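(* Let $k$ be a field (not necessarily algebraically closed). Let $Q$ be the quiver with four vertices $1,2,3,4$ and exactly nine arrows: two arrows $1\to 2$, two arrows $2\to 1$, one arrow $2\to 3$, two arrows $3\to 4$ and two arrows $4\to 3$. Let $r\subseteq kQ$ be the two-sided ideal generated by all paths of length $1$, and let $A=kQ/r^2$. Then the mutation quiver $Q(s\tau\text{-tilt } A)$ has at least $4$ connected components.
   Context: Let $A$ be a finite-dimensional $k$-algebra. $\mathrm{mod}\,A$ denotes finite-dimensional left $A$-modules, identified with representations of the quiver of $A$ (satisfying the relations). $\tau$ is the Auslander-Reiten translation. A module $M$ is $\tau$-rigid if $\mathrm{Hom}_A(M,\tau M)=0$. A module is basic if no two of its nonzero indecomposable summands in a decomposition are isomorphic. $|X|$ is the number of pairwise non-isomorphic indecomposable direct summands of $X$. A $\tau$-rigid pair is a pair $(M,P)$ of basic modules with $M$ $\tau$-rigid, $P$ projective and $\mathrm{Hom}_A(P,M)=0$. It is support $\tau$-tilting if $|M|+|P|=|A|$ and almost complete support $\tau$-tilting if $|M|+|P|=|A|-1$. A pair $(N,R)$ is a summand of $(M,P)$ if $N$ is a summand of $M$ and $R$ is a summand of $P$. Every almost complete support $\tau$-tilting pair is a summand of exactly two distinct (up to isomorphism) support $\tau$-tilting pairs; these two are called mutations of each other. $\mathrm{add}\,M$ is the category of modules all of whose indecomposable summands are summands of $M$, and $\mathrm{Fac}\,M$ is the category of quotients of modules in $\mathrm{add}\,M$. If $T_1=(M_1,P_1)$ and $T_2=(M_2,P_2)$ are mutations of each other, then one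 of $\mathrm{Fac}\,M_1$, $\mathrm{Fac}\,M_2$ is strictly contained in the other; $T_2$ is a left mutation of $T_1$ if $\mathrm{Fac}\,M_2\subset \mathrm{Fac}\,M_1$. The mutation quiver $Q(s\tau\text{-tilt } A)$ has as vertices the isomorphism classes of support $\tau$-tilting pairs over $A$, and an arrow $T_1\to T_2$ exactly when $T_2$ is a left mutation of $T_1$. Connected components are those of the underlying undirected graph. *)

(* Defs.v *)
From HB Require Import structures.
From mathcomp Require Import all_boot all_order all_algebra all_field.
From mathcomp Require Import finmap.
From mathcomp.multinomials Require Import monalg.
From Stdlib Require Import Relations.

Set Implicit Arguments.
Unset Strict Implicit.
Unset Printing Implicit Defensive.

Import GRing.Theory.
Local Open Scope ring_scope.

Record quiver := Quiver {
  vert : finType;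
  arr : finType;
  src : arr -> vert;
  tgt : arr -> vert }.

Section Paths.
Variable Q : quiver.

(* [walk i s]: the arrows of s, listed in the order in which they are
   traversed, form a path starting at i; [walk_end i s] is its end point. *)
Fixpoint walk (i : vert Q) (s : seq (arr Q)) : bool :=
  if s is a :: s' then (src a == i) && walk (tgt a) s' else true.

Definition walk_end (i : vert Q) (s : seq (arr Q)) : vert Q :=
  last i (map (@tgt Q) s).

Record qpath := QPath {
  qpath_val : vert Q * seq (arr Q);
  qpathP : walk qpath_val.1 qpath_val.2 }.

HB.instance Definition _ := [isSub for qpath_val].
HB.instance Definition _ := [Choice of qpath by <:].

Definition pstart (p : qpath) : vert Q := (val p).1.
Definition parrows (p : qpath) : seq (arr Q) := (val p).2.
Definition pend (p : qpath) : vert Q := walk_end (pstart p) (parrows p).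

Definition triv_path (i : vert Q) : qpath := @QPath (i, [::]) isT.

Lemma arr_walk (a : arr Q) : walk (src a) [:: a].
Proof. by rewrite /= eqxx. Qed.

Definition arr_path (a : arr Q) : qpath :=
  @QPath (src a, [:: a]) (arr_walk a).

Lemma walk_cat i s t : walk i (s ++ t) = walk i s && walk (walk_end i s) t.
Proof. by elim: s i => //= a s IHs i; rewrite IHs andbA. Qed.

Lemma walk_end_cat i s t : walk_end i (s ++ t) = walk_end (walk_end i s) t.
Proof. by rewrite /walk_end map_cat last_cat. Qed.

(* The composite "p after q", when it exists. *)
Definition pcomp (p q : qpath) : option qpath :=
  if pstart p == pend q then insub (pstart q, parrows q ++ parrows p) else None.

Lemma pcompP p q : pstart p = pend q ->
  {r | pcomp p q = Some r & val r = (pstart q, parrows q ++ parrows p)}.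
Proof.
move=> e; rewrite /pcomp e eqxx.
have w : walk (pstart q) (parrows q ++ parrows p).
  rewrite walk_cat -/(pend q) -e; apply/andP; split; exact: qpathP.
by exists (@QPath (_, _) w) => //; rewrite insubT; congr Some; apply: val_inj.
Qed.

Lemma pcompN p q : pstart p != pend q -> pcomp p q = None.
Proof. by rewrite /pcomp => /negbTE->. Qed.

Lemma pcompA p q r :
  obind (pcomp p) (pcomp q r) = obind (fun s => pcomp s r) (pcomp p q).
Proof.
have [eqr | nqr] := eqVneq (pstart q) (pend r); last first.
  rewrite pcompN //=; have [epq | npq] := eqVneq (pstart p) (pend q).
    have [s -> sE] := pcompP epq; rewrite /= pcompN //.
    by rewrite /pstart sE.
  by rewrite pcompN.
have [s -> sE] := pcompP eqr; rewrite /=.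
have es : pend s = pend q.
  by rewrite {1}/pend /pstart /parrows sE /= walk_end_cat -/(pend r) -eqr.
have [epq | npq] := eqVneq (pstart p) (pend q); last first.
  by rewrite !pcompN // es.
have [t -> tE] := pcompP epq; rewrite /=.
have [|u -> uE] := @pcompP p s; first by rewrite es.
have [|v -> vE] := @pcompP t r; first by rewrite /pstart tE.
by congr Some; apply: val_inj; rewrite uE vE /pstart /parrows sE tE /= catA.
Qed.

End Paths.

Section LinearExtension.
Variables (k : fieldType) (K : choiceType) (V : lmodType k).
Implicit Types (f : K -> V) (x : {malg k[K]}).

Definition lin_ext f x : V := \sum_(p <- msupp x) x@_p *: f p.

Lemma lin_extEw (d : {fset K}) f x : (msupp x `<=` d)%fset ->
  lin_ext f x = \sum_(p <- d) x@_p *: f p.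
Proof.
move=> sub; rewrite /lin_ext (big_fset_incl _ sub) // => p _ pN.
by rewrite mcoeff_outdom // scale0r.
Qed.

Lemma lin_ext_linear f : linear (lin_ext f).
Proof.
move=> c x y; pose d := (msupp x `|` msupp y `|` msupp (c *: x + y))%fset.
rewrite !(@lin_extEw d) ?/d.
- rewrite scaler_sumr -big_split /=; apply: eq_bigr => p _.
  by rewrite mcoeffD mcoeffZ scalerDl scalerA.
- by rewrite -fsetUA fsetUCA fsubsetUl.
- by rewrite -fsetUA fsubsetUl.
- by rewrite fsubsetUr.
Qed.

HB.instance Definition _ f :=
  GRing.isLinear.Build k {malg k[K]} V _ (lin_ext f) (lin_ext_linear f).

Lemma lin_extU f p : lin_ext f << p >> = f p.
Proof.
rewrite /lin_ext msuppU oner_eq0 big_seq_fset1.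
by rewrite mcoeffUU scale1r.
Qed.

Lemma lin_ext_sum (I : Type) (s : seq I) (c : I -> k) (F : I -> K -> V) x :
  lin_ext (fun p => \sum_(i <- s) c i *: F i p) x =
  \sum_(i <- s) c i *: lin_ext (F i) x.
Proof.
under [RHS]eq_bigr do rewrite scaler_sumr.
rewrite exchange_big /=; apply: eq_bigr => p _; rewrite scaler_sumr.
by apply: eq_bigr => i _; rewrite !scalerA mulrC.
Qed.

Lemma lin_ext_linr (W : lmodType k) (g : {linear V -> W}) f x :
  g (lin_ext f x) = \sum_(p <- msupp x) x@_p *: g (f p).
Proof. by rewrite linear_sum; apply: eq_bigr => p _; rewrite linearZ. Qed.

End LinearExtension.

Section PathAlgebra.
Variables (k : fieldType) (Q : quiver).

(* kQ: the k-vector space on the set of paths of Q, with the bilinear product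
   p * q = "p after q" if the paths compose, and 0 otherwise.  With this order
   of composition left modules over kQ are (covariant) representations of Q. *)
Definition path_alg : Type := {malg k[qpath Q]}.
HB.instance Definition _ := GRing.Lmodule.on path_alg.

Definition of_path (p : qpath Q) : path_alg := << p >>.

Definition of_opath (o : option (qpath Q)) : path_alg := oapp of_path 0 o.

Definition path_one : path_alg := \sum_(i : vert Q) of_path (triv_path i).

Lemma path_algE (x : path_alg) : x = \sum_(p <- msupp x) x@_p *: of_path p.
Proof.
rewrite [LHS]monalgE; apply: eq_bigr => p _; apply/malgP => q.
by rewrite [RHS]mcoeffZ [in LHS]mcoeffU [in RHS]mcoeffU mulrnAr mulr1.
Qed.

Definition path_mul (x y : path_alg) : path_alg :=
  lin_ext (fun p => lin_ext (fun q => of_opath (pcomp p q)) y) x.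

Lemma path_mul_linl y : linear (path_mul^~ y).
Proof. by move=> c x x'; rewrite /path_mul linearP. Qed.

Lemma path_mul_linr x : linear (path_mul x).
Proof.
move=> c y y'; rewrite /path_mul {1 3}/lin_ext {3}/lin_ext.
rewrite scaler_sumr -big_split /=; apply: eq_bigr => p _.
by rewrite linearP scalerDr !scalerA mulrC.
Qed.

HB.instance Definition _ x :=
  GRing.isLinear.Build k path_alg path_alg _ (path_mul x) (path_mul_linr x).

Definition path_mulr y x := path_mul x y.
HB.instance Definition _ y :=
  GRing.isLinear.Build k path_alg path_alg _ (path_mulr y) (path_mul_linl y).

Lemma path_mulUU p q :
  path_mul (of_path p) (of_path q) = of_opath (pcomp p q).
Proof. by rewrite /path_mul !lin_extU. Qed.

(* Unification may otherwise unfold these down to finite maps. *)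
#[global] Opaque of_path path_mul.

Lemma path_alg_ext (f g : {linear path_alg -> path_alg}) :
  (forall p, f (of_path p) = g (of_path p)) -> f =1 g.
Proof.
move=> fg x; rewrite (path_algE x) !linear_sum; apply: eq_bigr => p _.
by rewrite !linearZ fg.
Qed.

Lemma path_mulA : associative path_mul.
Proof.
move=> x y z.
pose l1 := path_mulr (path_mul y z); pose l2 := path_mulr z \o path_mulr y.
rewrite -[LHS]/(l1 x) -[RHS]/(l2 x) {}/l1 {}/l2; apply: path_alg_ext => p /=.
pose l1 := path_mul (of_path p) \o path_mulr z.
pose l2 := path_mulr z \o path_mul (of_path p).
rewrite -[LHS]/(l1 y) -[RHS]/(l2 y) {}/l1 {}/l2; apply: path_alg_ext => q /=.
pose l1 := path_mul (of_path p) \o path_mul (of_path q).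
pose l2 := path_mul (path_mul (of_path p) (of_path q)).
rewrite -[LHS]/(l1 z) -[RHS]/(l2 z) {}/l1 {}/l2; apply: path_alg_ext => r /=.
transitivity (path_mul (of_path p) (of_opath (pcomp q r))).
  by congr (path_mul _ _); exact: path_mulUU.
transitivity (path_mul (of_opath (pcomp p q)) (of_path r)); last first.
  by congr (path_mul _ _); symmetry; exact: path_mulUU.
have -> : path_mul (of_path p) (of_opath (pcomp q r)) =
          of_opath (obind (pcomp p) (pcomp q r)).
  by case: (pcomp q r) => [s|] /=; [exact: path_mulUU | exact: linear0].
rewrite pcompA; case: (pcomp p q) => [s|] /=.
  by symmetry; exact: path_mulUU.
by rewrite -[RHS]/(path_mulr (of_path r) 0) linear0.
Qed.

Lemma path_mul1l : left_id path_one path_mul.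
Proof.
move=> x; rewrite -[RHS]/(idfun x); apply: path_alg_ext => p /=.
rewrite -[LHS]/(path_mulr (of_path p) path_one) linear_sum.
rewrite (bigD1 (pend p)) //= big1 ?addr0 => [|i ne].
  rewrite /path_mulr (path_mulUU (triv_path _) p).
  have [|r -> rE] := @pcompP _ (triv_path (pend p)) p; first by [].
  congr of_path; apply: val_inj; rewrite rE /pstart /parrows /= cats0.
  by case: (val p).
by rewrite /path_mulr (path_mulUU (triv_path i) p) pcompN.
Qed.

Lemma path_mul1r : right_id path_one path_mul.
Proof.
move=> x; rewrite -[RHS]/(idfun x) -[LHS]/(path_mulr path_one x).
apply: path_alg_ext => p /=; rewrite /path_mulr linear_sum.
rewrite (bigD1 (pstart p)) //= big1 ?addr0 => [|i ne].
  rewrite (path_mulUU p (triv_path _)).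
  have [|r -> rE] := @pcompP _ p (triv_path (pstart p)); first by [].
  by congr of_path; apply: val_inj; rewrite rE /pstart /parrows /=; case: (val p).
by rewrite (path_mulUU p (triv_path i)) pcompN //= eq_sym.
Qed.

Lemma path_mulDl : left_distributive path_mul +%R.
Proof. by move=> x y z; rewrite -[LHS]/(path_mulr z (x + y)) linearD. Qed.

Lemma path_mulDr : right_distributive path_mul +%R.
Proof. by move=> x y z; rewrite linearD. Qed.

HB.instance Definition _ := GRing.Zmodule_isPzRing.Build path_alg
  path_mulA path_mul1l path_mul1r path_mulDl path_mulDr.

Lemma of_pathM p q : of_path p * of_path q = of_opath (pcomp p q).
Proof. exact: path_mulUU. Qed.

End PathAlgebra.

Arguments of_path {k Q} p.

Inductive ideal_gen (R : pzRingType) (S : R -> Prop) : R -> Prop :=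
| ideal_gen0 : ideal_gen S 0
| ideal_genD x y : ideal_gen S x -> ideal_gen S y -> ideal_gen S (x + y)
| ideal_genM a x b : S x -> ideal_gen S (a * x * b).

Definition ideal_mul (R : pzRingType) (I J : R -> Prop) : R -> Prop :=
  ideal_gen (fun z => exists x y, [/\ I x, J y & z = x * y]).

Definition arrow_ideal (k : fieldType) (Q : quiver) : path_alg k Q -> Prop :=
  ideal_gen (fun x => exists a : arr Q, x = of_path (arr_path a)).

Definition arrow_ideal_sq (k : fieldType) (Q : quiver) : path_alg k Q -> Prop :=
  ideal_mul (@arrow_ideal k Q) (@arrow_ideal k Q).

Section Modules.
Variables (k : fieldType) (A : falgType k).

Record fmod := FMod {
  carrier :> vectType k;
  act : A -> 'End(carrier);
  act_linear : linear act;
  act1 : act 1 = \1%VF;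
  actM : forall a b, act (a * b) = (act a \o act b)%VF }.

HB.instance Definition _ (M : fmod) :=
  GRing.isLinear.Build k A 'End(M) _ (@act M) (@act_linear M).

Definition is_hom (M N : fmod) (f : 'Hom(M, N)) : Prop :=
  forall a, (f \o act M a)%VF = (act N a \o f)%VF.

Definition injective_hom (M N : fmod) (f : 'Hom(M, N)) : Prop :=
  is_hom f /\ lker f = 0%VS.
Definition surjective_hom (M N : fmod) (f : 'Hom(M, N)) : Prop :=
  is_hom f /\ limg f = fullv.

Definition iso (M N : fmod) : Prop :=
  exists f : 'Hom(M, N), injective_hom f /\ surjective_hom f.

Definition is_zero (M : fmod) : Prop := \dim {: M} = 0%N.

Definition hom_zero (M N : fmod) : Prop :=
  forall f : 'Hom(M, N), is_hom f -> f = 0.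

Lemma reg_actM (a b : A) : amull (a * b) = (amull a \o amull b)%VF.
Proof. by apply/lfunP => x; rewrite !lfunE /= !lfunE /= mulrA. Qed.

Definition regmod : fmod :=
  @FMod A (@amull k A) (@amull_is_linear k A) (amull1 A) reg_actM.

Section DirectSum.
Variables M N : fmod.

Definition dsum_fun (a : A) (v : M * N) : M * N :=
  (act M a v.1, act N a v.2).

Lemma dsum_fun_linear a : linear (dsum_fun a).
Proof. by move=> c u v; rewrite /dsum_fun /= !linearP. Qed.

HB.instance Definition _ a :=
  GRing.isLinear.Build k (M * N)%type (M * N)%type _ (dsum_fun a)
    (dsum_fun_linear a).

Definition dsum_act (a : A) : 'End((M * N)%type) := linfun (dsum_fun a).

Lemma dsum_act_linear : linear dsum_act.
Proof.
move=> c a b; apply/lfunP => v; rewrite !lfunE /= scale_lfunE !lfunE /=.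
by rewrite /dsum_fun !linearP !lfunE /= !scale_lfunE.
Qed.

Lemma dsum_act1 : dsum_act 1 = \1%VF.
Proof.
by apply/lfunP => -[u v]; rewrite !lfunE /= /dsum_fun /= !act1 !lfunE.
Qed.

Lemma dsum_actM a b : dsum_act (a * b) = (dsum_act a \o dsum_act b)%VF.
Proof.
apply/lfunP => v; rewrite comp_lfunE !lfunE /= /dsum_fun /=.
by rewrite !actM !comp_lfunE.
Qed.

Definition dsum : fmod := FMod dsum_act_linear dsum_act1 dsum_actM.

End DirectSum.

Definition summand (X M : fmod) : Prop := exists Y, iso M (dsum X Y).

Definition indecomposable (M : fmod) : Prop :=
  ~ is_zero M /\ forall X Y, iso M (dsum X Y) -> is_zero X \/ is_zero Y.

Definition basic (M : fmod) : Prop :=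
  forall X Y Z, indecomposable X -> indecomposable Y ->
    iso M (dsum X (dsum Y Z)) -> ~ iso X Y.

(* [num_ind M n] is |M| = n: s enumerates the indecomposable summands of M
   without repetition up to isomorphism. *)
Definition num_ind (M : fmod) (n : nat) : Prop :=
  exists s : 'I_n -> fmod,
    [/\ forall i, indecomposable (s i) /\ summand (s i) M,
        forall i j, iso (s i) (s j) -> i = j &
        forall X, indecomposable X -> summand X M -> exists i, iso X (s i)].

Definition in_add (M X : fmod) : Prop :=
  forall Y, indecomposable Y -> summand Y X -> summand Y M.

Definition in_Fac (M N : fmod) : Prop :=
  exists2 X, in_add M X & exists f : 'Hom(X, N), surjective_hom f.

Definition projective (P : fmod) : Prop :=
  forall (M N : fmod) (g : 'Hom(M, N)) (f : 'Hom(P, N)),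
    surjective_hom g -> is_hom f ->
    exists2 h : 'Hom(P, M), is_hom h & (g \o h)%VF = f.

Definition submodule (M : fmod) (U : {vspace M}) : Prop :=
  forall a, (act M a @: U <= U)%VS.

Definition superfluous (M : fmod) (K : {vspace M}) : Prop :=
  forall U : {vspace M}, submodule U -> (U + K)%VS = fullv -> U = fullv.

Definition min_proj_presentation (P1 P0 M : fmod)
    (p1 : 'Hom(P1, P0)) (p0 : 'Hom(P0, M)) : Prop :=
  [/\ projective P1 /\ projective P0,
      is_hom p1,
      surjective_hom p0,
      limg p1 = lker p0 &
      superfluous (lker p0) /\ superfluous (lker p1)].

Section HomSpace.
Variables M N : fmod.

Definition defect (a : A) (f : 'Hom(M, N)) : 'Hom(M, N) :=
  ((f \o act M a) - (act N a \o f))%VF.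

Lemma defect_linear a : linear (defect a).
Proof.
move=> c f g; apply/lfunP => v; rewrite /defect.
by rewrite !(add_lfunE, opp_lfunE, scale_lfunE, comp_lfunE) linearP
           scalerBr opprD addrACA.
Qed.

HB.instance Definition _ a :=
  GRing.isLinear.Build k 'Hom(M, N) 'Hom(M, N) _ (defect a) (defect_linear a).

Definition hom_space : {vspace 'Hom(M, N)} :=
  (\bigcap_(a <- vbasis {: A}) lker (linfun (defect a)))%VS.

Lemma memv_bigcap (T : eqType) (V : vectType k) (s : seq T)
    (F : T -> {vspace V}) v :
  reflect {in s, forall i, v \in F i} (v \in \bigcap_(i <- s) F i)%VS.
Proof.
elim: s => [|i s IHs]; first by rewrite big_nil memvf; constructor.
rewrite big_cons memv_cap; apply: (iffP andP) => [[vi /IHs vs] j|vs].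
  by rewrite inE => /predU1P[-> | /vs].
by split; [apply: vs; rewrite mem_head |
           apply/IHs => j js; apply: vs; rewrite inE js orbT].
Qed.

Lemma hom_spaceP f : reflect (is_hom f) (f \in hom_space).
Proof.
apply: (iffP (memv_bigcap _ _ _)) => [fA a | fA a _]; last first.
  by rewrite memv_ker lfunE /= /defect fA subrr.
apply/eqP; rewrite -subr_eq0 -/(defect a f).
rewrite (coord_vbasis (memvf a)) /defect !linear_sum; apply/eqP.
pose c i := coord (vbasis {: A}) i a.
have actE (L : fmod) : \sum_i act L (c i *: (vbasis {: A})`_i) =
                       \sum_i c i *: act L (vbasis {: A})`_i.
  by apply: eq_bigr => i _; rewrite linearZ.
rewrite !actE {actE}.
apply/lfunP => v; rewrite add_lfunE opp_lfunE !comp_lfunE !sum_lfunE linear_sum.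
rewrite zero_lfunE -sumrB big1 // => i _; rewrite !scale_lfunE linearZ -scalerBr.
have /fA : (vbasis {: A})`_i \in vbasis {: A} by rewrite mem_nth ?size_tuple.
rewrite memv_ker lfunE /= /defect => /eqP/lfunP/(_ v).
by rewrite add_lfunE opp_lfunE !comp_lfunE zero_lfunE => ->; rewrite scaler0.
Qed.

End HomSpace.

(* Hom_A(M, A), a right A-module via (h a)(m) = h(m) a. *)
Definition hom_reg (M : fmod) : vectType k := subvs_of (hom_space M regmod).

Section Precomp.
Variables (M N : fmod) (p : 'Hom(M, N)).

Definition precomp_fun (h : hom_reg N) : hom_reg M :=
  vsproj (hom_space M regmod) (vsval h \o p)%VF.

Lemma precomp_fun_linear : linear precomp_fun.
Proof.
move=> c h g; rewrite /precomp_fun -linearP; congr vsproj.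
by rewrite linearP comp_lfunDl comp_lfunZl.
Qed.

HB.instance Definition _ :=
  GRing.isLinear.Build k (hom_reg N) (hom_reg M) _ precomp_fun
    precomp_fun_linear.

(* When p is a homomorphism, [vsproj] acts as the identity here and this is
   the map h |-> h p (see [precompE]). *)
Definition precomp : 'Hom(hom_reg N, hom_reg M) := linfun precomp_fun.

Lemma precompE : is_hom p -> forall h, vsval (precomp h) = (vsval h \o p)%VF.
Proof.
move=> pA h; rewrite lfunE /= vsprojK //.
apply: (introT (@hom_spaceP M regmod _)) => a.
have hA : is_hom (vsval h) := elimT (hom_spaceP _) (subvsP h).
by rewrite -comp_lfunA pA !comp_lfunA hA.
Qed.

End Precomp.

Section Nakayama.
Variable M : fmod.

Definition rmul_fun (a : A) (h : hom_reg M) : hom_reg M :=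
  vsproj (hom_space M regmod) (amulr a \o vsval h : 'Hom(M, regmod))%VF.

Lemma rmul_fun_linear a : linear (rmul_fun a).
Proof.
move=> c h g; rewrite /rmul_fun -linearP; congr vsproj.
by rewrite linearP comp_lfunDr comp_lfunZr.
Qed.

HB.instance Definition _ a :=
  GRing.isLinear.Build k (hom_reg M) (hom_reg M) _ (rmul_fun a)
    (rmul_fun_linear a).

Definition rmul (a : A) : 'End(hom_reg M) := linfun (rmul_fun a).

Lemma rmulE a h m : vsval (rmul a h) m = vsval h m * a :> A.
Proof.
rewrite lfunE /= vsprojK ?lfunE /= ?lfunE //.
apply: (introT (@hom_spaceP M regmod _)) => b.
have : is_hom (vsval h) := elimT (hom_spaceP _) (subvsP h).
move=> /(_ b)/lfunP hA; apply/lfunP => v; have := hA v.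
by rewrite !comp_lfunE /= => ->; rewrite !lfunE /= mulrA.
Qed.

Lemma rmul_linear : linear rmul.
Proof.
move=> c a b; apply/lfunP => h; apply: val_inj; apply/lfunP => m.
rewrite add_lfunE scale_lfunE [val (_ + _)]linearP add_lfunE scale_lfunE.
by rewrite /= !rmulE mulrDr scalerAr.
Qed.

Lemma rmul1 : rmul 1 = \1%VF.
Proof.
apply/lfunP => h; apply: val_inj; apply/lfunP => m.
by rewrite id_lfunE /= rmulE mulr1.
Qed.

Lemma rmulM a b : rmul (a * b) = (rmul b \o rmul a)%VF.
Proof.
apply/lfunP => h; apply: val_inj; apply/lfunP => m.
by rewrite comp_lfunE /= !rmulE mulrA.
Qed.

(* The k-dual of Hom_A(M, A), on which A acts by (a phi)(h) = phi (h a). *)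
Definition nak_carrier : vectType k := 'Hom(hom_reg M, k^o).

Definition nak_fun (a : A) (phi : nak_carrier) : nak_carrier :=
  (phi \o rmul a)%VF.

Lemma nak_fun_linear a : linear (nak_fun a).
Proof. by move=> c f g; rewrite /nak_fun comp_lfunDl comp_lfunZl. Qed.

HB.instance Definition _ a :=
  GRing.isLinear.Build k nak_carrier nak_carrier _ (nak_fun a)
    (nak_fun_linear a).

Definition nak_act (a : A) : 'End(nak_carrier) := linfun (nak_fun a).

Lemma nak_act_linear : linear nak_act.
Proof.
move=> c a b; apply/lfunP => f; rewrite add_lfunE scale_lfunE !lfunE /=.
by rewrite /nak_fun rmul_linear comp_lfunDr comp_lfunZr.
Qed.

Lemma nak_act1 : nak_act 1 = \1%VF.
Proof. by apply/lfunP => f; rewrite !lfunE /= /nak_fun rmul1 comp_lfun1r. Qed.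

Lemma nak_actM a b : nak_act (a * b) = (nak_act a \o nak_act b)%VF.
Proof.
apply/lfunP => f; rewrite comp_lfunE !lfunE /= /nak_fun rmulM.
by rewrite comp_lfunA.
Qed.

Definition nakayama : fmod := FMod nak_act_linear nak_act1 nak_actM.

End Nakayama.

Section NakayamaMap.
Variables (M N : fmod) (p : 'Hom(M, N)).

Definition nak_map_fun (phi : nakayama M) : nakayama N :=
  (phi \o precomp p)%VF.

Lemma nak_map_fun_linear : linear nak_map_fun.
Proof. by move=> c f g; rewrite /nak_map_fun comp_lfunDl comp_lfunZl. Qed.

HB.instance Definition _ :=
  GRing.isLinear.Build k (nakayama M) (nakayama N) _ nak_map_fun
    nak_map_fun_linear.

Definition nakayama_map : 'Hom(nakayama M, nakayama N) := linfun nak_map_fun.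

End NakayamaMap.

(* N is (isomorphic to) tau M = D Tr M: for a minimal projective presentation
   P1 -> P0 -> M -> 0, the sequence 0 -> N -> nu P1 -> nu P0 is exact, where
   nu = D Hom_A(-, A).  Such an N is unique up to isomorphism. *)
Definition is_tau (M N : fmod) : Prop :=
  exists (P1 P0 : fmod) (p1 : 'Hom(P1, P0)) (p0 : 'Hom(P0, M)),
    min_proj_presentation p1 p0 /\
    exists2 i : 'Hom(N, nakayama P1),
      injective_hom i & limg i = lker (nakayama_map p1).

Definition tau_rigid (M : fmod) : Prop :=
  exists2 N, is_tau M N & hom_zero M N.

Definition mod_pair : Type := (fmod * fmod)%type.

Implicit Types T U : mod_pair.

Definition tau_rigid_pair T : Prop :=
  [/\ basic T.1, basic T.2, tau_rigid T.1, projective T.2 & hom_zero T.2 T.1].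

Definition support_tau_tilting T : Prop :=
  tau_rigid_pair T /\
  exists m p n, [/\ num_ind T.1 m, num_ind T.2 p, num_ind regmod n &
                    (m + p)%N = n].

Definition almost_support_tau_tilting T : Prop :=
  tau_rigid_pair T /\
  exists m p n, [/\ num_ind T.1 m, num_ind T.2 p, num_ind regmod n &
                    (m + p).+1 = n].

Definition pair_summand U T : Prop := summand U.1 T.1 /\ summand U.2 T.2.

Definition pair_iso T U : Prop := iso T.1 U.1 /\ iso T.2 U.2.

Definition mutations T1 T2 : Prop :=
  [/\ support_tau_tilting T1, support_tau_tilting T2, ~ pair_iso T1 T2 &
      exists U, [/\ almost_support_tau_tilting U,
                    pair_summand U T1 & pair_summand U T2]].

Definition Fac_proper (M N : fmod) : Prop :=
  (forall X, in_Fac M X -> in_Fac N X) /\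
  ~ (forall X, in_Fac N X -> in_Fac M X).

Definition left_mutation T1 T2 : Prop :=
  mutations T1 T2 /\ Fac_proper T2.1 T1.1.

(* The vertices of Q(stau-tilt A) are the elements of [stau_tilt] taken up to
   [pair_iso], and its arrows T1 -> T2 are given by [left_mutation]. *)
Definition stau_tilt : Type := {T : mod_pair | support_tau_tilting T}.

(* The same connected component: the equivalence relation generated by the
   arrows, on vertices up to isomorphism. *)
Definition same_component : relation stau_tilt :=
  clos_refl_sym_trans stau_tilt
    (fun X Y => pair_iso (sval X) (sval Y) \/
                left_mutation (sval X) (sval Y)).

Definition at_least_components (n : nat) : Prop :=
  exists X : 'I_n -> stau_tilt,
    forall i j, same_component (X i) (X j) -> i = j.

End Modules.

(* The vertices 1, 2, 3, 4 are numbered 0, 1, 2, 3. *)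
Definition v1 : 'I_4 := @Ordinal 4 0 isT.
Definition v2 : 'I_4 := @Ordinal 4 1 isT.
Definition v3 : 'I_4 := @Ordinal 4 2 isT.
Definition v4 : 'I_4 := @Ordinal 4 3 isT.

Definition arrow_table : 9.-tuple ('I_4 * 'I_4) :=
  [tuple (v1, v2); (v1, v2); (v2, v1); (v2, v1); (v2, v3);
         (v3, v4); (v3, v4); (v4, v3); (v4, v3)].

Definition quiver9 : quiver :=
  @Quiver 'I_4 'I_9 (fun a => (tnth arrow_table a).1)
                    (fun a => (tnth arrow_table a).2).

(* Main.v *)
From HB Require Import structures.
Require Import Defs.
From mathcomp Require Import all_boot all_order all_algebra all_field.
From mathcomp.multinomials Require Import monalg.
From mathcomp Require Import zify ring.

(** Attach to a pair T = (M, P) and a vertex i the numbers a_i, b_i and p_i: the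
    dimensions at i of the top of M, of the relations of M (the second term of
    its minimal projective presentation) and of the top of P.  The differences
    a_i - b_i - p_i form the g-vector of T, and [bsign] adds up those at the two
    vertices of a block {1, 2} or {3, 4} of the quiver.  The sign of [bsign] on
    each block is constant on the connected components of the mutation quiver
    ([component_bsign]), and the four support tau-tilting pairs (A / A e A, A e),
    where e is the sum of the vertices in a union of blocks ([vpair]), realise
    the four combinations of signs.

    That mutation preserves signs rests on three facts about tau-rigid pairs.

    - Two summands have no opposite signs on a block ([bsign_mul_ge0]).  At each
      vertex, a_i > 0 excludes b_i > 0 and p_i > 0 ([sign_coherence],
      [hom_zero_vdim]), so the only case that needs an argument is that of tops
      at i and relations at j, for {i, j} the block.  There the two arrows from
      i to j make the relations into a representation of the Kronecker quiver
      of dimensions w = b_j and v = a_i ([kron]).  For X and Y without mutual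
      extensions the Euler form gives
      dim Hom(X, Y) + dim Hom(Y, X) = 2 (v - w) (v' - w') ([kext_sign]).

    - The sign vanishes only for a pair that is zero on the block ([bsign_eq0]),
      since (v - w)^2 = dim End X ([krigid_neq]).

    - A pair that is zero on one of the blocks has at most two indecomposable
      summands ([num_ind_block]).  In the Kronecker case, Hom(X, Y) or Hom(Y, X)
      is zero for distinct X and Y ([happel_ringel]), which means that the ratios
      w / (v - w) of X and Y differ by exactly 1; this cannot hold for three
      representations at once ([no_three_kreps]).

    Hence an almost complete pair U, which has three indecomposable summands, is
    nonzero on both blocks, and its signs are those of both of its completions.

    Rigidity is used as a statement on extensions.  If Hom(M, tau M) = 0, then
    extensions of summands of M by quotients of summands of M split
    ([tau_rigid_split]).  Over an algebra with radical square zero, any family of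
    linear maps, one for each arrow, from the tops to the radical or to a simple
    quotient defines such an extension ([derivation_inner]), so that the
    vanishing of Ext passes from modules to Kronecker representations
    ([kron_ext0]). *)

Set Implicit Arguments.
Unset Strict Implicit.
Unset Printing Implicit Defensive.

Import Order.TTheory GRing.Theory Num.Theory.
Local Open Scope ring_scope.

Section LinearMaps.
Variable k : fieldType.

Lemma linfunE (U V : vectType k) (f : U -> V) : linear f -> linfun f =1 f.
Proof.
move=> lf x; pose F := GRing.isLinear.Build k U V _ f lf.
pose G : {linear U -> V} := HB.pack f F.
exact: (lfunE G).
Qed.

Lemma lker_eq0P (U V : vectType k) (f : 'Hom(U, V)) :
  (forall x, f x = 0 -> x = 0) <-> lker f = 0%VS.
Proof.
split=> [H|H x fx0].
  apply/eqP; rewrite -subv0; apply/subvP => x; rewrite memv_ker memv0.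
  by move/eqP/H->.
by apply/eqP; rewrite -memv0 -H memv_ker fx0.
Qed.

Lemma limg_fullP (U V : vectType k) (f : 'Hom(U, V)) :
  (forall y, exists x, f x = y) <-> limg f = fullv.
Proof.
split=> [H|H y].
  apply/eqP; rewrite eqEsubv subvf; apply/subvP => y _.
  by have [x <-] := H y; rewrite memv_img ?memvf.
by have /memv_imgP[x _ ->] : y \in limg f by [rewrite H memvf]; exists x.
Qed.

Lemma limgP (U V : vectType k) (f : 'Hom(U, V)) y :
  reflect (exists x, y = f x) (y \in limg f).
Proof.
apply: (iffP memv_imgP) => [[x _ ->]|[x ->]]; first by exists x.
by exists x; rewrite ?memvf.
Qed.

Lemma functional_sep (V : vectType k) (U : {vspace V}) v : v \notin U ->
  exists2 l : 'Hom(V, k^o), forall u, u \in U -> l u = 0 & l v = 1.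
Proof.
move=> vU; pose w := v - projv U v.
have w0 : w != 0.
  by apply: contraNneq vU => /eqP; rewrite subr_eq0 => /eqP->; exact: memv_proj.
pose c : 'Hom(V, k^o) :=
  (linfun (coord [tuple w] ord0 : V -> k^o) \o (\1 - projv U))%VF.
have cE x : c x = coord [tuple w] ord0 (x - projv U x).
  by rewrite comp_lfunE lfunE add_lfunE opp_lfunE id_lfunE.
exists c => [u uU|]; first by rewrite cE projv_id // subrr linear0.
rewrite cE -/w; have fw : free [tuple w] by rewrite seq1_free.
exact: (etrans (coord_free ord0 ord0 fw) (congr1 (fun b : bool => b%:R) (eqxx _))).
Qed.

Lemma vsproj_id (V : vectType k) (U : {vspace V}) v :
  v \in U -> vsval (vsproj U v) = v.
Proof. exact: vsprojK. Qed.

Lemma lfun_bij_inv (U V : vectType k) (f : 'Hom(U, V)) :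
  lker f = 0%VS -> limg f = fullv ->
  exists g : 'Hom(V, U), cancel f g /\ cancel g f.
Proof.
move=> kf lf; exists (f^-1)%VF; split; first by apply: lker0_lfunK; apply/eqP.
by move=> y; apply: limg_lfunVK; rewrite lf memvf.
Qed.

End LinearMaps.

(** * Finite-dimensional modules *)

Section Modules.
Variables (k : fieldType) (A : falgType k).
Implicit Types M N X Y Z : fmod A.

Lemma is_homP M N (f : 'Hom(M, N)) :
  is_hom f <-> forall a x, f (act M a x) = act N a (f x).
Proof.
split=> [fA a x|fA a]; first by rewrite -!comp_lfunE fA.
by apply/lfunP => x; rewrite !comp_lfunE fA.
Qed.

Lemma homE M N (f : 'Hom(M, N)) : is_hom f ->
  forall a x, f (act M a x) = act N a (f x).
Proof. by move/is_homP. Qed.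

Lemma act1E M x : act M 1 x = x.
Proof. by rewrite act1 id_lfunE. Qed.

Lemma actME M a b x : act M (a * b) x = act M a (act M b x).
Proof. by rewrite actM comp_lfunE. Qed.

Lemma hom_id M : is_hom (\1%VF : 'Hom(M, M)).
Proof. by apply/is_homP => a x; rewrite !id_lfunE. Qed.

Lemma hom_comp M N X (g : 'Hom(N, X)) (f : 'Hom(M, N)) :
  is_hom g -> is_hom f -> is_hom (g \o f)%VF.
Proof.
by move=> /is_homP gA /is_homP fA; apply/is_homP => a x; rewrite !comp_lfunE fA gA.
Qed.

Lemma hom_sub M N (f g : 'Hom(M, N)) : is_hom f -> is_hom g -> is_hom (f - g).
Proof.
move=> /is_homP fA /is_homP gA; apply/is_homP => a x.
by rewrite !(add_lfunE, opp_lfunE) fA gA linearB.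
Qed.

Lemma hom_add M N (f g : 'Hom(M, N)) : is_hom f -> is_hom g -> is_hom (f + g).
Proof.
move=> /is_homP fA /is_homP gA; apply/is_homP => a x.
by rewrite !add_lfunE fA gA linearD.
Qed.

Lemma hom_zero_is_hom M N : is_hom (0 : 'Hom(M, N)).
Proof. by apply/is_homP => a x; rewrite !zero_lfunE linear0. Qed.

Lemma iso_of_inv M N (f : 'Hom(M, N)) (g : 'Hom(N, M)) :
  is_hom f -> cancel f g -> cancel g f -> iso M N.
Proof.
move=> fA fK gK; exists f; split; split=> //.
  by apply/lker_eq0P => x fx0; rewrite -[x]fK fx0 linear0.
by apply/limg_fullP => y; exists (g y).
Qed.

Lemma iso_inv M N : iso M N ->
  exists (f : 'Hom(M, N)) (g : 'Hom(N, M)),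
    [/\ is_hom f, is_hom g, cancel f g & cancel g f].
Proof.
case=> f [[fA kf] [_ lf]]; have [g [fK gK]] := lfun_bij_inv kf lf.
exists f, g; split=> //; apply/is_homP => a x.
by apply: (can_inj fK); rewrite gK (homE fA) gK.
Qed.

Lemma iso_sym M N : iso M N -> iso N M.
Proof. by case/iso_inv => f [g [fA gA fK gK]]; apply: (@iso_of_inv _ _ g f). Qed.

Lemma iso_trans M N X : iso M N -> iso N X -> iso M X.
Proof.
case/iso_inv => f [g [fA gA fK gK]] /iso_inv[f' [g' [fA' gA' fK' gK']]].
apply: (@iso_of_inv _ _ (f' \o f)%VF (g \o g')%VF); first exact: hom_comp.
  by move=> x; rewrite !comp_lfunE fK' fK.
by move=> x; rewrite !comp_lfunE gK gK'.
Qed.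

Lemma is_zeroP M : is_zero M <-> forall x : M, x = 0.
Proof.
split=> [/eqP|H]; rewrite /is_zero.
  by rewrite dimv_eq0 => /eqP H x; apply/eqP; rewrite -memv0 -H memvf.
by apply/eqP; rewrite dimv_eq0 -subv0; apply/subvP => x _; rewrite (H x) mem0v.
Qed.

(** ** Submodules and direct sums *)

Section Submod.
Variables (M : fmod A) (U : {vspace M}) (stU : submodule U).

Lemma stable_mem a x : x \in U -> act M a x \in U.
Proof. by move=> xU; apply: (subvP (stU a)); apply: memv_img. Qed.

Definition sub_act (a : A) : 'End(subvs_of U) :=
  (linfun (vsproj U) \o act M a \o linfun vsval)%VF.

Lemma sub_actE a x : vsval (sub_act a x) = act M a (vsval x).
Proof.
by rewrite !comp_lfunE !lfunE /= vsproj_id // stable_mem // subvsP.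
Qed.

Lemma sub_act_linear : linear sub_act.
Proof.
move=> c a b; apply/lfunP => x; apply: val_inj => /=.
rewrite add_lfunE scale_lfunE [RHS]linearP /= !sub_actE linearP /=.
by rewrite add_lfunE scale_lfunE.
Qed.

Lemma sub_act1 : sub_act 1 = \1%VF.
Proof.
by apply/lfunP => x; apply: val_inj; rewrite /= sub_actE act1E id_lfunE.
Qed.

Lemma sub_actM a b : sub_act (a * b) = (sub_act a \o sub_act b)%VF.
Proof.
apply/lfunP => x; apply: val_inj.
by rewrite comp_lfunE /= !sub_actE actME.
Qed.

Definition submod : fmod A := FMod sub_act_linear sub_act1 sub_actM.

Definition subincl : 'Hom(submod, M) := linfun vsval.

Lemma subinclE x : subincl x = vsval x.
Proof. exact: lfunE. Qed.

Lemma subincl_hom : is_hom subincl.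
Proof. by apply/is_homP => a x; rewrite !subinclE sub_actE. Qed.

Lemma subincl_inj x : subincl x = 0 -> x = 0.
Proof. by rewrite subinclE => x0; apply: val_inj. Qed.

Lemma limg_subincl : limg subincl = U.
Proof.
apply/vspaceP => x; apply/limgP/idP => [[y ->]|xU].
  by rewrite subinclE subvsP.
by exists (vsproj U x); rewrite subinclE vsproj_id.
Qed.

Lemma corestrict N (f : 'Hom(N, M)) : is_hom f -> (limg f <= U)%VS ->
  exists2 g : 'Hom(N, submod), is_hom g & (subincl \o g)%VF = f.
Proof.
move=> fA /subvP fU; exists (linfun (vsproj U) \o f)%VF.
  apply/is_homP => a x; apply: val_inj; rewrite /= sub_actE !comp_lfunE !lfunE /=.
  by rewrite !vsproj_id ?fU ?memv_img ?memvf // (homE fA).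
apply/lfunP => x; rewrite !comp_lfunE subinclE lfunE /= vsproj_id //.
by rewrite fU ?memv_img ?memvf.
Qed.

End Submod.

Lemma submodule_lker M N (f : 'Hom(M, N)) : is_hom f -> submodule (lker f).
Proof.
move=> /is_homP fA a; apply/subvP => _ /memv_imgP[x + ->].
by rewrite !memv_ker fA => /eqP->; rewrite linear0.
Qed.

Lemma submodule_limg M N (f : 'Hom(M, N)) : is_hom f -> submodule (limg f).
Proof.
move=> /is_homP fA a; apply/subvP => _ /memv_imgP[_ /limgP[x ->] ->].
by rewrite -fA memv_img ?memvf.
Qed.

Section DirectSums.
Variables M N : fmod A.

Definition inl_hom : 'Hom(M, dsum M N) :=
  linfun ((fun x => (x, 0)) : M -> (M * N)%type).
Definition inr_hom : 'Hom(N, dsum M N) :=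
  linfun ((fun y => (0, y)) : N -> (M * N)%type).
Definition prl_hom : 'Hom(dsum M N, M) := linfun (fst : (M * N)%type -> M).
Definition prr_hom : 'Hom(dsum M N, N) := linfun (snd : (M * N)%type -> N).

Lemma inl_homE x : inl_hom x = (x, 0).
Proof.
apply: (linfunE (f := (fun x => (x, 0)) : M -> (M * N)%type)) => c u v.
by congr pair; rewrite /= ?scaler0 ?addr0.
Qed.
Lemma inr_homE y : inr_hom y = (0, y).
Proof.
apply: (linfunE (f := (fun y => (0, y)) : N -> (M * N)%type)) => c u v.
by congr pair; rewrite /= ?scaler0 ?addr0.
Qed.
Lemma prl_homE z : prl_hom z = z.1.
Proof. exact: (lfunE (fst : {linear (M * N)%type -> M})). Qed.
Lemma prr_homE z : prr_hom z = z.2.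
Proof. exact: (lfunE (snd : {linear (M * N)%type -> N})). Qed.

Lemma dsum_actE a z : act (dsum M N) a z = (act M a z.1, act N a z.2).
Proof. exact: (lfunE (dsum_fun (M := M) (N := N) a)). Qed.

Lemma inl_hom_hom : is_hom inl_hom.
Proof.
by apply/is_homP => a x; rewrite dsum_actE !inl_homE /= linear0.
Qed.
Lemma inr_hom_hom : is_hom inr_hom.
Proof.
by apply/is_homP => a x; rewrite dsum_actE !inr_homE /= linear0.
Qed.
Lemma prl_hom_hom : is_hom prl_hom.
Proof. by apply/is_homP => a x; rewrite dsum_actE !prl_homE. Qed.
Lemma prr_hom_hom : is_hom prr_hom.
Proof. by apply/is_homP => a x; rewrite dsum_actE !prr_homE. Qed.

End DirectSums.

(** Retracts compose without mention of a complement; by [retract_summand]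
    they are the summands. *)
Definition retract X M := exists (i : 'Hom(X, M)) (p : 'Hom(M, X)),
  [/\ is_hom i, is_hom p & cancel i p].

Lemma retract_refl M : retract M M.
Proof. by exists \1%VF, \1%VF; split; [exact: hom_id..|move=> x; rewrite !id_lfunE]. Qed.

Lemma retract_trans X Y M : retract X Y -> retract Y M -> retract X M.
Proof.
case=> i [p [iA pA iK]] [j [q [jA qA jK]]].
exists (j \o i)%VF, (p \o q)%VF; split; try exact: hom_comp.
by move=> x; rewrite !comp_lfunE jK iK.
Qed.

Lemma iso_retract X M : iso X M -> retract X M.
Proof. by case/iso_inv => f [g [fA gA fK gK]]; exists f, g. Qed.

Lemma retract_dsuml X Y : retract X (dsum X Y).
Proof.
exists (inl_hom X Y), (prl_hom X Y); split;
  [exact: inl_hom_hom|exact: prl_hom_hom|].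
by move=> x; rewrite prl_homE inl_homE.
Qed.

Lemma summand_retract X M : summand X M -> retract X M.
Proof.
case=> Y /iso_sym/iso_retract XY; exact: retract_trans (retract_dsuml X Y) XY.
Qed.

Lemma internal_dsum M (U V : {vspace M}) (stU : submodule U) (stV : submodule V) :
  (U + V)%VS = fullv -> (U :&: V)%VS = 0%VS ->
  iso M (dsum (submod stU) (submod stV)).
Proof.
move=> UV UV0; apply: iso_sym.
pose f : 'Hom(dsum (submod stU) (submod stV), M) :=
  ((subincl stU \o prl_hom (submod stU) (submod stV))
   + (subincl stV \o prr_hom (submod stU) (submod stV)))%VF.
have fE t : f t = vsval t.1 + vsval t.2.
  by rewrite add_lfunE !comp_lfunE !subinclE prl_homE prr_homE.
have fA : is_hom f.
  by apply: hom_add; apply: hom_comp;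
    [exact: subincl_hom|exact: prl_hom_hom|exact: subincl_hom|exact: prr_hom_hom].
exists f; split; split=> //.
  apply/lker_eq0P => -[u v]; rewrite fE /= => /eqP; rewrite addr_eq0 => /eqP uv.
  have : vsval u \in (U :&: V)%VS by rewrite memv_cap subvsP uv memvN subvsP.
  rewrite UV0 memv0 => /eqP u0; have := uv; rewrite u0 => /esym/eqP.
  by rewrite oppr_eq0 => /eqP v0; congr pair; apply: val_inj.
apply/limg_fullP => x; have : x \in (U + V)%VS by rewrite UV memvf.
case/memv_addP => u uU [v vV ->].
by exists (vsproj U u, vsproj V v); rewrite fE /= !vsproj_id.
Qed.

Lemma retract_ker X M (i : 'Hom(X, M)) (p : 'Hom(M, X)) (iA : is_hom i) (pA : is_hom p) :
  cancel i p -> iso M (dsum X (submod (submodule_lker pA))).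
Proof.
move=> iK.
apply: iso_trans (internal_dsum (submodule_limg iA) (submodule_lker pA) _ _) _.
- apply/eqP; rewrite eqEsubv subvf /=; apply/subvP => x _.
  rewrite -[x](subrK (i (p x))) addrC memv_add ?memv_img ?memvf //.
  by rewrite memv_ker linearB /= iK subrr.
- apply/eqP; rewrite -subv0; apply/subvP => _ /memv_capP[/limgP[x ->]].
  by rewrite memv_ker iK => /eqP->; rewrite linear0 mem0v.
pose K := submod (submodule_lker pA); pose I := submod (submodule_limg iA).
have [i' i'A i'E] := corestrict (submodule_limg iA) iA (subvv _).
pose f : 'Hom(dsum X K, dsum I K) :=
  ((inl_hom I K \o i' \o prl_hom X K) + (inr_hom I K \o prr_hom X K))%VF.
have fE t : f t = (i' t.1, t.2).
  rewrite add_lfunE !comp_lfunE prl_homE prr_homE inl_homE inr_homE.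
  by congr pair; rewrite ?addr0 ?add0r.
pose g : 'Hom(dsum I K, dsum X K) :=
  ((inl_hom X K \o p \o subincl _ \o prl_hom I K) + (inr_hom X K \o prr_hom I K))%VF.
have gE t : g t = (p (vsval t.1), t.2).
  rewrite add_lfunE !comp_lfunE prl_homE prr_homE inl_homE inr_homE subinclE.
  by congr pair; rewrite ?addr0 ?add0r.
have i'V x : vsval (i' x) = i x by have := congr1 (fun h : 'Hom(X, M) => h x) i'E; rewrite /= comp_lfunE subinclE.
apply: iso_sym; apply: (@iso_of_inv _ _ f g).
- by apply: hom_add; do ![exact: inl_hom_hom|exact: inr_hom_hom|exact: prl_hom_hom
    |exact: prr_hom_hom|exact: i'A|apply: hom_comp].
- by move=> [x y]; rewrite fE gE /= i'V iK.
- move=> [x y]; rewrite gE fE /=; congr pair; apply: val_inj; rewrite /= i'V.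
  by case/limgP: (subvsP x) => z ->; rewrite iK.
Qed.

Lemma retract_summand X M : retract X M -> summand X M.
Proof. by case=> i [p [iA pA iK]]; exists (submod (submodule_lker pA)); exact: retract_ker iK. Qed.

Lemma summand_iso X M N : iso M N -> summand X M -> summand X N.
Proof. by move=> MN [Y MXY]; exists Y; exact: iso_trans (iso_sym MN) MXY. Qed.

(** ** Fitting's lemma *)

Fixpoint lpow (V : vectType k) (f : 'End(V)) n : 'End(V) :=
  if n is n'.+1 then (f \o lpow f n')%VF else \1%VF.

Lemma lpowD (V : vectType k) (f : 'End(V)) m n x :
  lpow f (m + n) x = lpow f m (lpow f n x).
Proof.
by elim: m => [|m IHm] /=; rewrite ?id_lfunE // !comp_lfunE IHm.
Qed.

Lemma lpowSr (V : vectType k) (f : 'End(V)) n x :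
  lpow f n.+1 x = lpow f n (f x).
Proof. by rewrite -addn1 lpowD /= comp_lfunE id_lfunE. Qed.

Lemma lpow_hom M (f : 'End(M)) n : @is_hom _ _ M M f -> @is_hom _ _ M M (lpow f n).
Proof.
by move=> fA; elim: n => [|n IHn] /=; [exact: hom_id|exact: (@hom_comp M M M)].
Qed.

Lemma lker_lpow_stab (V : vectType k) (f : 'End(V)) :
  exists n, forall m, lker (lpow f (n + m)) = lker (lpow f n).
Proof.
have mono n : (lker (lpow f n) <= lker (lpow f n.+1))%VS.
  by apply/subvP => x; rewrite !memv_ker /= comp_lfunE => /eqP->; rewrite linear0.
have step n : lker (lpow f n.+1) = lker (lpow f n) ->
    lker (lpow f n.+2) = lker (lpow f n.+1).
  move=> e; apply/vspaceP => x; rewrite !memv_ker !(lpowSr f _ x) -!memv_ker.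
  by rewrite e.
have [n en] : exists n, lker (lpow f n.+1) = lker (lpow f n).
  have H n : (exists m, lker (lpow f m.+1) = lker (lpow f m)) \/
             (n <= \dim (lker (lpow f n)))%N.
    elim: n => [|n [|IHn]]; [by right|by left|].
    have [/eqP e|ne] := boolP (lker (lpow f n.+1) == lker (lpow f n)).
      by left; exists n.
    right; apply: leq_ltn_trans IHn _.
    by rewrite (ltn_leqif (dimv_leqif_eq (mono n))) eq_sym.
  case: (H (\dim {: V}).+1) => // lt; have := dimvS (subvf (lker (lpow f (\dim {: V}).+1))).
  by rewrite leqNgt lt.
have stab m : lker (lpow f (n + m).+1) = lker (lpow f (n + m)).
  by elim: m => [|m IHm]; rewrite ?addn0 // addnS; apply: step.
by exists n; elim=> [|m IHm]; rewrite ?addn0 // addnS stab.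
Qed.

(** Fitting's lemma: X is the direct sum of the kernel and the image of a high
    power of f. *)
Lemma indec_endo X (f : 'End(X)) : indecomposable X -> @is_hom _ _ X X f ->
  (exists n, lpow f n = 0) \/ (lker f = 0%VS /\ limg f = fullv).
Proof.
move=> [_ iX] fA; have [n nP] := lker_lpow_stab f.
pose g : 'Hom(X, X) := lpow f n; have gA : is_hom g by exact: lpow_hom.
have gE x : lpow f (n + n) x = g (g x) by rewrite lpowD.
have cap0 : (lker g :&: limg g)%VS = 0%VS.
  apply/eqP; rewrite -subv0; apply/subvP => y /memv_capP[ky /limgP[x yE]].
  by move: ky; rewrite yE memv_ker -gE -memv_ker nP memv_ker memv0.
have sum1 : (lker g + limg g)%VS = fullv.
  apply/eqP; rewrite eqEdim subvf dimv_disjoint_sum //=.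
  by have := limg_ker_dim g fullv; rewrite capfv => ->.
have XE := internal_dsum (submodule_lker gA) (submodule_limg gA) sum1 cap0.
have [/is_zeroP k0|/is_zeroP l0] := iX _ _ XE; [right|left].
  have inj x : f x = 0 -> x = 0.
    move=> fx; have xk : x \in lker g.
    by rewrite -(nP 1%N) memv_ker addn1 lpowSr fx linear0.
    by have := k0 (vsproj _ x) => /(congr1 vsval); rewrite vsproj_id.
  have kf : lker f = 0%VS by apply/lker_eq0P.
  split=> //; apply/eqP; rewrite eqEdim subvf /=.
  by have := limg_ker_dim f fullv; rewrite kf capv0 dimv0 add0n => ->.
exists n; apply/lfunP => x; rewrite zero_lfunE.
have := l0 (vsproj _ (g x)) => /(congr1 vsval).
by rewrite vsproj_id ?memv_img ?memvf.
Qed.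

Lemma lpow_fix (V : vectType k) (l : V -> k) (f : 'End(V)) n x :
  (forall y, l (f y) = l y) -> l (lpow f n x) = l x.
Proof. by move=> lf; elim: n => [|n IHn] /=; rewrite ?id_lfunE // comp_lfunE lf. Qed.

Lemma indec_endo_bij X (f : 'End(X)) (l : 'Hom(X, k^o)) :
  indecomposable X -> @is_hom _ _ X X f -> l != 0 ->
  (forall y, l (f y) = l y) -> lker f = 0%VS /\ limg f = fullv.
Proof.
move=> iX fA l0 lf; have [[n fn]|//] := indec_endo iX fA.
case/negP: l0; apply/eqP/lfunP => x; rewrite zero_lfunE.
by rewrite -(lpow_fix n x lf) fn zero_lfunE linear0.
Qed.

(** The composites of f and g preserve a nonzero functional, so they are not
    nilpotent and must be bijective. This takes the place of the Krull-Schmidt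
    theorem: for functionals on tops, such f and g are easy to find. *)
Lemma indec_iso_functional X Y (lX : 'Hom(X, k^o)) (lY : 'Hom(Y, k^o))
    (f : 'Hom(X, Y)) (g : 'Hom(Y, X)) :
  indecomposable X -> indecomposable Y -> lX != 0 -> lY != 0 ->
  is_hom f -> is_hom g ->
  (forall x, lY (f x) = lX x) -> (forall y, lX (g y) = lY y) -> iso X Y.
Proof.
move=> iX iY lX0 lY0 fA gA lf lg.
have [kgf _] : lker (g \o f)%VF = 0%VS /\ limg (g \o f)%VF = fullv.
  apply: (indec_endo_bij (l := lX)) => // [|x]; first exact: hom_comp.
  by rewrite comp_lfunE lg lf.
have [_ lfg] : lker (f \o g)%VF = 0%VS /\ limg (f \o g)%VF = fullv.
  apply: (indec_endo_bij (l := lY)) => // [|x]; first exact: hom_comp.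
  by rewrite comp_lfunE lf lg.
exists f; split; split=> //.
  apply/lker_eq0P => x fx; apply: ((lker_eq0P _).2 kgf).
  by rewrite comp_lfunE fx linear0.
apply/limg_fullP => y; have [z <-] := (limg_fullP _).2 lfg y.
by exists (g z); rewrite comp_lfunE.
Qed.

(** ** The number of indecomposable summands *)

Lemma num_ind_le M m n : num_ind M m -> num_ind M n -> (m <= n)%N.
Proof.
case=> s [sP sI sE] [t [tP tI tE]].
have H i : exists j, iso (s i) (t j) by apply: tE; case: (sP i).
have [f fP] := fin_all_exists H.
have fI : injective f.
  by move=> i j e; apply: sI; apply: iso_trans (fP i) _; rewrite e; apply: iso_sym.
by have := leq_card f fI; rewrite !card_ord.
Qed.

Lemma num_ind_uniq M m n : num_ind M m -> num_ind M n -> m = n.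
Proof.
by move=> Hm Hn; apply/eqP; rewrite eqn_leq (num_ind_le Hm Hn) (num_ind_le Hn Hm).
Qed.

Lemma num_ind_iso M N n : iso M N -> num_ind M n -> num_ind N n.
Proof.
move=> MN [s [sP sI sE]]; exists s; split=> // [i|X iX XN].
  by have [iS sM] := sP i; split=> //; exact: summand_iso sM.
by apply: sE => //; exact: summand_iso (iso_sym MN) XN.
Qed.

End Modules.

(** * Rigidity and extensions *)

Section TauRigid.
Variables (k : fieldType) (A : falgType k).
Implicit Types M N X Y Z P E : fmod A.

Section Power.
Variables (M : fmod A) (n : nat).

Definition pow_act (a : A) : 'End({ffun 'I_n -> M}) :=
  linfun (fun u : {ffun 'I_n -> M} => [ffun i => act M a (u i)]).

Lemma pow_actE a u : pow_act a u = [ffun i => act M a (u i)].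
Proof.
rewrite /pow_act linfunE // => c v w; apply/ffunP => i.
by rewrite !ffunE linearP.
Qed.

Lemma pow_act_linear : linear pow_act.
Proof.
move=> c a b; apply/lfunP => u; rewrite add_lfunE scale_lfunE !pow_actE.
by apply/ffunP => i; rewrite !ffunE linearP add_lfunE scale_lfunE.
Qed.

Lemma pow_act1 : pow_act 1 = \1%VF.
Proof.
by apply/lfunP => u; rewrite pow_actE id_lfunE; apply/ffunP => i; rewrite ffunE act1E.
Qed.

Lemma pow_actM a b : pow_act (a * b) = (pow_act a \o pow_act b)%VF.
Proof.
apply/lfunP => u; rewrite comp_lfunE !pow_actE; apply/ffunP => i.
by rewrite !ffunE actME.
Qed.

Definition pow_mod : fmod A := FMod pow_act_linear pow_act1 pow_actM.

Lemma act_powE a (u : pow_mod) : act pow_mod a u = [ffun i => act M a (u i)].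
Proof. exact: pow_actE. Qed.

End Power.

(** P is a retract of the free module on a basis b of P, and the maps xi are
    the coordinates of the section. *)
Lemma dual_basis P : projective P ->
  exists n (xi : 'I_n -> 'Hom(P, regmod A)) (b : 'I_n -> P),
    (forall j, is_hom (xi j)) /\
    forall x, x = \sum_j act P (xi j x : A) (b j).
Proof.
move=> Pproj; pose n := \dim {: P}; pose b (j : 'I_n) := (vbasis {: P})`_j.
pose F := pow_mod (regmod A) n.
pose s : 'Hom(F, P) :=
  linfun (fun u : {ffun 'I_n -> A} => \sum_j act P (u j) (b j)).
have sE (u : {ffun 'I_n -> A}) : s u = \sum_j act P (u j) (b j).
  rewrite /s linfunE // => c v w; rewrite scaler_sumr -big_split /=.
  by apply: eq_bigr => j _; rewrite !ffunE linearP add_lfunE scale_lfunE.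
have sA : is_hom s.
  apply/is_homP => a u; rewrite act_powE !sE linear_sum.
  apply: eq_bigr => j _; rewrite ffunE lfunE /=.
  by rewrite actME.
have ss : surjective_hom s.
  split=> //; apply/limg_fullP => x.
  exists [ffun j => coord (vbasis {: P}) j x *: 1]; rewrite sE.
  rewrite [RHS](coord_vbasis (memvf x)); apply: eq_bigr => j _.
  by rewrite ffunE linearZ scale_lfunE act1E.
have [h hA hE] := Pproj _ _ s \1%VF ss (hom_id P).
pose xi j : 'Hom(P, regmod A) :=
  (linfun (fun u : {ffun 'I_n -> A} => u j) \o h)%VF.
have xiE j x : xi j x = h x j.
  by rewrite /xi comp_lfunE linfunE // => c u v; rewrite !ffunE.
exists n, xi, b; split=> [j|x].
  apply/is_homP => a x; by rewrite !xiE (homE hA) act_powE ffunE.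
rewrite -{1}[x]id_lfunE -hE comp_lfunE sE.
by apply: eq_bigr => j _; rewrite xiE.
Qed.

Lemma proj_lift_image P E Y (f : 'Hom(P, E)) (q : 'Hom(Y, E)) :
  projective P -> is_hom f -> is_hom q -> (limg f <= limg q)%VS ->
  exists2 g : 'Hom(P, Y), is_hom g & (q \o g)%VF = f.
Proof.
move=> Pproj fA qA fq; have [f' f'A f'E] := corestrict (submodule_limg qA) fA fq.
have [q' q'A q'E] := corestrict (submodule_limg qA) qA (subvv _).
have q's : surjective_hom q'.
  split=> //; apply/limg_fullP => z; have /limgP[y zy] := subvsP z.
  exists y; apply: val_inj; rewrite /= zy.
  by have := congr1 (fun h : 'Hom(Y, E) => h y) q'E; rewrite comp_lfunE subinclE.
have [g gA gE] := Pproj _ _ q' f' q's f'A; exists g => //.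
have -> : (q \o g)%VF = (subincl (submodule_limg qA) \o q' \o g)%VF.
  by congr comp_lfun; rewrite q'E.
by rewrite -comp_lfunA gE.
Qed.

(** By the dual basis lemma, the maps that send x to xi x . m span Hom(P, M). *)
Lemma hom_functional P M (l : 'Hom(subvs_of (hom_space P M), k^o)) :
  projective P ->
  (forall (xi : 'Hom(P, regmod A)) (m : M), is_hom xi ->
     forall g : 'Hom(P, M), is_hom g -> (forall x, g x = act M (xi x : A) m) ->
     l (vsproj (hom_space P M) g) = 0) ->
  l = 0.
Proof.
move=> /dual_basis[n [xi [b [xiA bE]]]] H; apply/lfunP => u; rewrite zero_lfunE.
have uA : is_hom (vsval u) := elimT (hom_spaceP _) (subvsP u).
pose g j : 'Hom(P, M) :=
  linfun (fun x => act M (xi j x : A) (vsval u (b j))).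
have gE j x : g j x = act M (xi j x : A) (vsval u (b j)).
  rewrite /g linfunE // => c v w; rewrite linearP.
  by rewrite (linearP (act M)) add_lfunE scale_lfunE.
have gA j : is_hom (g j).
  apply/is_homP => a x; rewrite !gE (homE (xiA j)) -actME.
  by congr (act M _ _); rewrite lfunE.
have uE : vsval u = \sum_j g j.
  apply/lfunP => x; rewrite {1}[x]bE linear_sum sum_lfunE.
  by apply: eq_bigr => j _; rewrite /= gE (homE uA).
rewrite -[u]vsvalK uE !linear_sum big1 // => j _.
exact: (H (xi j) (vsval u (b j)) (xiA j) (g j) (gA j) (gE j)).
Qed.

(** A functional on Hom(P1, M) that kills all maps factoring through p1 is the
    same thing as a homomorphism from M to the kernel of nu P1 -> nu P0, which
    is tau M. As Hom(M, tau M) = 0, every map P1 -> M factors through p1. *)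
Lemma tau_rigid_lift M : tau_rigid M ->
  exists (P1 P0 : fmod A) (p1 : 'Hom(P1, P0)) (p0 : 'Hom(P0, M)),
    [/\ projective P1 /\ projective P0, is_hom p1, surjective_hom p0,
        limg p1 = lker p0 &
        forall g : 'Hom(P1, M), is_hom g ->
          exists2 h : 'Hom(P0, M), is_hom h & (h \o p1)%VF = g].
Proof.
case=> N [P1 [P0 [p1 [p0 [[PP p1A p0s p10 _] [i [iA ik] il]]]]]] MN0.
exists P1, P0, p1, p0; split=> // g gA.
pose H1 := hom_space P1 M; pose H0 := hom_space P0 M.
pose c : 'Hom(subvs_of H0, subvs_of H1) :=
  linfun (fun h => vsproj H1 (vsval h \o p1)%VF).
have cE h : vsval (c h) = (vsval h \o p1)%VF.
  rewrite /c linfunE => [|x u v]; last first.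
    by rewrite -linearP; congr vsproj; rewrite linearP comp_lfunDl comp_lfunZl.
  rewrite vsproj_id //; apply/hom_spaceP; apply: hom_comp => //.
  by apply/hom_spaceP; exact: subvsP.
suff /limgP[h gE] : vsproj H1 g \in limg c.
  exists (vsval h); first by apply/hom_spaceP; exact: subvsP.
  by rewrite -cE -gE vsproj_id //; apply/hom_spaceP.
apply/negPn/negP => /functional_sep[l l0 l1].
suff l_eq0 : l = 0 by move/eqP: l1; rewrite l_eq0 zero_lfunE eq_sym oner_eq0.
have [P1proj P0proj] := PP; apply: hom_functional P1proj _.
(* The functional l, read as a homomorphism from M to nu P1. *)
pose ev m (xi : hom_reg P1) : 'Hom(P1, M) :=
  linfun (fun x => act M (vsval xi x : A) m).
have evE m xi x : ev m xi x = act M (vsval xi x : A) m.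
  rewrite /ev linfunE // => a v w; rewrite linearP.
  by rewrite (linearP (act M)) add_lfunE scale_lfunE.
have evA m xi : ev m xi \in H1.
  have xiA : is_hom (vsval xi) := elimT (hom_spaceP _) (subvsP xi).
  apply/hom_spaceP/is_homP => a x; rewrite !evE (homE xiA) -actME.
  by congr (act M _ _); rewrite lfunE.
pose th0 m : 'Hom(hom_reg P1, k^o) := linfun (fun xi => l (vsproj H1 (ev m xi))).
have th0E m xi : th0 m xi = l (vsproj H1 (ev m xi)).
  rewrite /th0 linfunE // => a v w; rewrite -!linearP; congr (l (vsproj _ _)).
  apply/lfunP => x; rewrite add_lfunE scale_lfunE !evE.
  by rewrite [vsval _]linearP add_lfunE scale_lfunE (linearP (act M))
     add_lfunE scale_lfunE.
pose th : 'Hom(M, nakayama P1) := linfun th0.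
have thE m : th m = th0 m.
  rewrite /th linfunE // => a u v; apply/lfunP => xi.
  rewrite add_lfunE scale_lfunE !th0E -!linearP; congr (l (vsproj _ _)).
  by apply/lfunP => x; rewrite add_lfunE scale_lfunE !evE linearP.
have thA : is_hom th.
  apply/is_homP => a m; rewrite !thE; apply/lfunP => xi.
  rewrite [act (nakayama P1) a _](lfunE (nak_fun (M := P1) a)) /= /nak_fun comp_lfunE !th0E.
  congr (l (vsproj _ _)); apply/lfunP => x; rewrite !evE rmulE actME //.
have thk : (limg th <= limg i)%VS.
  rewrite il; apply/subvP => _ /limgP[m ->]; rewrite memv_ker; apply/eqP.
  rewrite (lfunE (nak_map_fun p1)) /= /nak_map_fun thE; apply/lfunP => eta.
  rewrite comp_lfunE zero_lfunE th0E; apply: l0; apply/limgP.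
  have etaA : is_hom (vsval eta) := elimT (hom_spaceP _) (subvsP eta).
  pose h : 'Hom(P0, M) := linfun (fun x => act M (vsval eta x : A) m).
  have hE x : h x = act M (vsval eta x : A) m.
    rewrite /h linfunE // => a v w; rewrite linearP.
    by rewrite (linearP (act M)) add_lfunE scale_lfunE.
  have hA : h \in H0.
    apply/hom_spaceP/is_homP => a x; rewrite !hE (homE etaA) -actME.
    by congr (act M _ _); rewrite lfunE.
  exists (vsproj H0 h); apply: val_inj; rewrite [RHS]cE /= !vsproj_id //.
  by apply/lfunP => x; rewrite evE precompE // !comp_lfunE hE.
(* It lands in the image of N = tau M, so it is zero. *)
have [t tE] : exists t : 'Hom(M, N), (i \o t)%VF = th.
  exists (i^-1 \o th)%VF; apply/lfunP => m; rewrite !comp_lfunE limg_lfunVK //.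
  by apply: (subvP thk); rewrite memv_img ?memvf.
have itE m : i (t m) = th m by rewrite -tE comp_lfunE.
have tA : is_hom t.
  apply/is_homP => a m; apply/eqP; rewrite -subr_eq0; apply/eqP.
  apply: ((lker_eq0P i).2 ik); rewrite linearB /= (homE iA) !itE.
  by rewrite (homE thA) subrr.
have t0 := MN0 t tA.
move=> xi m xiA g' g'A g'E.
have := thE m; rewrite -tE t0 comp_lfun0r zero_lfunE => /esym th00.
have xiH : xi \in hom_space P1 (regmod A) by apply/hom_spaceP.
have := th0E m (vsproj (hom_space P1 (regmod A)) xi); rewrite th00 zero_lfunE => /esym.
suff -> : ev m (vsproj (hom_space P1 (regmod A)) xi) = g' by [].
by apply/lfunP => x; rewrite evE vsproj_id // g'E.
Qed.

(** The vanishing of Ext^1(M, Fac M), for summands of M. A lift of P0 -> X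
    through p is corrected by a map that factors through q, so that it kills
    the image of p1; the correction exists by [tau_rigid_lift]. *)
Lemma tau_rigid_split M X Y E (p : 'Hom(E, X)) (q : 'Hom(Y, E)) :
  tau_rigid M -> retract X M -> retract Y M ->
  surjective_hom p -> is_hom q -> limg q = lker p ->
  exists2 s : 'Hom(X, E), is_hom s & cancel s p.
Proof.
case/tau_rigid_lift => P1 [P0 [p1 [p0 [[P1p P0p] p1A [p0A p0s] p10 lift]]]].
move=> [i [r [iA rA iK]]] [j [t [jA tA jK]]] [pA ps] qA qp.
have [l lA lE] : exists2 l : 'Hom(P0, E), is_hom l & (p \o l)%VF = (r \o p0)%VF.
  by apply: P0p => //; exact: hom_comp.
have lE' x : p (l x) = r (p0 x) by rewrite -!comp_lfunE lE.
have p10E x : p0 (p1 x) = 0.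
  by apply/eqP; rewrite -memv_ker -p10 memv_img ?memvf.
have [u uA uE] : exists2 u : 'Hom(P1, Y), is_hom u & (q \o u)%VF = (l \o p1)%VF.
  apply: proj_lift_image => //; first exact: hom_comp.
  apply/subvP => _ /limgP[x ->]; rewrite qp memv_ker comp_lfunE lE' p10E.
  by rewrite linear0.
have [h hA hE] := lift (j \o u)%VF (hom_comp jA uA).
pose w : 'Hom(P0, E) := l - (q \o t \o h)%VF.
have wA : is_hom w by apply: hom_sub => //; do 2!apply: hom_comp => //.
have wp1 x : w (p1 x) = 0.
  rewrite add_lfunE opp_lfunE !comp_lfunE.
  have -> : h (p1 x) = j (u x) by rewrite -!comp_lfunE hE.
  by rewrite jK -!comp_lfunE uE subrr.
have w0 x : p0 x = 0 -> w x = 0.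
  move=> px; have : x \in limg p1 by rewrite p10 memv_ker px.
  by case/limgP => y ->.
have p0V m : p0 (p0^-1%VF m) = m by rewrite limg_lfunVK // p0s memvf.
pose s : 'Hom(M, E) := (w \o p0^-1)%VF.
have sE x : s (p0 x) = w x.
  apply/eqP; rewrite comp_lfunE -subr_eq0 -linearB /=; apply/eqP/w0.
  by rewrite linearB /= p0V subrr.
have sA : is_hom s.
  apply/is_homP => a m; rewrite -[m]p0V -(homE p0A) !sE.
  by rewrite (homE wA).
have pq y : p (q y) = 0 by apply/eqP; rewrite -memv_ker -qp memv_img ?memvf.
exists (s \o i)%VF; first exact: hom_comp.
move=> x; rewrite comp_lfunE -[i x]p0V sE add_lfunE opp_lfunE linearB /= lE' p0V.
by rewrite !comp_lfunE pq subr0 iK.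
Qed.

End TauRigid.

(** * Modules over a radical square zero algebra *)

(** What is used of kQ / r^2: the vertices and arrows form a basis, given by
    its coordinate functions, with the products dictated by the quiver. *)
Record radsq (k : fieldType) (A : falgType k) (Q : quiver) := RadSq {
  vx : vert Q -> A;
  ax : arr Q -> A;
  vx_mul : forall i j, vx i * vx j = if i == j then vx i else 0;
  vx_sum : \sum_i vx i = 1;
  vx_ax : forall i a, vx i * ax a = if i == tgt a then ax a else 0;
  ax_vx : forall a i, ax a * vx i = if i == src a then ax a else 0;
  ax_mul : forall a b, ax a * ax b = 0;
  vc : vert Q -> {linear A -> k^o};
  ac : arr Q -> {linear A -> k^o};
  coordE : forall x, x = \sum_i (vc i x : k) *: vx i + \sum_a (ac a x : k) *: ax a;
  vc_vx : forall i j, vc i (vx j) = (i == j)%:R;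
  vc_ax : forall i a, vc i (ax a) = 0;
  ac_vx : forall a i, ac a (vx i) = 0;
  ac_ax : forall a b, ac a (ax b) = (a == b)%:R }.

Section RadSqModules.
Variables (k : fieldType) (A : falgType k) (Q : quiver) (B : radsq A Q).
Implicit Types (M N X Y Z : fmod A) (i j : vert Q) (a b : arr Q).

Lemma radsq_ind (P : A -> Prop) :
  P 0 -> (forall (c : k) x y, P x -> P y -> P (c *: x + y)) ->
  (forall i, P (vx B i)) -> (forall a, P (ax B a)) -> forall x, P x.
Proof.
move=> P0 PD Pv Pa x; rewrite (coordE B x).
have sumP (I : finType) (c : I -> k) (f : I -> A) y :
    (forall l, P (f l)) -> P y -> P (\sum_l c l *: f l + y).
  move=> Pf Py; elim: (index_enum I) => [|l s IHs]; first by rewrite big_nil add0r.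
  by rewrite big_cons -addrA; apply: PD.
by apply: (sumP) => //; rewrite -[X in P X]addr0; apply: (sumP).
Qed.

Definition vop M i : 'End(M) := act M (vx B i).
Definition aop M a : 'End(M) := act M (ax B a).

Lemma vop_vop M i j x : vop M i (vop M j x) = if i == j then vop M i x else 0.
Proof.
by rewrite /vop -actME vx_mul; case: ifP => // _; rewrite linear0 zero_lfunE.
Qed.
Lemma vop_id M i x : vop M i (vop M i x) = vop M i x.
Proof. by rewrite vop_vop eqxx. Qed.
Lemma vop_sum M x : \sum_i vop M i x = x.
Proof. by rewrite -[RHS]act1E -(vx_sum B) linear_sum sum_lfunE. Qed.
Lemma vop_aop M i a x : vop M i (aop M a x) = if i == tgt a then aop M a x else 0.
Proof.
by rewrite /vop /aop -actME vx_ax; case: ifP => // _; rewrite linear0 zero_lfunE.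
Qed.
Lemma aop_vop M a i x : aop M a (vop M i x) = if i == src a then aop M a x else 0.
Proof.
by rewrite /vop /aop -actME ax_vx; case: ifP => // _; rewrite linear0 zero_lfunE.
Qed.
Lemma aop_src M a x : aop M a (vop M (src a) x) = aop M a x.
Proof. by rewrite aop_vop eqxx. Qed.
Lemma aop_aop M a b x : aop M a (aop M b x) = 0.
Proof. by rewrite /aop -actME ax_mul linear0 zero_lfunE. Qed.

Lemma hom_vop M N (f : 'Hom(M, N)) : is_hom f ->
  forall i x, f (vop M i x) = vop N i (f x).
Proof. by move=> fA i x; rewrite (homE fA). Qed.
Lemma hom_aop M N (f : 'Hom(M, N)) : is_hom f ->
  forall a x, f (aop M a x) = aop N a (f x).
Proof. by move=> fA a x; rewrite (homE fA). Qed.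

Lemma hom_of_ops M N (f : 'Hom(M, N)) :
  (forall i x, f (vop M i x) = vop N i (f x)) ->
  (forall a x, f (aop M a x) = aop N a (f x)) -> is_hom f.
Proof.
move=> fv fa; apply/is_homP => a x; elim/radsq_ind: a => //.
- by rewrite !linear0 !zero_lfunE linear0.
- by move=> c a b IHa IHb; rewrite !(linearP (act _)) /= !add_lfunE !scale_lfunE linearP
     /= IHa IHb.
- by move=> i; rewrite fv.
- by move=> a; rewrite fa.
Qed.

Section FromOperators.
Variables (V : vectType k) (ev : vert Q -> 'End(V)) (ea : arr Q -> 'End(V)).
Hypothesis evv : forall i j x, ev i (ev j x) = if i == j then ev i x else 0.
Hypothesis ev1 : forall x, \sum_i ev i x = x.
Hypothesis eva : forall i a x, ev i (ea a x) = if i == tgt a then ea a x else 0.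
Hypothesis eav : forall a i x, ea a (ev i x) = if i == src a then ea a x else 0.
Hypothesis eaa : forall a b x, ea a (ea b x) = 0.

Definition rep_act (x : A) : 'End(V) :=
  \sum_i (vc B i x : k) *: ev i + \sum_a (ac B a x : k) *: ea a.

Lemma rep_act_linear : linear rep_act.
Proof.
move=> c x y; rewrite /rep_act scalerDr !scaler_sumr addrACA -!big_split /=.
by congr (_ + _); apply: eq_bigr => i _; rewrite linearP scalerDl scalerA.
Qed.

HB.instance Definition _ :=
  GRing.isLinear.Build k A 'End(V) _ rep_act rep_act_linear.

Lemma rep_act_vx i : rep_act (vx B i) = ev i.
Proof.
rewrite /rep_act [X in _ + X]big1 ?addr0 => [|a _]; last by rewrite ac_vx scale0r.
rewrite (bigD1 i) //= vc_vx eqxx scale1r big1 ?addr0 // => j ji.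
by rewrite vc_vx (negbTE ji) scale0r.
Qed.

Lemma rep_act_ax a : rep_act (ax B a) = ea a.
Proof.
rewrite /rep_act [X in X + _]big1 ?add0r => [|i _]; last by rewrite vc_ax scale0r.
rewrite (bigD1 a) //= ac_ax eqxx scale1r big1 ?addr0 // => b ba.
by rewrite ac_ax (negbTE ba) scale0r.
Qed.

Lemma rep_act1 : rep_act 1 = \1%VF.
Proof.
rewrite -(vx_sum B) linear_sum; apply/lfunP => x; rewrite sum_lfunE id_lfunE.
by rewrite -[RHS]ev1; apply: eq_bigr => i _; rewrite /= rep_act_vx.
Qed.

Lemma rep_actM x y : rep_act (x * y) = (rep_act x \o rep_act y)%VF.
Proof.
elim/radsq_ind: x => [|c x x' IHx IHx'|i|a].
- by rewrite mul0r !linear0 comp_lfun0l.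
- rewrite mulrDl -scalerAl !linearP /= IHx IHx'.
  by rewrite (comp_lfunDl (c *: rep_act x)) comp_lfunZl.
- elim/radsq_ind: y => [|c y y' IHy IHy'|j|a].
  + by rewrite mulr0 !linear0 comp_lfun0r.
  + rewrite mulrDr -scalerAr !linearP /= IHy IHy'.
    by rewrite (comp_lfunDr _ (c *: rep_act y)) comp_lfunZr.
  + apply/lfunP => x; rewrite comp_lfunE vx_mul !rep_act_vx evv.
    by case: ifP; rewrite ?rep_act_vx // linear0 zero_lfunE.
  + apply/lfunP => x; rewrite comp_lfunE vx_ax !(rep_act_vx, rep_act_ax) eva.
    by case: ifP; rewrite ?rep_act_ax // linear0 zero_lfunE.
- elim/radsq_ind: y => [|c y y' IHy IHy'|j|b].
  + by rewrite mulr0 !linear0 comp_lfun0r.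
  + rewrite mulrDr -scalerAr !linearP /= IHy IHy'.
    by rewrite (comp_lfunDr _ (c *: rep_act y)) comp_lfunZr.
  + apply/lfunP => x; rewrite comp_lfunE ax_vx !(rep_act_vx, rep_act_ax) eav.
    by case: ifP; rewrite ?rep_act_ax // linear0 zero_lfunE.
  + apply/lfunP => x; rewrite comp_lfunE ax_mul !rep_act_ax eaa.
    by rewrite linear0 zero_lfunE.
Qed.

(** A module is the same as a vector space with operators for the vertices and
    the arrows that satisfy the relations of kQ / r^2. All modules below are
    built in this way. *)
Definition rep_mod : fmod A := FMod rep_act_linear rep_act1 rep_actM.

Lemma vop_rep i (x : rep_mod) : vop rep_mod i x = ev i x.
Proof. by rewrite /vop [act _ _]rep_act_vx. Qed.
Lemma aop_rep a (x : rep_mod) : aop rep_mod a x = ea a x.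
Proof. by rewrite /aop [act _ _]rep_act_ax. Qed.

End FromOperators.

(** ** The radical *)

Definition rad M : {vspace M} := (\sum_a limg (aop M a))%VS.

Lemma aop_rad M a x : aop M a x \in rad M.
Proof. by apply: (subvP (sumv_sup a _ _)) => //; rewrite memv_img ?memvf. Qed.

Lemma radP M x : reflect (exists u : arr Q -> M, x = \sum_a aop M a (u a)) (x \in rad M).
Proof.
apply: (iffP idP) => [/memv_sumP[v vP ->]|[u ->]]; last first.
  by apply: memv_suml => a _; exact: aop_rad.
have H a : exists y, v a = aop M a y by apply/limgP/vP.
have [u uP] := fin_all_exists H; exists u.
by apply: eq_bigr => a _.
Qed.

Lemma aop_of_rad M a x : x \in rad M -> aop M a x = 0.
Proof.
case/radP => u ->; rewrite linear_sum big1 // => b _; exact: aop_aop.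
Qed.

Lemma vop_of_rad M i x : x \in rad M -> vop M i x \in rad M.
Proof.
case/radP => u ->; rewrite linear_sum memv_suml // => a _ /=.
by rewrite vop_aop; case: ifP; rewrite ?aop_rad ?mem0v.
Qed.

Lemma hom_rad M N (f : 'Hom(M, N)) x : is_hom f -> x \in rad M -> f x \in rad N.
Proof.
move=> fA /radP[u ->]; rewrite linear_sum memv_suml // => a _ /=.
by rewrite (hom_aop fA) aop_rad.
Qed.

(** The arrows kill the radical, so that J M = J (U + J M) lies in U. *)
Lemma nakayama_rad M (U : {vspace M}) :
  (forall a x, x \in U -> aop M a x \in U) -> (U + rad M)%VS = fullv -> U = fullv.
Proof.
move=> Ua UM; apply/eqP; rewrite eqEsubv subvf -UM subv_add subvv /=.
apply/subvP => _ /radP[u ->]; apply: memv_suml => a _.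
have : u a \in (U + rad M)%VS by rewrite UM memvf.
case/memv_addP => v vU [w wr ->]; rewrite linearD /= (aop_of_rad a wr) addr0.
exact: Ua.
Qed.

Lemma superfluous_rad M (K : {vspace M}) : (K <= rad M)%VS -> superfluous K.
Proof.
move=> Kr U Usub UK; apply: nakayama_rad => [a x|].
  exact: stable_mem.
by apply/eqP; rewrite eqEsubv subvf -UK addvS.
Qed.

Lemma surj_of_top M N (f : 'Hom(M, N)) : is_hom f ->
  (forall y, exists x, y - f x \in rad N) -> limg f = fullv.
Proof.
move=> fA H; apply: nakayama_rad => [a _ /limgP[x ->]|].
  by rewrite -(hom_aop fA) memv_img ?memvf.
apply/eqP; rewrite eqEsubv subvf; apply/subvP => y _; have [x yx] := H y.
by rewrite -[y](subrK (f x)) addrC memv_add ?memv_img ?memvf.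
Qed.

Lemma rad_full_zero M : rad M = fullv -> is_zero M.
Proof.
move=> rM; have := @nakayama_rad M 0%VS; rewrite rM add0v.
by move=> H; rewrite /is_zero -H ?dimv0 // => a x; rewrite memv0 => /eqP->; rewrite linear0 mem0v.
Qed.

Lemma rad_surj M N (f : 'Hom(M, N)) : surjective_hom f -> (f @: rad M)%VS = rad N.
Proof.
case=> fA fs; apply/vspaceP => y; apply/memv_imgP/idP => [[x xr ->]|/radP[u ->]].
  exact: hom_rad.
have H a : exists x, f x = u a by apply: ((limg_fullP f).2 fs).
have [v vP] := fin_all_exists H; exists (\sum_a aop M a (v a)).
  by apply/radP; exists v.
by rewrite linear_sum; apply: eq_bigr => a _; rewrite /= (hom_aop fA) vP.
Qed.

(** ** Dimension counts *)

Definition vdim M i := \dim (limg (vop M i)).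
Definition rdim M i := \dim (vop M i @: rad M)%VS.
(** The dimension at i of the top M / rad M; see [dim_topv]. *)
Definition tdim M i := (vdim M i - rdim M i)%N.

Lemma vdimE M i : vdim M i = \dim (limg (vop M i)).
Proof. by []. Qed.
Lemma rdimE M i : rdim M i = \dim (vop M i @: rad M)%VS.
Proof. by []. Qed.

Lemma rdim_le M i : (rdim M i <= vdim M i)%N.
Proof. by apply/dimvS/limgS/subvf. Qed.

Lemma tdimE M i : (tdim M i + rdim M i)%N = vdim M i.
Proof. by rewrite subnK ?rdim_le. Qed.

Lemma vop_surj M N (f : 'Hom(M, N)) i (U : {vspace M}) : is_hom f ->
  (f @: (vop M i @: U) = vop N i @: (f @: U))%VS.
Proof.
move=> fA; apply/vspaceP => y; apply/memv_imgP/memv_imgP => -[_ /memv_imgP[x xU ->] ->].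
  by exists (f x); rewrite ?memv_img // (hom_vop fA).
by exists (vop M i x); rewrite ?memv_img // (hom_vop fA).
Qed.

Lemma vdim_iso M N i : iso M N -> vdim M i = vdim N i.
Proof.
case=> f [[fA kf] [_ fs]]; rewrite /vdim -fs -vop_surj // (limg_dim_eq (f := f)) //.
by rewrite kf capv0.
Qed.

Lemma rdim_iso M N i : iso M N -> rdim M i = rdim N i.
Proof.
case=> f [[fA kf] fs]; rewrite /rdim -(rad_surj fs) -vop_surj // (limg_dim_eq (f := f)) //.
by rewrite kf capv0.
Qed.

Lemma dim_dsum M N (U : {vspace (dsum M N)}) :
  (forall z, z \in U -> inl_hom M N z.1 \in U) ->
  \dim U = (\dim (prl_hom M N @: U) + \dim (prr_hom M N @: U))%N.
Proof.
move=> Ul; rewrite -(limg_ker_dim (prl_hom M N) U) addnC; congr (_ + _)%N.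
have <- : (prr_hom M N @: (U :&: lker (prl_hom M N)) = prr_hom M N @: U)%VS.
  apply/eqP; rewrite eqEsubv limgS ?capvSl //=; apply/subvP => _ /memv_imgP[z zU ->].
  have -> : prr_hom M N z = prr_hom M N (z - inl_hom M N z.1).
    by rewrite linearB /= [X in _ - X]prr_homE inl_homE subr0.
  rewrite memv_img // memv_cap memvB ?Ul //= memv_ker linearB /= !prl_homE inl_homE.
  by rewrite subrr.
rewrite limg_dim_eq //; apply/eqP; rewrite -subv0; apply/subvP => -[u v].
rewrite !memv_cap !memv_ker prl_homE prr_homE memv0 /=.
by case/andP => /andP[_ /eqP->] /eqP->.
Qed.

Lemma vop_dsum M N i z : vop (dsum M N) i z = (vop M i z.1, vop N i z.2).
Proof. exact: dsum_actE. Qed.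
Lemma aop_dsum M N a z : aop (dsum M N) a z = (aop M a z.1, aop N a z.2).
Proof. exact: dsum_actE. Qed.

Lemma prl_surj M N : surjective_hom (prl_hom M N).
Proof.
split; first exact: prl_hom_hom.
by apply/limg_fullP => x; exists (inl_hom M N x); rewrite prl_homE inl_homE.
Qed.
Lemma prr_surj M N : surjective_hom (prr_hom M N).
Proof.
split; first exact: prr_hom_hom.
by apply/limg_fullP => x; exists (inr_hom M N x); rewrite prr_homE inr_homE.
Qed.

Lemma vdim_dsum M N i : vdim (dsum M N) i = (vdim M i + vdim N i)%N.
Proof.
rewrite /vdim dim_dsum => [|_ /limgP[z ->]].
  rewrite !vop_surj; first by rewrite (prl_surj M N).2 (prr_surj M N).2.
    exact: prr_hom_hom.
  exact: prl_hom_hom.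
by rewrite vop_dsum (hom_vop (@inl_hom_hom _ _ M N)) memv_img ?memvf.
Qed.

Lemma rdim_dsum M N i : rdim (dsum M N) i = (rdim M i + rdim N i)%N.
Proof.
rewrite /rdim dim_dsum => [|_ /memv_imgP[z zr ->]].
  rewrite !vop_surj; first by rewrite (rad_surj (prl_surj M N)) (rad_surj (prr_surj M N)).
    exact: prr_hom_hom.
  exact: prl_hom_hom.
rewrite vop_dsum (hom_vop (@inl_hom_hom _ _ M N)) memv_img //.
apply: (hom_rad (@inl_hom_hom _ _ M N)); rewrite -prl_homE.
exact: (hom_rad (@prl_hom_hom _ _ M N)).
Qed.

Lemma tdim_dsum M N i : tdim (dsum M N) i = (tdim M i + tdim N i)%N.
Proof.
have := tdimE (dsum M N) i; rewrite vdim_dsum rdim_dsum.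
have := tdimE M i; have := tdimE N i; lia.
Qed.

Lemma tdim_iso M N i : iso M N -> tdim M i = tdim N i.
Proof. by move=> MN; rewrite /tdim (vdim_iso i MN) (rdim_iso i MN). Qed.

Lemma tdim_zero M : (forall i, tdim M i = 0%N) -> is_zero M.
Proof.
move=> t0; apply: rad_full_zero; apply/eqP; rewrite eqEsubv subvf /=.
apply/subvP => x _; rewrite -[x]vop_sum memv_suml // => i _.
have /subvP/(_ (vop M i x)) : (limg (vop M i) <= vop M i @: rad M)%VS.
  by rewrite -(geq_leqif (dimv_leqif_sup (limgS _ (subvf _)))) -subn_eq0; apply/eqP/t0.
by case/(_ (memv_img _ (memvf _)))/memv_imgP => y yr ->; exact: vop_of_rad.
Qed.

Lemma vdim_eq0 M i : vdim M i = 0%N -> forall x, vop M i x = 0.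
Proof.
move/eqP; rewrite dimv_eq0 => /eqP H x.
by apply/eqP; rewrite -memv0 -H memv_img ?memvf.
Qed.

End RadSqModules.

(** * Tops and their relations *)

Section Tops.
Variables (k : fieldType) (A : falgType k) (Q : quiver) (B : radsq A Q).
Implicit Types (M N X Y Z : fmod A) (i j : vert Q) (a b : arr Q).
Local Notation vop := (vop B).
Local Notation aop := (aop B).
Local Notation rad := (rad B).
Local Notation vdim := (vdim B).
Local Notation rdim := (rdim B).
Local Notation tdim := (tdim B).

(** A projection along the radical that commutes with the vertices, obtained
    by averaging an arbitrary one. Its image serves as the top of M. *)
Definition tp M : 'End(M) :=
  \sum_i (vop M i \o (\1 - projv (rad M)) \o vop M i)%VF.

Lemma tpE M x : tp M x = \sum_i vop M i (vop M i x - projv (rad M) (vop M i x)).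
Proof.
rewrite sum_lfunE; apply: eq_bigr => i _.
by rewrite !comp_lfunE add_lfunE opp_lfunE id_lfunE.
Qed.

Lemma tp_rad M x : x \in rad M -> tp M x = 0.
Proof.
move=> xr; rewrite tpE big1 // => i _.
by rewrite projv_id ?subrr ?linear0 ?vop_of_rad.
Qed.

Lemma sub_tp_rad M x : x - tp M x \in rad M.
Proof.
rewrite -{1}(vop_sum B x) tpE -sumrB memv_suml // => i _.
by rewrite linearB /= vop_id subKr vop_of_rad // memv_proj.
Qed.

Lemma tp_id M x : tp M (tp M x) = tp M x.
Proof.
by have /tp_rad/eqP := sub_tp_rad x; rewrite linearB subr_eq0 eq_sym => /eqP.
Qed.

Lemma tp_vop M i x : tp M (vop M i x) = vop M i (tp M x).
Proof.
rewrite !tpE linear_sum /= (bigD1 i) //= big1 => [|j ji]; last first.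
  by rewrite !vop_vop (negbTE ji) linear0 subr0 linear0.
rewrite addr0 (bigD1 i) //= big1 => [|j ji]; last first.
  by rewrite vop_vop eq_sym (negbTE ji).
by rewrite addr0 !vop_id.
Qed.

Lemma aop_tp M a x : aop M a (tp M x) = aop M a x.
Proof.
by apply/eqP; rewrite eq_sym -subr_eq0 -linearB /= (aop_of_rad _ (sub_tp_rad x)).
Qed.

Lemma tp_eq0 M x : tp M x = 0 -> x \in rad M.
Proof. by move=> x0; have := sub_tp_rad x; rewrite x0 subr0. Qed.

Definition topv M i : {vspace M} := limg (tp M \o vop M i)%VF.

Lemma topvP M i x : reflect (tp M x = x /\ vop M i x = x) (x \in topv M i).
Proof.
apply: (iffP (limgP _ _)) => [[y ->]|[tx vx]].
  by rewrite comp_lfunE tp_id -tp_vop vop_id.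
by exists x; rewrite comp_lfunE vx tx.
Qed.

Lemma topv_mem M i x : tp M (vop M i x) \in topv M i.
Proof. by apply/limgP; exists x; rewrite comp_lfunE. Qed.

Lemma dim_topv M i : \dim (topv M i) = tdim M i.
Proof.
rewrite /topv limg_comp; apply/eqP.
rewrite -(eqn_add2r (rdim M i)) tdimE vdimE -(limg_ker_dim (tp M) (limg _)) addnC.
apply/eqP; congr (_ + _)%N; congr (\dim _); apply/vspaceP => x.
rewrite memv_cap memv_ker; apply/memv_imgP/andP => [[y yr ->]|[/limgP[y ->] /eqP t0]].
  by rewrite memv_img ?memvf ?tp_rad // vop_of_rad.
by exists (vop M i y); rewrite ?vop_id // tp_eq0.
Qed.

Lemma tdim_gt0P M i :
  reflect (exists y, vop M i y \notin rad M) (0 < tdim M i)%N.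
Proof.
rewrite -dim_topv lt0n dimv_eq0 -subv0.
apply: (iffP idP) => [/subvPn[x xt x0]|[y yr]].
  exists x; apply: contra x0 => xr; rewrite memv0.
  by case/topvP: xt xr => tx -> xr; rewrite -tx tp_rad.
apply/subvPn; exists (tp M (vop M i y)); first exact: topv_mem.
by apply: contra yr; rewrite memv0 => /eqP; exact: tp_eq0.
Qed.

Definition top_functional M i (l : 'Hom(M, k^o)) :=
  [/\ l != 0, forall x, x \in rad M -> l x = 0 &
      forall j x, l (vop M j x) = if j == i then l x else 0].

Lemma exists_top_functional M i : (0 < tdim M i)%N ->
  exists (l : 'Hom(M, k^o)) x, [/\ top_functional i l, vop M i x = x & l x = 1].
Proof.
case/tdim_gt0P => y /functional_sep[l l0 l1].
exists (l \o vop M i)%VF, (vop M i y); split; rewrite ?vop_id ?comp_lfunE ?vop_id //.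
split=> [|x xr|j x]; last 2 first.
- by rewrite comp_lfunE l0 ?vop_of_rad.
- by rewrite !comp_lfunE vop_vop eq_sym; case: ifP => // _; rewrite linear0.
apply/negP => /eqP/lfunP/(_ y); rewrite comp_lfunE l1 zero_lfunE => /eqP.
by rewrite oner_eq0.
Qed.

Lemma top_functional_gt0 M i l : top_functional (M := M) i l -> (0 < tdim M i)%N.
Proof.
case=> l0 lr lv; apply/tdim_gt0P.
have [x lx] : exists x, l x != 0 by case/lfunPn: l0 => x; rewrite zero_lfunE; exists x.
by exists x; apply: contra lx => /lr; rewrite lv eqxx => ->.
Qed.

(** ** Relations *)

Definition mm M : 'Hom({ffun arr Q -> M}, M) :=
  linfun (fun u : {ffun arr Q -> M} => \sum_a aop M a (u a)).

Lemma mmE M (u : {ffun arr Q -> M}) : mm M u = \sum_a aop M a (u a).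
Proof.
rewrite /mm linfunE // => c v w; rewrite scaler_sumr -big_split /=.
by apply: eq_bigr => a _; rewrite !ffunE linearP.
Qed.

Definition gen M j : 'End({ffun arr Q -> M}) :=
  linfun (fun u : {ffun arr Q -> M} =>
    [ffun a => if tgt a == j then tp M (vop M (src a) (u a)) else 0]).

Lemma genE M j u : gen M j u =
  [ffun a => if tgt a == j then tp M (vop M (src a) (u a)) else 0].
Proof.
rewrite /gen linfunE // => c v w; apply/ffunP => a; rewrite !ffunE.
by case: ifP => _; rewrite ?scaler0 ?addr0 // !linearP.
Qed.

(** The relations at j: families of elements of the top, indexed by the arrows
    a ending at j, with sum of the a (u a) equal to zero. As the square of the
    radical is zero, they form the part at j of the kernel of a projective
    cover of M, so that their dimension is the multiplicity of the projective
    at j in the second term of a minimal presentation. *)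
Definition relv M j : {vspace {ffun arr Q -> M}} := (limg (gen M j) :&: lker (mm M))%VS.

Lemma gen_id M j u : gen M j (gen M j u) = gen M j u.
Proof.
rewrite !genE; apply/ffunP => a; rewrite !ffunE; case: ifP => // ->.
by rewrite -!tp_vop vop_id tp_id.
Qed.

Lemma relvP M j u : reflect (gen M j u = u /\ \sum_a aop M a (u a) = 0) (u \in relv M j).
Proof.
rewrite memv_cap memv_ker mmE.
apply: (iffP andP) => [[/limgP[v ->] /eqP->]|[gu ->]]; first by rewrite gen_id.
by split=> //; apply/limgP; exists u.
Qed.

Lemma relv_topv M j u a : u \in relv M j -> u a \in topv M (src a).
Proof.
case/relvP => <- _; rewrite genE ffunE; case: ifP => _; first exact: topv_mem.
exact: mem0v.
Qed.

Lemma relv_tgt M j u a : u \in relv M j -> tgt a != j -> u a = 0.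
Proof. by case/relvP => <- _ /negbTE aj; rewrite genE ffunE aj. Qed.

Lemma mm_gen M j (u : {ffun arr Q -> M}) :
  \sum_a aop M a (gen M j u a) = vop M j (\sum_a aop M a (u a)).
Proof.
rewrite linear_sum; apply: eq_bigr => a _; rewrite genE ffunE /= vop_aop eq_sym.
by case: ifP; rewrite ?linear0 // aop_tp aop_src.
Qed.

Lemma mem_relv M j (u : {ffun arr Q -> M}) :
  \sum_(a | tgt a == j) aop M a (u a) = 0 -> gen M j u \in relv M j.
Proof.
move=> u0; apply/relvP; rewrite gen_id mm_gen; split=> //.
rewrite -[RHS]u0 linear_sum [RHS]big_mkcond; apply: eq_bigr => a _ /=.
by rewrite vop_aop eq_sym.
Qed.

Lemma dim_diag (I : finType) (V : vectType k) (g : I -> 'End(V))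
    (D : 'End({ffun I -> V})) :
  (forall u, D u = [ffun a => g a (u a)]) -> \dim (limg D) = (\sum_a \dim (limg (g a)))%N.
Proof.
move=> DE; pose inj (l : I) : 'Hom(V, {ffun I -> V}) :=
  linfun (fun x => [ffun m => if m == l then x else 0]).
have injE l x : inj l x = [ffun m => if m == l then x else 0].
  rewrite /inj linfunE // => c y z; apply/ffunP => m; rewrite !ffunE.
  by case: ifP => // _; rewrite scaler0 addr0.
have dinj l (U : {vspace V}) : \dim (inj l @: U) = \dim U.
  apply: limg_dim_eq; apply/eqP; rewrite -subv0; apply/subvP => x.
  rewrite memv_cap memv_ker injE => /andP[_ /eqP/ffunP/(_ l)].
  by rewrite !ffunE eqxx memv0 => ->.
have -> : limg D = (\sum_l inj l @: limg (g l))%VS.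
  apply/eqP; rewrite eqEsubv; apply/andP; split.
    apply/subvP => _ /limgP[u ->].
    have -> : D u = \sum_l inj l (g l (u l)).
      apply/ffunP => m; rewrite DE ffunE sum_ffunE (bigD1 m) //= big1 => [|l lm].
        by rewrite injE ffunE eqxx addr0.
      by rewrite injE ffunE eq_sym (negbTE lm).
    by apply: memv_sumr => l _; rewrite !memv_img ?memvf.
  apply/subv_sumP => l _; apply/subvP => _ /memv_imgP[_ /limgP[x ->] ->].
  apply/limgP; exists (inj l x); rewrite DE !injE; apply/ffunP => m; rewrite !ffunE.
  by case: ifP => [/eqP->//|_]; rewrite linear0.
have : directv (\sum_l inj l @: limg (g l)).
  apply/directv_sum_independent => u uP u0 l _.
  have [x ul] : exists x, u l = inj l x.
    by case/memv_imgP: (uP l isT) => x _ ->; exists x.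
  have := congr1 (fun w : {ffun I -> V} => w l) u0; rewrite /= sum_ffunE ffunE (bigD1 l) //=.
  rewrite big1 ?addr0 => [|m ml].
    by rewrite ul injE ffunE eqxx => ->; apply/ffunP => m; rewrite !ffunE if_same.
  have /memv_imgP[y _ ->] := uP m isT.
  by rewrite injE ffunE eq_sym (negbTE ml).
by move/directvP => /= ->; apply: eq_bigr => l _; exact: dinj.
Qed.

(** The rank formula for the map that sends a family u to the sum of the a (u
    a): its image is the part of the radical at j. *)
Lemma dim_relv M j :
  (\dim (relv M j) + rdim M j = \sum_(a | tgt a == j) tdim M (src a))%N.
Proof.
transitivity (\dim (limg (gen M j))).
  rewrite -(limg_ker_dim (mm M)) /relv rdimE; congr (_ + \dim _)%N.
  apply/vspaceP => x; apply/memv_imgP/memv_imgP => [[y /radP[u ->] ->]|[u /limgP[v ->] ->]].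
    exists (gen M j (finfun u)); first by rewrite memv_img ?memvf.
    rewrite mmE mm_gen; congr (vop _ _ _).
    by apply: eq_bigr => a _; rewrite ffunE.
  rewrite mmE mm_gen; exists (\sum_a aop M a (v a)) => //.
  by apply/radP; exists v.
rewrite (dim_diag (g := fun a => if tgt a == j then (tp M \o vop M (src a))%VF else 0)).
  rewrite [RHS]big_mkcond /=; apply: eq_bigr => a _; case: ifP => _.
    exact: dim_topv.
  by apply/eqP; rewrite dimv_eq0 lim0g.
move=> u; rewrite genE; apply/ffunP => a; rewrite !ffunE.
by case: ifP; rewrite ?zero_lfunE // comp_lfunE.
Qed.

(** The absence of relations at j, for families in M instead of the top; see
    [relv0_free] and [free_relv0]. *)
Definition free_at M j := forall u : {ffun arr Q -> M},
  \sum_(a | tgt a == j) aop M a (u a) = 0 ->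
  forall a, tgt a == j -> vop M (src a) (u a) \in rad M.

Lemma relv0_free M j : relv M j = 0%VS -> free_at M j.
Proof.
move=> r0 u /mem_relv; rewrite r0 memv0 => /eqP/ffunP g0 a aj.
by have := g0 a; rewrite genE !ffunE aj => /tp_eq0.
Qed.

Lemma free_relv0 M j : free_at M j -> relv M j = 0%VS.
Proof.
move=> fM; apply/eqP; rewrite -subv0; apply/subvP => u uW; have /relvP[gu u0] := uW.
rewrite memv0; apply/eqP/ffunP => a; rewrite -gu genE !ffunE; case: ifP => // aj.
apply/tp_rad/fM => //; rewrite -[RHS]u0 big_mkcond /=; apply: eq_bigr => b _.
by case: ifPn => // bj; rewrite (relv_tgt uW bj) linear0.
Qed.

(** ** Lifting maps between tops *)

(** X is presented by its top and its relations, so a graded map of tops that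
    preserves the relations extends to X. *)
Lemma hom_lift X Y (f : 'Hom(X, Y)) :
  (forall i x, f (vop X i x) = vop Y i (f x)) ->
  (forall x, x \in rad X -> f x \in rad Y) ->
  (forall j (u : {ffun arr Q -> X}), \sum_(a | tgt a == j) aop X a (u a) = 0 ->
     \sum_(a | tgt a == j) aop Y a (f (u a)) = 0) ->
  exists2 h : 'Hom(X, Y), is_hom h & forall x, h x - f x \in rad Y.
Proof.
move=> fv fr fW.
have fW' (u : {ffun arr Q -> X}) : \sum_a aop X a (u a) = 0 ->
    \sum_a aop Y a (f (u a)) = 0.
  move=> u0; rewrite -[LHS](vop_sum B) big1 // => j _.
  transitivity (\sum_(a | tgt a == j) aop Y a (f (u a))).
    rewrite linear_sum [RHS]big_mkcond; apply: eq_bigr => a _ /=.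
    by rewrite vop_aop eq_sym.
  apply: fW; transitivity (vop X j (\sum_a aop X a (u a))).
    rewrite linear_sum big_mkcond; apply: eq_bigr => a _ /=.
    by rewrite vop_aop eq_sym.
  by rewrite u0 linear0.
pose fm : 'Hom({ffun arr Q -> X}, {ffun arr Q -> Y}) :=
  linfun (fun u : {ffun arr Q -> X} => [ffun a => f (u a)]).
have fmE u : fm u = [ffun a => f (u a)].
  rewrite /fm linfunE // => c v w; apply/ffunP => a.
  by rewrite !ffunE linearP.
pose R : 'Hom(X, Y) := (mm Y \o fm \o (mm X)^-1)%VF.
have RE (u : {ffun arr Q -> X}) : R (\sum_a aop X a (u a)) = \sum_a aop Y a (f (u a)).
  rewrite -mmE !comp_lfunE; set v := (mm X)^-1%VF _.
  apply/eqP; rewrite -subr_eq0 mmE -sumrB; apply/eqP.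
  rewrite -[RHS](fW' (v - u)) => [|]; last first.
    rewrite -mmE linearB /= limg_lfunVK ?subrr //.
    by rewrite memv_img ?memvf.
  by apply: eq_bigr => a _; rewrite -linearB fmE !ffunE -linearB.
have Rr x : x \in rad X -> R x \in rad Y.
  move=> /radP[u ->]; pose w := finfun u.
  have -> : \sum_a aop X a (u a) = \sum_a aop X a (w a).
    by apply: eq_bigr => a _; rewrite ffunE.
  by rewrite RE memv_suml // => a _; rewrite aop_rad.
have Rv i x : x \in rad X -> R (vop X i x) = vop Y i (R x).
  move=> /radP[u ->]; pose w := finfun u.
  pose w' : {ffun arr Q -> X} := [ffun a => if i == tgt a then u a else 0].
  have -> : vop X i (\sum_a aop X a (u a)) = \sum_a aop X a (w' a).
    rewrite linear_sum; apply: eq_bigr => a _; rewrite ffunE /= vop_aop.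
    by case: ifP; rewrite ?linear0.
  have -> : \sum_a aop X a (u a) = \sum_a aop X a (w a).
    by apply: eq_bigr => a _; rewrite ffunE.
  rewrite !RE linear_sum; apply: eq_bigr => a _; rewrite !ffunE /= vop_aop.
  by case: ifP => // _; rewrite !linear0.
have Ra a x : R (aop X a x) = aop Y a (f x).
  pose w : {ffun arr Q -> X} := [ffun b => if b == a then x else 0].
  have -> : aop X a x = \sum_b aop X b (w b).
    rewrite (bigD1 a) //= big1 ?addr0 ?ffunE ?eqxx // => b ba.
    by rewrite ffunE (negbTE ba) linear0.
  rewrite RE (bigD1 a) //= big1 ?addr0 ?ffunE ?eqxx // => b ba.
  by rewrite ffunE (negbTE ba) !linear0.
pose h : 'Hom(X, Y) := ((f \o tp X) + (R \o (\1 - tp X)))%VF.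
have hE x : h x = f (tp X x) + R (x - tp X x).
  by rewrite !(add_lfunE, comp_lfunE, opp_lfunE, id_lfunE).
exists h => [|x]; last first.
  rewrite hE addrAC -linearB -[_ - _]opprB linearN /= addrC.
  by rewrite memvB ?Rr ?fr ?sub_tp_rad.
apply: (hom_of_ops (B := B)) => [i x|a x].
  by rewrite !hE tp_vop -linearB fv Rv ?sub_tp_rad // -linearD.
rewrite !hE tp_rad ?aop_rad // linear0 add0r subr0 Ra linearD /=.
rewrite [X in _ + X]aop_of_rad ?Rr ?sub_tp_rad // addr0.
apply/eqP; rewrite -subr_eq0 -linearB -linearB /=.
by rewrite aop_of_rad // fr // sub_tp_rad.
Qed.

Lemma free_hom X Y i (lX : 'Hom(X, k^o)) (lY : 'Hom(Y, k^o)) y :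
  top_functional i lX -> top_functional i lY -> vop Y i y = y -> lY y = 1 ->
  (forall j, free_at X j \/ vdim Y j = 0%N) ->
  exists2 h : 'Hom(X, Y), is_hom h & forall x, lY (h x) = lX x.
Proof.
move=> [lX0 lXr lXv] [lY0 lYr lYv] yi ly1 H.
pose f : 'Hom(X, Y) := linfun (fun x => (lX x : k) *: y).
have fE x : f x = (lX x : k) *: y.
  by rewrite /f linfunE // => c u v; rewrite linearP scalerDl scalerA.
have [h hA hf] : exists2 h : 'Hom(X, Y), is_hom h & forall x, h x - f x \in rad Y.
  apply: hom_lift => [j x|x xr|j u u0].
  - rewrite !fE lXv linearZ /= -yi vop_vop.
    by case: eqP => [->|_]; rewrite ?scaler0 ?scale0r.
  - by rewrite fE lXr // scale0r mem0v.
  case: (H j) => [fX|Y0]; apply: big1 => a /eqP aj.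
    rewrite -aop_src fE -yi linearZ /= vop_vop.
    case: ifP => [/eqP sa|_]; last by rewrite scaler0 linear0.
    have /lXr := fX u u0 a (introT eqP aj).
    by rewrite lXv sa eqxx => ->; rewrite scale0r linear0.
  by have := vdim_eq0 Y0 (aop Y a (f (u a))); rewrite vop_aop aj eqxx.
exists h => // x; have /lYr := hf x; rewrite linearB /= => /eqP.
by rewrite subr_eq0 fE linearZ /= ly1 /= => /eqP->; rewrite /GRing.scale /= mulr1.
Qed.

(** Where there are no relations, every map of tops lifts. In particular one
    of rank one does, which carries a given functional on one top to a given
    functional on the other. *)
Lemma free_iso X Y i : indecomposable X -> indecomposable Y ->
  (0 < tdim X i)%N -> (0 < tdim Y i)%N ->
  (forall j, free_at X j \/ vdim Y j = 0%N) ->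
  (forall j, free_at Y j \/ vdim X j = 0%N) -> iso X Y.
Proof.
move=> iX iY /exists_top_functional[lX [x [lXt xi lx]]]
  /exists_top_functional[lY [y [lYt yi ly]]] fX fY.
have [f fA lf] := free_hom lXt lYt yi ly fX.
have [g gA lg] := free_hom lYt lXt xi lx fY.
by apply: (indec_iso_functional iX iY (lX := lX) (lY := lY) (f := f) (g := g)) => //;
  [case: lXt|case: lYt].
Qed.

End Tops.

(** * Kronecker representations *)

Record krep (k : fieldType) := KRep {
  kV : vectType k;
  kW : vectType k;
  k1 : 'Hom(kW, kV);
  k2 : 'Hom(kW, kV) }.

Lemma subr_subACA (V : zmodType) (a b c d : V) : (a - b) - (c - d) = (a - c) - (b - d).
Proof. by rewrite !opprD !opprK addrACA. Qed.

Lemma full_of_sub (k : fieldType) (V : vectType k) (U W : {vspace V}) :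
  (U <= W)%VS -> U = fullv -> W = fullv.
Proof. by move=> UW U1; apply/eqP; rewrite eqEsubv subvf -{1}U1. Qed.

Section Kronecker.
Variable k : fieldType.
Implicit Types X Y Z : krep k.

Definition khom X Y (f : 'Hom(kV X, kV Y)) (g : 'Hom(kW X, kW Y)) : Prop :=
  (forall w, f (k1 X w) = k1 Y (g w)) /\ (forall w, f (k2 X w) = k2 Y (g w)).

(** Ext^1(X, Y) = 0. This Ext group is the cokernel of [kdiff], the map that
    measures how far a pair of linear maps is from a homomorphism. *)
Definition kext0 X Y : Prop := forall D1 D2 : 'Hom(kW X, kV Y),
  exists (f : 'Hom(kV X, kV Y)) (g : 'Hom(kW X, kW Y)),
    forall w, D1 w = f (k1 X w) - k1 Y (g w) /\ D2 w = f (k2 X w) - k2 Y (g w).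

Definition kiso X Y : Prop := exists (f : 'Hom(kV X, kV Y)) (g : 'Hom(kW X, kW Y)),
  [/\ khom f g, lker f = 0%VS, limg f = fullv, lker g = 0%VS & limg g = fullv].

Definition kbij X Y (f : 'Hom(kV X, kV Y)) (g : 'Hom(kW X, kW Y)) : Prop :=
  (lker f = 0%VS /\ lker g = 0%VS) /\ (limg f = fullv /\ limg g = fullv).

(** The conclusion of Fitting's lemma, in place of indecomposability. *)
Definition klocal X : Prop :=
  forall (f : 'End(kV X)) (g : 'End(kW X)), @khom X X f g ->
    (exists n, lpow f n = 0 /\ lpow g n = 0) \/ @kbij X X f g.

Definition knz X : Prop := (0 < dim (kV X) + dim (kW X))%N.

Lemma khom_comp X Y Z f g f' g' : @khom Y Z f' g' -> @khom X Y f g ->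
  @khom X Z (f' \o f)%VF (g' \o g)%VF.
Proof.
by move=> [h1 h2] [h3 h4]; split=> w; rewrite !comp_lfunE ?h3 ?h4 ?h1 ?h2.
Qed.

(** From r t = t (1 - s) one gets 0 = r^n t = t (1 - s)^n, where 1 - s is
    invertible. *)
Lemma lpow_sub_nil (U V : vectType k) (t : 'Hom(U, V)) (r : 'End(V)) (s : 'End(U)) n m :
  (forall x, r (t x) = t (x - s x)) -> lpow r n = 0 -> lpow s m = 0 -> t = 0.
Proof.
move=> rt rn sm.
have tn x : lpow r n (t x) = t (lpow (\1 - s)%VF n x).
  elim: n x {rn} => [|n IHn] x; first by rewrite /= !id_lfunE.
  rewrite /= !comp_lfunE IHn rt; congr (t _).
  by rewrite add_lfunE opp_lfunE id_lfunE.
(* 1 - s is injective, as s is nilpotent. *)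
have inj x : x - s x = 0 -> x = 0.
  move=> /eqP; rewrite subr_eq0 eq_sym => /eqP sx.
  suff <- : lpow s m x = x by rewrite sm zero_lfunE.
  by elim: m {sm} => [|m IHm]; rewrite /= ?id_lfunE // comp_lfunE IHm.
have injn n' x : lpow (\1 - s)%VF n' x = 0 -> x = 0.
  elim: n' x => [|n' IHn] x /=; first by rewrite id_lfunE.
  by rewrite comp_lfunE add_lfunE opp_lfunE id_lfunE => /inj/IHn.
have k0 : lker (lpow (\1 - s)%VF n) == 0%VS.
  by apply/eqP/lker_eq0P; exact: injn.
apply/lfunP => x; rewrite zero_lfunE -[x](lker0_lfunVK k0) -tn rn zero_lfunE //.
Qed.

(** An argument of Happel and Ringel. Let t = (f, g), let p be a linear
    projection of Y onto the image of t and i a linear section of t on this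
    image. As Ext^1(Y, X) = 0, there is a linear q from Y to X whose defect
    from being a homomorphism is i times the defect of p. Then p - t q is an
    endomorphism of Y with image in that of t, and q t is an endomorphism of
    X. If t is neither injective nor surjective, both are nilpotent, and (p -
    t q) t = t (1 - q t) implies t = 0. *)
Lemma happel_ringel X Y f g : @khom X Y f g -> kext0 Y X ->
  klocal X -> klocal Y ->
  [\/ f = 0 /\ g = 0, lker f = 0%VS /\ lker g = 0%VS |
      limg f = fullv /\ limg g = fullv].
Proof.
move=> [fg1 fg2] ext lX lY.
pose pV : 'End(kV Y) := projv (limg f); pose pW : 'End(kW Y) := projv (limg g).
pose iV : 'Hom(kV Y, kV X) := (f^-1)%VF; pose iW : 'Hom(kW Y, kW X) := (g^-1)%VF.
have pVf x : pV (f x) = f x by rewrite projv_id // memv_img ?memvf.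
have pWg x : pW (g x) = g x by rewrite projv_id // memv_img ?memvf.
have pWE w : exists x, pW w = g x by apply/limgP/memv_proj.
have iVK y : y \in limg f -> f (iV y) = y by exact: limg_lfunVK.
pose d1 : 'Hom(kW Y, kV Y) := ((pV \o k1 Y) - (k1 Y \o pW))%VF.
pose d2 : 'Hom(kW Y, kV Y) := ((pV \o k2 Y) - (k2 Y \o pW))%VF.
have d1E w : d1 w = pV (k1 Y w) - k1 Y (pW w).
  by rewrite add_lfunE opp_lfunE !comp_lfunE.
have d2E w : d2 w = pV (k2 Y w) - k2 Y (pW w).
  by rewrite add_lfunE opp_lfunE !comp_lfunE.
have d1l w : f (iV (d1 w)) = d1 w.
  apply: iVK; rewrite d1E memvB ?memv_proj //.
  by have [x ->] := pWE w; rewrite -fg1 memv_img ?memvf.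
have d2l w : f (iV (d2 w)) = d2 w.
  apply: iVK; rewrite d2E memvB ?memv_proj //.
  by have [x ->] := pWE w; rewrite -fg2 memv_img ?memvf.
have d1g w : d1 (g w) = 0 by rewrite d1E pWg -fg1 pVf subrr.
have d2g w : d2 (g w) = 0 by rewrite d2E pWg -fg2 pVf subrr.
have [pf [pg pE]] := ext (iV \o d1)%VF (iV \o d2)%VF.
have p1 w : pf (k1 Y w) - k1 X (pg w) = iV (d1 w) by have [<- _] := pE w; rewrite comp_lfunE.
have p2 w : pf (k2 Y w) - k2 X (pg w) = iV (d2 w) by have [_ <-] := pE w; rewrite comp_lfunE.
pose rV : 'End(kV Y) := (pV - (f \o pf))%VF.
pose rW : 'End(kW Y) := (pW - (g \o pg))%VF.
have rVE y : rV y = pV y - f (pf y) by rewrite add_lfunE opp_lfunE comp_lfunE.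
have rWE y : rW y = pW y - g (pg y) by rewrite add_lfunE opp_lfunE comp_lfunE.
have rH : @khom Y Y rV rW.
  split=> w; rewrite rVE rWE linearB /=.
    apply/eqP; rewrite -subr_eq0 subr_subACA -d1E -fg1 -d1l -p1.
    by rewrite [f (_ - _)]linearB subrr.
  apply/eqP; rewrite -subr_eq0 subr_subACA -d2E -fg2 -d2l -p2.
  by rewrite [f (_ - _)]linearB subrr.
have qH : @khom X X (pf \o f)%VF (pg \o g)%VF.
  split=> w; rewrite !comp_lfunE; apply/eqP; rewrite -subr_eq0.
    by rewrite fg1 p1 d1g linear0.
  by rewrite fg2 p2 d2g linear0.
have rV_lim : (limg rV <= limg f)%VS.
  by apply/subvP => _ /limgP[y ->]; rewrite rVE memvB ?memv_proj ?memv_img ?memvf.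
have rW_lim : (limg rW <= limg g)%VS.
  by apply/subvP => _ /limgP[y ->]; rewrite rWE memvB ?memv_proj ?memv_img ?memvf.
have [[n [rVn rWn]]|[_ [rV1 rW1]]] := lY _ _ rH; last first.
  by apply: Or33; split; [exact: full_of_sub rV1|exact: full_of_sub rW1].
have [[m [qVm qWm]]|[[qV0 qW0] _]] := lX _ _ qH; last first.
  apply: Or32; split; apply/lker_eq0P => x fx.
    by apply: ((lker_eq0P _).2 qV0); rewrite comp_lfunE fx linear0.
  by apply: ((lker_eq0P _).2 qW0); rewrite comp_lfunE fx linear0.
apply: Or31; split.
  apply: lpow_sub_nil rVn qVm => x; rewrite rVE pVf comp_lfunE linearB //.
by apply: lpow_sub_nil rWn qWm => x; rewrite rWE pWg comp_lfunE linearB.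
Qed.

Lemma lker0_limg_full (U : vectType k) (f : 'End(U)) :
  lker f = 0%VS <-> limg f = fullv.
Proof.
have := limg_ker_dim f fullv; rewrite capfv => H; split=> e; move: H; rewrite e.
  by rewrite dimv0 add0n => H; apply/eqP; rewrite eqEdim subvf H leqnn.
by move/eqP; rewrite -[X in _ == X]add0n eqn_add2r dimv_eq0 => /eqP.
Qed.

Lemma kend_bij X f g : @khom X X f g -> kext0 X X -> klocal X ->
  f = 0 /\ g = 0 \/ @kbij X X f g.
Proof.
move=> fg ext lX; have [z|[f0 g0]|[f1 g1]] := happel_ringel fg ext lX lX.
- by left.
- by right; split; split=> //; apply/lker0_limg_full.
- by right; split; split=> //; apply/lker0_limg_full.
Qed.

(** The pair (f, g) is injective or surjective, so that if both pairs are
    nonzero, then so is one of their composites. It is bijective by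
    [kend_bij], and (f, g) is an isomorphism. *)
Lemma khom_one_way X Y f g f' g' :
  kext0 X Y -> kext0 Y X -> kext0 X X -> kext0 Y Y -> klocal X -> klocal Y ->
  ~ kiso X Y -> @khom X Y f g -> @khom Y X f' g' ->
  (f = 0 /\ g = 0) \/ (f' = 0 /\ g' = 0).
Proof.
move=> eXY eYX eXX eYY lX lY nXY fg fg'.
have [z|[f0 g0]|[f1 g1]] := happel_ringel fg eYX lX lY; [by left|right|right].
- have [[ff gg]|[_ [ff gg]]] := kend_bij (khom_comp fg fg') eYY lY.
    split; apply/lfunP => y; rewrite zero_lfunE.
      by apply: ((lker_eq0P _).2 f0); rewrite -comp_lfunE ff zero_lfunE.
    by apply: ((lker_eq0P _).2 g0); rewrite -comp_lfunE gg zero_lfunE.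
  case: nXY; exists f, g; split=> //; apply/limg_fullP => y.
    have [x <-] := (limg_fullP _).2 ff y.
    by exists (f' x); rewrite comp_lfunE.
  have [x <-] := (limg_fullP _).2 gg y.
  by exists (g' x); rewrite comp_lfunE.
have [[ff gg]|[[ff gg] _]] := kend_bij (khom_comp fg' fg) eXX lX.
  split; apply/lfunP => y; rewrite zero_lfunE.
    by have [x <-] := (limg_fullP _).2 f1 y; rewrite -comp_lfunE ff zero_lfunE.
  by have [x <-] := (limg_fullP _).2 g1 y; rewrite -comp_lfunE gg zero_lfunE.
case: nXY; exists f, g; split=> //; apply/lker_eq0P => x fx.
  by apply: ((lker_eq0P _).2 ff); rewrite comp_lfunE fx linear0.
by apply: ((lker_eq0P _).2 gg); rewrite comp_lfunE fx linear0.
Qed.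

Definition kdiff X Y : 'Hom(('Hom(kV X, kV Y) * 'Hom(kW X, kW Y))%type,
                            ('Hom(kW X, kV Y) * 'Hom(kW X, kV Y))%type) :=
  linfun (fun t => ((t.1 \o k1 X)%VF - (k1 Y \o t.2)%VF,
                    (t.1 \o k2 X)%VF - (k2 Y \o t.2)%VF)).

Lemma kdiffE X Y t : kdiff X Y t = ((t.1 \o k1 X)%VF - (k1 Y \o t.2)%VF,
                                    (t.1 \o k2 X)%VF - (k2 Y \o t.2)%VF).
Proof.
rewrite /kdiff linfunE // => c u v; congr pair; apply/lfunP => w;
by rewrite !(add_lfunE, opp_lfunE, scale_lfunE, comp_lfunE) linearP
           scalerBr opprD addrACA.
Qed.

Lemma khom_lker X Y f g : @khom X Y f g <-> (f, g) \in lker (kdiff X Y).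
Proof.
rewrite memv_ker kdiffE; split=> [[h1 h2]|/eqP[/eqP + /eqP +]].
  by apply/eqP; congr pair; apply/eqP; rewrite subr_eq0; apply/eqP/lfunP => w;
    rewrite !comp_lfunE.
rewrite !subr_eq0 => /eqP h1 /eqP h2; split=> w; rewrite -!comp_lfunE ?h1 ?h2 //.
Qed.

Definition khdim X Y := \dim (lker (kdiff X Y)).

(** The Euler form, from the rank formula for [kdiff]. *)
Lemma khdimE X Y : kext0 X Y ->
  (khdim X Y + 2 * (dim (kW X) * dim (kV Y)) =
   dim (kV X) * dim (kV Y) + dim (kW X) * dim (kW Y))%N.
Proof.
move=> ext; have := limg_ker_dim (kdiff X Y) fullv; rewrite capfv -/(khdim X Y).
have -> : limg (kdiff X Y) = fullv.
  apply/limg_fullP => -[D1 D2]; have [f [g fgE]] := ext D1 D2.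
  exists (f, g); rewrite kdiffE /=; congr pair; apply/lfunP => w;
  by rewrite add_lfunE opp_lfunE !comp_lfunE; case: (fgE w).
rewrite !dimvf => e; apply: etrans e.
by congr (_ + _)%N; rewrite mul2n -addnn.
Qed.

Lemma khdim_gt0 X : knz X -> (0 < khdim X X)%N.
Proof.
move=> nX; rewrite lt0n dimv_eq0; apply/negP => /eqP l0.
have : (\1%VF, \1%VF) \in lker (kdiff X X).
  by apply/khom_lker; split=> w; rewrite !id_lfunE.
rewrite l0 memv0 => /eqP[e1 e2]; move: nX; rewrite /knz -!dimvf.
have z (U : vectType k) : \1%VF = 0 :> 'End(U) -> \dim {: U} = 0%N.
  move=> e; apply/eqP; rewrite dimv_eq0 -subv0; apply/subvP => x _.
  by rewrite memv0 -[x]id_lfunE e zero_lfunE.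
by rewrite !z.
Qed.

Lemma khdim_one_way X Y :
  kext0 X Y -> kext0 Y X -> kext0 X X -> kext0 Y Y -> klocal X -> klocal Y ->
  ~ kiso X Y -> khdim X Y = 0%N \/ khdim Y X = 0%N.
Proof.
move=> eXY eYX eXX eYY lX lY nXY.
have [/eqP->|/eqP XY0] := boolP (khdim X Y == 0%N); first by left.
have [/eqP->|/eqP YX0] := boolP (khdim Y X == 0%N); first by right.
have ex X' Y' : khdim X' Y' <> 0%N -> exists f g, @khom X' Y' f g /\ ~ (f = 0 /\ g = 0).
  move/eqP; rewrite dimv_eq0 -subv0 => /subvPn[[f g] /khom_lker fg nz].
  by exists f, g; split=> // -[f0 g0]; move: nz; rewrite f0 g0 memv0 eqxx.
have [f [g [fg nz]]] := ex _ _ XY0; have [f' [g' [fg' nz']]] := ex _ _ YX0.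
by case: (khom_one_way eXY eYX eXX eYY lX lY nXY fg fg').
Qed.

(** Here (v - w)^2 = dim End X > 0, for v and w the dimensions of X. *)
Lemma krigid_neq X : kext0 X X -> knz X -> dim (kV X) != dim (kW X).
Proof.
move=> /khdimE e /khdim_gt0 h; apply/eqP => vw; move: e h; rewrite vw; lia.
Qed.

(** This says (v - w) (v' - w') >= 0 for the dimensions of X and Y; twice this
    product is dim Hom(X, Y) + dim Hom(Y, X). *)
Lemma kext_sign X Y : kext0 X Y -> kext0 Y X ->
  (dim (kV X) * dim (kW Y) + dim (kW X) * dim (kV Y) <=
   dim (kV X) * dim (kV Y) + dim (kW X) * dim (kW Y))%N.
Proof. by move=> /khdimE e1 /khdimE e2; move: e1 e2; lia. Qed.

(** Let d = v - w. As Hom(X, Y) or Hom(Y, X) is zero for distinct X and Y, the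
    determinant w' v - w v' is d d' or - d d'. For three representations the
    Pluecker relation between the determinants would make a sum of three signs
    vanish. *)
Lemma no_three_kreps (s : 'I_3 -> krep k) :
  (forall a b, kext0 (s a) (s b)) -> (forall a, klocal (s a)) ->
  (forall a, knz (s a)) -> (forall a b, kiso (s a) (s b) -> a = b) -> False.
Proof.
move=> ext loc nz inj.
pose v a : int := dim (kV (s a)); pose w a : int := dim (kW (s a)).
pose d a := v a - w a.
have hE a b : (khdim (s a) (s b))%:Z = v a * v b + w a * w b - 2 * (w a * v b).
  by have := khdimE (ext a b); rewrite /v /w; lia.
have d0 a : d a != 0.
  apply/eqP => da; have := khdim_gt0 (nz a); have := hE a a.
  have -> : v a = w a by apply/eqP; rewrite -subr_eq0 -/(d a) da.
  lia.
have one a b : a != b -> w b * v a - w a * v b = d a * d b \/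
                         w b * v a - w a * v b = - (d a * d b).
  move=> ab; have nab : ~ kiso (s a) (s b) by move=> /inj e; rewrite e eqxx in ab.
  have [h|h] := khdim_one_way (ext a b) (ext b a) (ext a a) (ext b b) (loc a) (loc b) nab;
    [right; have := hE a b|left; have := hE b a]; rewrite h /d; lia.
pose a : 'I_3 := @Ordinal 3 0 isT; pose b : 'I_3 := @Ordinal 3 1 isT.
pose c : 'I_3 := @Ordinal 3 2 isT.
have plucker : d c * (w b * v a - w a * v b) + d a * (w c * v b - w b * v c)
             + d b * (w a * v c - w c * v a) = 0 by rewrite /d; ring.
have : d a * d b * d c != 0 by rewrite !mulf_neq0.
have := one a b isT; have := one b c isT; have := one c a isT.
move=> [h1|h1] [h2|h2] [h3|h3]; move: plucker; rewrite h1 h2 h3; lia.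
Qed.

End Kronecker.

(** * Consequences of rigidity for tops and relations *)

Record double (Q : quiver) (i j : vert Q) (a1 a2 : arr Q) : Prop := Double {
  dbl_s1 : src a1 = i;
  dbl_t1 : tgt a1 = j;
  dbl_s2 : src a2 = i;
  dbl_t2 : tgt a2 = j;
  dbl_neq : a1 != a2;
  dbl_only : forall a, src a = i -> tgt a = j -> a = a1 \/ a = a2 }.

Section Rigidity.
Variables (k : fieldType) (A : falgType k) (Q : quiver) (B : radsq A Q).
Implicit Types (M N X Y Z : fmod A) (i j : vert Q) (a b : arr Q).
Local Notation vop := (vop B).
Local Notation aop := (aop B).
Local Notation rad := (rad B).
Local Notation vdim := (vdim B).
Local Notation rdim := (rdim B).
Local Notation tdim := (tdim B).
Local Notation tp := (tp B).
Local Notation topv := (topv B).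
Local Notation relv := (relv B).
Local Notation gen := (gen B).
Local Notation free_at := (free_at B).

(** The maps D a define a module structure on X + Y' that makes it an
    extension of X by Y', and a section of this extension is the graph of T. *)
Lemma derivation_inner M X Y Y' (q0 : 'Hom(Y, Y')) (D : arr Q -> 'Hom(X, Y')) :
  tau_rigid M -> retract X M -> retract Y M -> surjective_hom q0 ->
  (forall a i x, D a (vop X i x) = if i == src a then D a x else 0) ->
  (forall a i x, vop Y' i (D a x) = if i == tgt a then D a x else 0) ->
  (forall a b x, D a (aop X b x) = 0) -> (forall a b x, aop Y' b (D a x) = 0) ->
  exists2 T : 'Hom(X, Y'), (forall i x, T (vop X i x) = vop Y' i (T x)) &
    forall a x, D a x = T (aop X a x) - aop Y' a (T x).
Proof.
move=> Mrig XM YM [q0A q0s] Dv vD Da aD.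
pose V : vectType k := (X * Y')%type.
pose ev i : 'End(V) := vop (dsum X Y') i.
pose ea a : 'End(V) :=
  (aop (dsum X Y') a + (inr_hom X Y' \o D a \o prl_hom X Y'))%VF.
have evE i z : ev i z = (vop X i z.1, vop Y' i z.2) by exact: vop_dsum.
have eaE a z : ea a z = (aop X a z.1, aop Y' a z.2 + D a z.1).
  rewrite add_lfunE !comp_lfunE prl_homE inr_homE aop_dsum.
  by congr pair; rewrite addr0.
have evv i j z : ev i (ev j z) = if i == j then ev i z else 0.
  by rewrite !evE /= !vop_vop; case: ifP.
have ev1 z : \sum_i ev i z = z.
  by rewrite -[RHS](vop_sum B (M := dsum X Y')); apply: eq_bigr.
have eva i a z : ev i (ea a z) = if i == tgt a then ea a z else 0.
  by rewrite evE eaE /= linearD /= !vop_aop vD; case: ifP => // _; rewrite addr0.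
have eav a i z : ea a (ev i z) = if i == src a then ea a z else 0.
  by rewrite evE !eaE /= !aop_vop Dv; case: ifP => // _; rewrite addr0.
have eaa a b z : ea a (ea b z) = 0.
  by rewrite !eaE /= linearD /= !aop_aop aD Da !addr0.
pose E := rep_mod B evv ev1 eva eav eaa.
pose p : 'Hom(E, X) := prl_hom X Y'.
pose q : 'Hom(Y, E) := (inr_hom X Y' \o q0)%VF.
have pE z : p z = z.1 by exact: prl_homE.
have qE y : q y = (0, q0 y) by rewrite comp_lfunE inr_homE.
have pA : is_hom p.
  by apply: (hom_of_ops (B := B)) => [i z|a z];
    rewrite !pE ?vop_rep ?aop_rep ?evE ?eaE.
have qA : is_hom q.
  apply: (hom_of_ops (B := B)) => [i y|a y]; rewrite !qE ?vop_rep ?aop_rep ?evE ?eaE /=.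
    by rewrite linear0 (hom_vop B q0A).
  by rewrite !linear0 addr0 (hom_aop B q0A).
have ps : limg p = fullv.
  by apply/limg_fullP => x; exists (x, 0); rewrite pE.
have qp : limg q = lker p.
  apply/vspaceP => -[x y]; rewrite memv_ker pE /=.
  apply/limgP/eqP => [[y' ]|->]; first by rewrite qE => -[].
  by have [y' <-] := (limg_fullP _).2 q0s y; exists y'; rewrite qE.
have [s sA sp] := tau_rigid_split Mrig XM YM (conj pA ps) qA qp.
pose T : 'Hom(X, Y') := (prr_hom X Y' \o s)%VF.
have sE x : s x = (x, T x).
  by rewrite comp_lfunE prr_homE -{2}[x]sp pE -surjective_pairing.
exists T => [i x|a x].
  have := hom_vop B sA i x; rewrite vop_rep !sE evE /= => -[]; exact.
have := hom_aop B sA a x; rewrite aop_rep !sE eaE /= => -[->].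
by rewrite addrAC subrr add0r.
Qed.

Section Simple.
Variable i0 : vert Q.

Let ev i : 'End(k^o) := if i == i0 then \1%VF else 0.
Let ea a : 'End(k^o) := 0.
Let evv i j x : ev i (ev j x) = if i == j then ev i x else 0.
Proof.
rewrite /ev; have [ei|ni] := eqVneq i i0; have [ej|nj] := eqVneq j i0.
- by rewrite ei ej eqxx !id_lfunE.
- by rewrite ei eq_sym (negbTE nj) zero_lfunE linear0.
- by rewrite ej (negbTE ni) zero_lfunE.
- by rewrite !zero_lfunE if_same.
Qed.
Let ev1 x : \sum_i ev i x = x.
Proof.
rewrite (bigD1 i0) //= big1 /ev => [|i /negbTE->]; last by rewrite zero_lfunE.
by rewrite eqxx id_lfunE addr0.
Qed.
Let eva i a x : ev i (ea a x) = if i == tgt a then ea a x else 0.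
Proof. by rewrite zero_lfunE linear0 if_same. Qed.
Let eav a i x : ea a (ev i x) = if i == src a then ea a x else 0.
Proof. by rewrite !zero_lfunE if_same. Qed.
Let eaa a b x : ea a (ea b x) = 0.
Proof. by rewrite !zero_lfunE. Qed.

Definition simple_mod : fmod A := rep_mod B evv ev1 eva eav eaa.

Lemma vop_simple i (x : simple_mod) : vop simple_mod i x = if i == i0 then x else 0.
Proof. by rewrite vop_rep /ev; case: ifP; rewrite ?id_lfunE ?zero_lfunE. Qed.
Lemma aop_simple a (x : simple_mod) : aop simple_mod a x = 0.
Proof. by rewrite aop_rep zero_lfunE. Qed.

Lemma functional_hom Y (l : 'Hom(Y, simple_mod)) :
  top_functional B i0 (l : 'Hom(Y, k^o)) -> surjective_hom l.
Proof.
case=> l0 lr lv; split.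
  apply: (hom_of_ops (B := B)) => [i x|a x]; first by rewrite vop_simple lv.
  by rewrite aop_simple lr // aop_rad.
case/lfunPn: l0 => y; rewrite zero_lfunE => ly.
apply/limg_fullP => c; exists ((c / l y : k) *: y).
by rewrite linearZ; apply: divfK.
Qed.

End Simple.

(** If a relation u at i involved the arrow a, a functional on X with value 1
    at u a would define an extension of X by the simple module at i that does
    not split, while this simple module is a quotient of Y. *)
Lemma sign_coherence M X Y i : tau_rigid M -> retract X M -> retract Y M ->
  (0 < tdim Y i)%N -> free_at X i.
Proof.
move=> Mrig XM YM /exists_top_functional[lY [y [lYt yi ly]]] u u0 a ai.
apply/negPn/negP => /functional_sep[l lr l1].
pose D b : 'Hom(X, simple_mod i) :=
  if b == a then (l \o vop X (src a))%VF else 0.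
have DE b x : D b x = if b == a then l (vop X (src a) x) else 0.
  by rewrite /D; case: ifP => _; rewrite ?comp_lfunE ?zero_lfunE.
have [T _ DT] : exists2 T : 'Hom(X, simple_mod i),
    (forall j x, T (vop X j x) = vop (simple_mod i) j (T x)) &
    forall b x, D b x = T (aop X b x) - aop (simple_mod i) b (T x).
  apply: (derivation_inner (q0 := lY : 'Hom(Y, simple_mod i)) Mrig XM YM).
  - exact: functional_hom.
  - move=> b j x; rewrite !DE; case: eqP => [->|_]; last by rewrite if_same.
    by rewrite vop_vop eq_sym; case: ifP => // _; rewrite linear0.
  - move=> b j x; rewrite vop_simple DE; case: (b =P a) => [->|_]; last by rewrite !if_same.
    by rewrite (eqP ai).
  - move=> b c x; rewrite DE; case: ifP => // _.
    by rewrite lr // vop_of_rad // aop_rad.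
  - by move=> b c x; rewrite aop_simple.
have {}DT b x : D b x = T (aop X b x) by rewrite DT aop_simple subr0.
have : \sum_(b | tgt b == i) D b (u b) = 0.
  by rewrite -[RHS](linear0 T) -u0 linear_sum; apply: eq_bigr => b _; rewrite DT.
rewrite (bigD1 a) //= big1 => [|b /andP[_ /negbTE ba]]; last by rewrite DE ba.
by rewrite DE eqxx addr0 l1 => /eqP; rewrite oner_eq0.
Qed.

(** ** The Kronecker representation of a pair of parallel arrows *)

Section KroneckerPart.
Variables (i j : vert Q) (a1 a2 : arr Q).
Hypothesis dbl : double i j a1 a2.

Let s1 : src a1 = i := dbl_s1 dbl.
Let t1 : tgt a1 = j := dbl_t1 dbl.
Let s2 : src a2 = i := dbl_s2 dbl.
Let t2 : tgt a2 = j := dbl_t2 dbl.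
Let a12 : a1 != a2 := dbl_neq dbl.
Let only2 : forall a, src a = i -> tgt a = j -> a = a1 \/ a = a2 := dbl_only dbl.

Definition kcoord X a : 'Hom(subvs_of (relv X j), subvs_of (topv X i)) :=
  linfun (fun u : subvs_of (relv X j) => vsproj (topv X i) (vsval u a)).

Lemma kcoordE X a u : src a = i -> vsval (kcoord X a u) = vsval u a.
Proof.
move=> sa; rewrite /kcoord linfunE => [|c v w]; last by rewrite linearP !ffunE linearP.
by rewrite vsproj_id // -sa; exact: relv_topv (subvsP u).
Qed.

(** The relations at j with their components at the arrows a1 and a2: the part
    of a minimal presentation of X that lies between the projectives at j and
    at i. *)
Definition kron X : krep k := KRep (kcoord X a1) (kcoord X a2).

Lemma kron_dimV X : dim (kV (kron X)) = tdim X i.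
Proof. exact: dim_topv. Qed.
Lemma kron_dimW X : dim (kW (kron X)) = \dim (relv X j).
Proof. by []. Qed.

(** The maps D1 and D2 extend to a derivation from X to Y with values in the
    radical. It is inner, given by some T, and T acts on tops and on
    relations. *)
Lemma kron_ext0 M X Y : tau_rigid M -> retract X M -> retract Y M ->
  kext0 (kron X) (kron Y).
Proof.
move=> Mrig XM YM D1 D2.
(* The map that D1 and D2 induce on relations, extended to all families by a
   projection onto the relations. *)
pose d (u : {ffun arr Q -> X}) : Y :=
  aop Y a1 (vsval (D1 (vsproj (relv X j) u))) + aop Y a2 (vsval (D2 (vsproj (relv X j) u))).
have dlin : linear d.
  move=> c u v; rewrite /d [vsproj _ _]linearP !linearP /=.
  by rewrite scalerDr addrACA.
pose dl : 'Hom({ffun arr Q -> X}, Y) := linfun d.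
have dlE u : dl u = d u by rewrite /dl linfunE.
pose single a (x : X) : {ffun arr Q -> X} := [ffun b => if b == a then x else 0].
pose D a : 'Hom(X, Y) := linfun (fun x => dl (gen X j (single a x))).
have DE a x : D a x = d (gen X j (single a x)).
  rewrite /D linfunE ?dlE // => c u v; rewrite -!linearP /=; congr (dl (gen _ _ _)).
  by apply/ffunP => b; rewrite !ffunE; case: ifP => // _; rewrite scaler0 addr0.
have d0 : d 0 = 0 by rewrite -dlE linear0.
have gen0 a x : tp X (vop X (src a) x) = 0 -> gen X j (single a x) = 0.
  move=> x0; rewrite genE; apply/ffunP => b; rewrite !ffunE; case: ifP => // _.
  by case: eqP => [->|_]; rewrite ?x0 // !linear0.
have gent a x : tgt a != j -> gen X j (single a x) = 0.
  move=> aj; rewrite genE; apply/ffunP => b; rewrite !ffunE.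
  by case: ifP => // bj; case: eqP => [ba|_]; rewrite ?linear0 //; rewrite -ba bj in aj.
have [T Tv DT] : exists2 T : 'Hom(X, Y), (forall l x, T (vop X l x) = vop Y l (T x)) &
    forall a x, D a x = T (aop X a x) - aop Y a (T x).
  apply: (derivation_inner (q0 := (\1%VF : 'Hom(Y, Y))) Mrig XM YM).
  - split; first exact: hom_id.
    by apply/limg_fullP => y; exists y; rewrite id_lfunE.
  - move=> a l x; rewrite !DE; have [->|la] := eqVneq l (src a).
      congr d; rewrite !genE; apply/ffunP => b; rewrite !ffunE.
      by case: ifP => // _; case: eqP => [->|_]; rewrite ?vop_id.
    by rewrite gen0 // vop_vop eq_sym (negbTE la) linear0.
  - move=> a l x; rewrite !DE; have [ta|ta] := eqVneq (tgt a) j; last first.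
      by rewrite gent // d0 linear0 if_same.
    by rewrite /d linearD /= !vop_aop t1 t2 ta; case: ifP; rewrite ?addr0.
  - by move=> a b x; rewrite DE gen0 ?d0 // vop_aop; case: ifP => _; rewrite ?linear0 // tp_rad // aop_rad.
  - by move=> a b x; rewrite DE /d linearD /= !aop_aop addr0.
(* On a relation u, the sum of the D a (u a) is minus the sum of the
   a (T (u a)), so that g0 u below is a relation again. *)
pose f0 x : Y := - tp Y (T x).
pose f : 'Hom(kV (kron X), kV (kron Y)) :=
  linfun (fun x => vsproj (topv Y i) (f0 (vsval x))).
have fE x : vsval (f x) = f0 (vsval x).
  rewrite /f linfunE => [|c u v]; last first.
    by rewrite -linearP; congr vsproj; rewrite /f0 !linearP.
  rewrite vsproj_id // memvN; have /topvP[_ <-] := subvsP x.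
  by rewrite Tv; exact: topv_mem.
pose g0 (u : subvs_of (relv X j)) : {ffun arr Q -> Y} :=
  [ffun a => - tp Y (T (vsval u a)) - (if a == a1 then vsval (D1 u) else 0)
             - (if a == a2 then vsval (D2 u) else 0)].
have g0r u : g0 u \in relv Y j.
  have uW := subvsP u; have /relvP[gu u0] := uW.
  have uT a : vop X (src a) (vsval u a) = vsval u a.
    by have /topvP[] := relv_topv a uW.
  apply/relvP; split.
    rewrite genE; apply/ffunP => a; rewrite !ffunE; case: eqP => [aj|/eqP aj]; last first.
      rewrite (relv_tgt uW aj) !linear0.
      have /negbTE-> : a != a1 by apply: contraNneq aj => ->; rewrite t1.
      have /negbTE-> : a != a2 by apply: contraNneq aj => ->; rewrite t2.
      by rewrite !subr0.
    have tD (D' : 'Hom(kW (kron X), kV (kron Y))) a' : src a' = i ->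
        tp Y (vop Y (src a) (if a == a' then vsval (D' u) else 0)) =
        if a == a' then vsval (D' u) else 0.
      move=> sa'; case: eqP => [->|_]; last by rewrite !linear0.
      by rewrite sa'; have /topvP[e1 e2] := subvsP (D' u); rewrite e2 e1.
    rewrite !linearB /= !tD //; congr (_ - _ - _).
    by rewrite !linearN /= -tp_vop tp_id -Tv uT.
  have : \sum_a D a (vsval u a) = d (vsval u).
    transitivity (d (gen X j (vsval u))); last by rewrite gu.
    transitivity (dl (gen X j (\sum_a single a (vsval u a)))).
      by rewrite !linear_sum; apply: eq_bigr => a _; rewrite DE -dlE.
    rewrite dlE; congr (d (gen _ _ _)).
    apply/ffunP => b; rewrite sum_ffunE (bigD1 b) //= big1 => [|a ab]; last first.
      by rewrite ffunE eq_sym (negbTE ab).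
    by rewrite ffunE eqxx addr0.
  rewrite (eq_bigr _ (fun a _ => DT a _)) sumrB -linear_sum u0 linear0 sub0r.
  rewrite /d vsvalK => e.
  transitivity (- (\sum_a aop Y a (T (vsval u a)))
     - (\sum_a aop Y a (if a == a1 then vsval (D1 u) else 0))
     - (\sum_a aop Y a (if a == a2 then vsval (D2 u) else 0))).
    rewrite -!sumrN -!big_split /=; apply: eq_bigr => a _.
    by rewrite ffunE 2!linearB linearN /= aop_tp.
  rewrite e (bigD1 a1) //= big1 => [|a /negbTE->]; last by rewrite linear0.
  rewrite (bigD1 a2) //= big1 => [|a /negbTE->]; last by rewrite linear0.
  by rewrite !eqxx !addr0 -addrA -opprD subrr.
pose g : 'Hom(kW (kron X), kW (kron Y)) := linfun (fun u => vsproj (relv Y j) (g0 u)).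
have gE u : vsval (g u) = g0 u.
  rewrite /g linfunE ?vsproj_id // => c v w; rewrite -linearP; congr vsproj.
  apply/ffunP => a; rewrite !ffunE.
  have lin3 (x y z x' y' z' : Y) : (c *: x + x') - (c *: y + y') - (c *: z + z') =
      c *: (x - y - z) + (x' - y' - z').
    by rewrite !opprD [X in X + _ = _]addrACA [LHS]addrACA !scalerBr.
  rewrite -lin3; congr (_ - _ - _); first by rewrite !linearP.
    by case: ifP => _; rewrite ?linearP // scaler0 addr0.
  by case: ifP => _; rewrite ?linearP // scaler0 addr0.
have vB (x y : subvs_of (topv Y i)) : val (x - y) = vsval x - vsval y by [].
exists f, g => u; split; apply: val_inj; rewrite vB [vsval (kcoord _ _ _)]kcoordE //
  gE ffunE fE kcoordE // eqxx.
  by rewrite (negbTE a12) subr0 /f0 opprB addrC subrK.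
by rewrite eq_sym (negbTE a12) subr0 /f0 opprB addrC subrK.
Qed.

(** X is determined by its Kronecker representation. *)
Definition solo X := (forall l, l != i -> tdim X l = 0%N) /\
                     (forall l, l != j -> free_at X l).

Lemma tdim0_topv X l x : tdim X l = 0%N -> x \in topv X l -> x = 0.
Proof.
move=> t0; have /eqP : \dim (topv X l) = 0%N by rewrite dim_topv.
by rewrite dimv_eq0 => /eqP->; rewrite memv0 => /eqP.
Qed.

Lemma solo_tp X x : solo X -> tp X x = tp X (vop X i x).
Proof.
move=> [X0 _]; rewrite -{1}(vop_sum B x) linear_sum (bigD1 i) //= big1 ?addr0 // => l li.
by apply: (tdim0_topv (X0 l li)); exact: topv_mem.
Qed.

Lemma solo_relv X u a : solo X -> u \in relv X j -> a != a1 -> a != a2 -> u a = 0.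
Proof.
move=> [X0 _] uW n1 n2; have [ta|ta] := eqVneq (tgt a) j; last exact: relv_tgt uW ta.
have [sa|sa] := eqVneq (src a) i.
  by have [e|e] := only2 sa ta; [rewrite e eqxx in n1|rewrite e eqxx in n2].
by apply: (tdim0_topv (X0 _ sa)); exact: relv_topv uW.
Qed.

(** A homomorphism of Kronecker representations is a map of tops that
    preserves the only relations, to which [hom_lift] applies. *)
Lemma kron_lift X Y (f : 'Hom(kV (kron X), kV (kron Y))) g : solo X -> solo Y ->
  khom f g -> exists2 h : 'Hom(X, Y), is_hom h &
    forall x : subvs_of (topv X i), tp Y (h (vsval x)) = vsval (f x).
Proof.
move=> sX sY [fg1 fg2].
pose F : 'Hom(X, Y) := (linfun vsval \o f \o linfun (vsproj (topv X i)) \o tp X \o vop X i)%VF.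
have FE x : F x = vsval (f (vsproj (topv X i) (tp X (vop X i x)))).
  by rewrite !comp_lfunE !lfunE.
have Ft x : F x \in topv Y i by rewrite FE subvsP.
have Fv l x : F (vop X l x) = if l == i then F x else 0.
  rewrite !FE vop_vop eq_sym; case: ifP => // _.
  by rewrite ?vop_id // !linear0.
have vF l x : vop Y l (F x) = if l == i then F x else 0.
  by have /topvP[_ <-] := Ft x; rewrite vop_vop; case: eqP => // ->.
have [h hA hF] : exists2 h : 'Hom(X, Y), is_hom h & forall x, h x - F x \in rad Y.
  apply: (hom_lift (B := B)) => [l x|x xr|l u u0].
  - by rewrite Fv vF.
  - by rewrite FE tp_rad ?vop_of_rad // !linear0 mem0v.
  have [lj|lj] := eqVneq l j; last first.
    apply: big1 => a al; rewrite -aop_src vF; case: eqP => [sa|_]; last by rewrite linear0.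
    have := (proj2 sX) l lj u u0 a al; rewrite sa => /tp_rad t0.
    by rewrite FE t0 !linear0.
  rewrite {l}lj in u0 *.
  pose w := gen X j u; have wW : w \in relv X j by exact: mem_relv.
  pose v := vsval (g (vsproj (relv X j) w)).
  have vW : v \in relv Y j by exact: subvsP.
  have [_ v0] := elimT (relvP _ _ _) vW.
  rewrite -[RHS]v0 big_mkcond; apply: eq_bigr => a _ /=.
  have coordF b : src b = i -> tgt b = j -> F (u b) =
      vsval (f (kcoord X b (vsproj (relv X j) w))).
    move=> sb tb; rewrite FE; congr (vsval (f _)); apply: val_inj.
    rewrite [RHS]kcoordE // [LHS]vsproj_id ?topv_mem // vsproj_id //.
    by rewrite /w genE ffunE tb eqxx sb.
  case: eqP => [ta|/eqP ta]; last by rewrite (relv_tgt vW ta) linear0.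
  have [sa|sa] := eqVneq (src a) i; last first.
    rewrite -aop_src vF (negbTE sa) linear0.
    by rewrite (solo_relv sY vW) ?linear0 //; apply: contraNneq sa => ->; rewrite ?s1 ?s2.
  congr (aop _ _ _); rewrite coordF //.
  have [->|->] := only2 sa ta.
    by have := fg1 (vsproj (relv X j) w) => /= ->; rewrite [LHS]kcoordE.
  by have := fg2 (vsproj (relv X j) w) => /= ->; rewrite [LHS]kcoordE.
exists h => // x; have /tp_rad/eqP := hF (vsval x).
rewrite linearB subr_eq0 /= => /eqP->; have /topvP[-> _] := Ft (vsval x).
by rewrite FE; have /topvP[e1 e2] := subvsP x; rewrite e2 e1 vsvalK.
Qed.

Lemma kron_faithful X Y f (g : 'Hom(kW (kron X), kW (kron Y))) u :
  solo Y -> @khom _ (kron X) (kron Y) f g ->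
  f (k1 (kron X) u) = 0 -> f (k2 (kron X) u) = 0 -> g u = 0.
Proof.
move=> sY [fg1 fg2]; rewrite fg1 fg2 => e1 e2.
apply: val_inj; apply/ffunP => a; rewrite ffunE.
have [->|n1] := eqVneq a a1.
  by have := congr1 vsval e1; rewrite /= kcoordE.
have [->|n2] := eqVneq a a2.
  by have := congr1 vsval e2; rewrite /= kcoordE.
exact: (solo_relv sY (subvsP (g u)) n1 n2).
Qed.

Lemma khom_lpow (Z : krep k) (f : 'End(kV Z)) (g : 'End(kW Z)) n :
  @khom _ Z Z f g -> @khom _ Z Z (lpow f n) (lpow g n).
Proof.
move=> fg; elim: n => [|n IHn] /=; first by split=> w; rewrite !id_lfunE.
exact: khom_comp.
Qed.

Lemma kron_klocal X : solo X -> indecomposable X -> klocal (kron X).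
Proof.
move=> sX iX f g fg; have [h hA hf] := kron_lift sX sX fg.
have htp x : tp X (h (tp X x)) = tp X (h x).
  apply/eqP; rewrite eq_sym -subr_eq0 -linearB /=; apply/eqP/tp_rad.
  have := hom_rad (B := B) hA (sub_tp_rad B x); by rewrite linearB.
have [[n hn]|[h0 h1]] := indec_endo iX hA.
  left; exists n; have f0 : lpow f n = 0.
    apply/lfunP => x; rewrite zero_lfunE; apply: val_inj => /=.
    suff <- : tp X (lpow h n (vsval x)) = vsval (lpow f n x).
      by rewrite hn zero_lfunE linear0.
    elim: n x {hn} => [|n IHn] x /=.
      by rewrite !id_lfunE; have /topvP[] := subvsP x.
    by rewrite !comp_lfunE -htp IHn hf.
  split=> //; apply/lfunP => u; rewrite zero_lfunE.
  have fgn := khom_lpow n fg.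
  by apply: (kron_faithful sX fgn); rewrite f0 zero_lfunE.
have f0 : lker f = 0%VS.
  apply/lker_eq0P => x fx; have /tp_eq0 : tp X (h (vsval x)) = 0 by rewrite hf fx.
  rewrite -(rad_surj B (conj hA h1)) => /memv_imgP[y yr hy].
  have : h (vsval x - y) = 0 by rewrite linearB /= hy subrr.
  move/((lker_eq0P _).2 h0)/eqP; rewrite subr_eq0 => /eqP xy.
  apply: val_inj; rewrite /= -(tp_rad yr) -xy.
  by have /topvP[] := subvsP x.
have g0 : lker g = 0%VS.
  apply/lker_eq0P => u gu; have := kron_faithful (f := \1%VF) (g := \1%VF) (u := u) sX.
  rewrite !id_lfunE; apply; first by split=> w; rewrite !id_lfunE.
    by apply: ((lker_eq0P _).2 f0); case: fg => -> _; rewrite gu linear0.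
  by apply: ((lker_eq0P _).2 f0); case: fg => _ ->; rewrite gu linear0.
by right; split; split=> //; apply/lker0_limg_full.
Qed.

Lemma kron_surj X Y (f : 'Hom(kV (kron X), kV (kron Y))) g : solo X -> solo Y ->
  khom f g -> limg f = fullv -> exists h : 'Hom(X, Y), surjective_hom h.
Proof.
move=> sX sY fg f1; have [h hA hf] := kron_lift sX sY fg.
exists h; split=> //; apply: (surj_of_top (B := B)) => // y.
have [x fx] := (limg_fullP _).2 f1 (vsproj (topv Y i) (tp Y y)).
exists (vsval x); apply: tp_eq0; rewrite linearB /= hf fx solo_tp //.
by rewrite vsproj_id ?subrr //; exact: topv_mem.
Qed.

Lemma surj_both_iso X Y (f : 'Hom(X, Y)) (g : 'Hom(Y, X)) :
  surjective_hom f -> surjective_hom g -> iso X Y.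
Proof.
move=> [fA f1] [gA g1].
have := limg_ker_dim f fullv; have := limg_ker_dim g fullv; rewrite !capfv f1 g1.
move=> e1 e2; exists f; split=> //; split=> //.
by apply/eqP; rewrite -dimv_eq0; move: e1 e2; lia.
Qed.

Lemma kron_iso X Y : solo X -> solo Y -> kiso (kron X) (kron Y) -> iso X Y.
Proof.
move=> sX sY [f [g [[fg1 fg2] f0 f1 g0 g1]]].
have [f' [fK f'K]] := lfun_bij_inv f0 f1; have [g' [gK g'K]] := lfun_bij_inv g0 g1.
have fg' : @khom _ (kron Y) (kron X) f' g'.
  by split=> w; apply: (can_inj fK); rewrite ?fg1 ?fg2 f'K g'K.
have [h hs] := kron_surj sX sY (conj fg1 fg2) f1.
have [|h' h's] := kron_surj sY sX fg'.
  by apply/limg_fullP => x; exists (f x).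
exact: surj_both_iso hs h's.
Qed.

Lemma kron_knz X : solo X -> ~ is_zero X -> knz (kron X).
Proof.
move=> [X0 _] nX; rewrite /knz kron_dimV addn_gt0; apply/orP; left.
rewrite lt0n; apply/negP => /eqP Xi; apply: nX; apply: (tdim_zero (B := B)) => l.
by have [->|/X0] := eqVneq l i.
Qed.

End KroneckerPart.

End Rigidity.

(** * The sign of a pair on a block of the quiver *)

Section Counting.
Variables (k : fieldType) (A : falgType k) (Q : quiver) (B : radsq A Q).
Implicit Types (M N X Y Z P : fmod A) (i j l : vert Q) (a b : arr Q).
Local Notation vop := (vop B).
Local Notation aop := (aop B).
Local Notation rad := (rad B).
Local Notation vdim := (vdim B).
Local Notation rdim := (rdim B).
Local Notation tdim := (tdim B).
Local Notation relv := (relv B).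
Local Notation free_at := (free_at B).

Definition bdim M j := \dim (relv M j).

Lemma bdimE M j : (bdim M j + rdim M j = \sum_(a | tgt a == j) tdim M (src a))%N.
Proof. exact: dim_relv. Qed.

Lemma bdim_dsum M N j : bdim (dsum M N) j = (bdim M j + bdim N j)%N.
Proof.
have := bdimE (dsum M N) j; rewrite rdim_dsum.
rewrite (eq_bigr _ (fun a _ => tdim_dsum B M N (src a))) big_split /= -!bdimE; lia.
Qed.

Lemma bdim_iso M N j : iso M N -> bdim M j = bdim N j.
Proof.
move=> MN; have := bdimE M j; have := bdimE N j.
rewrite (rdim_iso B j MN) (eq_bigr _ (fun a _ => tdim_iso B (src a) MN)); lia.
Qed.

Lemma free_bdim M j : free_at M j -> bdim M j = 0%N.
Proof. by move/free_relv0 => e; rewrite /bdim e dimv0. Qed.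

Lemma bdim_free M j : bdim M j = 0%N -> free_at M j.
Proof. by move/eqP; rewrite dimv_eq0 => /eqP; exact: relv0_free. Qed.

Lemma tdim_retract X M l : retract X M -> (tdim X l <= tdim M l)%N.
Proof.
case/retract_summand => Y /(tdim_iso B l) ->; rewrite tdim_dsum; exact: leq_addr.
Qed.

Lemma bdim_retract X M l : retract X M -> (bdim X l <= bdim M l)%N.
Proof.
case/retract_summand => Y /(bdim_iso l) ->; rewrite bdim_dsum; exact: leq_addr.
Qed.

Lemma vdim_retract X M l : retract X M -> (vdim X l <= vdim M l)%N.
Proof.
case/retract_summand => Y /(vdim_iso B l) ->; rewrite vdim_dsum; exact: leq_addr.
Qed.

Lemma tdim_le_vdim M l : (tdim M l <= vdim M l)%N.
Proof. by rewrite -tdimE leq_addr. Qed.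

Lemma retract_projective X P : projective P -> retract X P -> projective X.
Proof.
move=> Pp [i [p [iA pA iK]]] M N g f gs fA.
have [h hA hE] := Pp _ _ g (f \o p)%VF gs (hom_comp fA pA).
exists (h \o i)%VF; first exact: hom_comp.
apply/lfunP => x; rewrite !comp_lfunE -[g (h _)]comp_lfunE hE comp_lfunE iK //.
Qed.

Lemma proj_iso X Y l : projective X -> projective Y ->
  indecomposable X -> indecomposable Y ->
  (0 < tdim X l)%N -> (0 < tdim Y l)%N -> iso X Y.
Proof.
move=> Xp Yp iX iY /exists_top_functional[lX [_ [lXt _ _]]]
  /exists_top_functional[lY [_ [lYt _ _]]].
have Xs := functional_hom (l := (lX : 'Hom(X, simple_mod B l))) lXt.
have Ys := functional_hom (l := (lY : 'Hom(Y, simple_mod B l))) lYt.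
have [f fA fE] := Xp _ _ _ _ Ys (proj1 Xs); have [g gA gE] := Yp _ _ _ _ Xs (proj1 Ys).
apply: (indec_iso_functional iX iY (lX := lX) (lY := lY) (f := f) (g := g)) => //.
- by case: lXt.
- by case: lYt.
- by move=> x; rewrite -[in RHS]fE comp_lfunE.
- by move=> y; rewrite -[in RHS]gE comp_lfunE.
Qed.

(** Some map h from P to A hits the vertex l modulo the radical. If m lies at
    l and is not zero, then the map that sends y to h y . m is not zero. *)
Lemma hom_zero_vdim P M l : projective P -> hom_zero P M -> (0 < tdim P l)%N ->
  vdim M l = 0%N.
Proof.
move=> Pp PM0 /exists_top_functional[lP [x [lPt xl lx]]].
pose c : 'Hom(regmod A, k^o) := linfun (vc B l).
have cE (a : A) : c a = vc B l a by exact: lfunE.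
have vE i (a : A) : vop (regmod A) i a = vx B i * a by exact: lfunE.
have aE b (a : A) : aop (regmod A) b a = ax B b * a by exact: lfunE.
have ct : top_functional B l c.
  split.
  - apply/negP => /eqP/lfunP/(_ (vx B l)); rewrite cE vc_vx eqxx zero_lfunE => /eqP.
    by rewrite oner_eq0.
  - move=> _ /radP[u ->]; rewrite linear_sum big1 // => b _ /=; rewrite cE aE.
    rewrite [u b](coordE B) mulrDr !mulr_sumr linearD !linear_sum /=.
    rewrite !big1 ?addr0 // => i _; rewrite -scalerAr linearZ /=.
      by rewrite ax_mul linear0 ?scaler0.
    by rewrite ax_vx; case: ifP => _; rewrite ?vc_ax ?linear0 ?scaler0.
  - move=> i a; rewrite !cE vE; rewrite {1}(coordE B a) mulrDr !mulr_sumr linearD !linear_sum /=.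
    rewrite [X in _ + X]big1 ?addr0 => [|b _]; last first.
      rewrite -scalerAr linearZ /= vx_ax; case: ifP => _; rewrite ?vc_ax ?linear0 ?scaler0 //.
    rewrite (bigD1 i) //= big1 ?addr0 => [|j ji]; last first.
      by rewrite -scalerAr linearZ /= vx_mul eq_sym (negbTE ji) linear0 ?scaler0.
    rewrite -scalerAr linearZ /= vx_mul eqxx vc_vx eq_sym /GRing.scale /=.
    by case: eqP => [->|_]; rewrite ?mulr1 ?mulr0.
have cs := functional_hom (l := (c : 'Hom(regmod A, simple_mod B l))) ct.
have Ps := functional_hom (l := (lP : 'Hom(P, simple_mod B l))) lPt.
have [h hA hE] := Pp _ _ _ _ cs (proj1 Ps).
suff z (m : M) : vop M l m = 0.
  by apply/eqP; rewrite dimv_eq0 -subv0; apply/subvP => _ /limgP[m ->]; rewrite z mem0v.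
pose m' := vop M l m; pose f : 'Hom(P, M) := linfun (fun y => act M (h y : A) m').
have fE y : f y = act M (h y : A) m'.
  by rewrite /f linfunE // => d u v; rewrite linearP (linearP (act M)) add_lfunE scale_lfunE.
have fA : is_hom f.
  apply/is_homP => a y; rewrite !fE (homE hA) -actME; congr (act M _ _).
  by rewrite lfunE.
have := fE x; rewrite (PM0 f fA) zero_lfunE => /esym hm.
have ch : vc B l (h x : A) = 1 by rewrite -cE -comp_lfunE hE.
have mE : act M (h x : A) m' = m' + \sum_a (ac B a (h x : A) : k) *: aop M a m'.
  rewrite {1}[h x : A](coordE B) linearD !linear_sum add_lfunE !sum_lfunE.
  congr (_ + _); last by apply: eq_bigr => a _; rewrite linearZ scale_lfunE.
  rewrite (bigD1 l) //= big1 ?addr0 => [|i il]; last first.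
    rewrite linearZ scale_lfunE /= -/(vop M i) vop_vop (negbTE il).
    by rewrite scaler0.
  by rewrite linearZ scale_lfunE ch scale1r /= -/(vop M l) vop_id.
have mr : m' \in rad M.
  have /eqP := mE; rewrite hm eq_sym addr_eq0 => /eqP ->.
  by rewrite memvN memv_suml // => a _; rewrite memvZ // aop_rad.
have := mE; rewrite hm big1 ?addr0 // => a _; rewrite (aop_of_rad a mr) scaler0 //.
Qed.

End Counting.

Section Block.
Variables (k : fieldType) (A : falgType k) (Q : quiver) (B : radsq A Q).
Implicit Types (M N X Y Z P : fmod A) (i j l : vert Q) (a b : arr Q).
Local Notation vop := (vop B).
Local Notation aop := (aop B).
Local Notation rad := (rad B).
Local Notation vdim := (vdim B).
Local Notation rdim := (rdim B).
Local Notation tdim := (tdim B).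
Local Notation bdim := (bdim B).
Local Notation relv := (relv B).
Local Notation free_at := (free_at B).

(** The sum of the coordinates at i and j of the g-vector of T. *)
Definition bsign i j (T : mod_pair A) : int :=
  (tdim T.1 i)%:Z + (tdim T.1 j)%:Z - ((bdim T.1 i)%:Z + (bdim T.1 j)%:Z)
  - ((tdim T.2 i)%:Z + (tdim T.2 j)%:Z).

Lemma bsignC i j T : bsign j i T = bsign i j T.
Proof. rewrite /bsign; lia. Qed.

Lemma bsign_iso i j T U : pair_iso T U -> bsign i j T = bsign i j U.
Proof.
move=> [e1 e2]; rewrite /bsign !(tdim_iso B _ e1) !(bdim_iso B _ e1).
by rewrite !(tdim_iso B _ e2).
Qed.

(** As X vanishes at j, the arrows a1 and a2 act by zero, and each contributes
    a copy of the top at i to the relations. *)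
Lemma bdim_double i j a1 a2 X : double i j a1 a2 -> vdim X j = 0%N ->
  (2 * tdim X i <= bdim X j)%N.
Proof.
case=> s1 t1 s2 t2 a12 _ Xj; have := bdimE B X j.
have -> : rdim X j = 0%N by apply/eqP; rewrite -leqn0 -Xj rdim_le.
rewrite addn0 => ->; rewrite (bigD1 a1) ?t1 //= (bigD1 a2) /=; last first.
  by rewrite t2 eqxx eq_sym a12.
by rewrite s1 s2; lia.
Qed.

Section Pair.
Variables (M P : fmod A).
Hypotheses (Mrig : tau_rigid M) (Pproj : projective P) (PM0 : hom_zero P M).

Lemma coherent_pos X l : retract X M -> (0 < tdim M l)%N ->
  free_at X l /\ tdim P l = 0%N.
Proof.
move=> XM tM; split; first exact: sign_coherence Mrig XM (retract_refl M) tM.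
apply/eqP; rewrite -leqn0 leqNgt; apply/negP => /(hom_zero_vdim Pproj PM0) v0.
by have := tdim_le_vdim B M l; rewrite v0; move: tM; lia.
Qed.

Lemma coherent_vdim X l : retract X M -> (0 < tdim P l)%N -> vdim X l = 0%N.
Proof.
move=> XM /(hom_zero_vdim Pproj PM0) v0.
by apply/eqP; rewrite -leqn0 -v0; exact: vdim_retract.
Qed.

Lemma retract_tdim0 X N l : retract X N -> tdim N l = 0%N -> tdim X l = 0%N.
Proof. by move=> /(tdim_retract B l) + e; rewrite e leqn0 => /eqP. Qed.

(** The sign of a summand is that of t - b - p, where t is its top at i, b its
    relations at j, and p the top at j of its projective part. If P has a top
    at j, then M vanishes at j, so b >= 2 t and no summand is positive.
    Otherwise t - b is the difference of the dimensions of a Kronecker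
    representation, and [kext_sign] applies. *)
Lemma bsign_mixed_mul i j a1 a2 X Y PX PY : double i j a1 a2 ->
  (0 < tdim M i)%N -> tdim M j = 0%N ->
  retract X M -> retract Y M -> retract PX P -> retract PY P ->
  0 <= bsign i j (X, PX) * bsign i j (Y, PY).
Proof.
move=> dbl Mi Mj XM YM PXP PYP; rewrite /bsign /=.
have [fX Pi] := coherent_pos XM Mi; have [fY _] := coherent_pos YM Mi.
rewrite (free_bdim fX) (free_bdim fY) (retract_tdim0 XM Mj) (retract_tdim0 YM Mj).
rewrite (retract_tdim0 PXP Pi) (retract_tdim0 PYP Pi).
have [Pj|Pj] := posnP (tdim P j); last first.
  have := bdim_double dbl (coherent_vdim XM Pj).
  have := bdim_double dbl (coherent_vdim YM Pj).
  by move=> bY bX; apply: mulr_le0; lia.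
rewrite (retract_tdim0 PXP Pj) (retract_tdim0 PYP Pj).
have := kext_sign (kron_ext0 (B := B) dbl Mrig XM YM) (kron_ext0 (B := B) dbl Mrig YM XM).
rewrite !kron_dimV !kron_dimW -!/(bdim _ _) => h.
have E (t b : nat) : t%:Z + 0%:Z - (0%:Z + b%:Z) - (0%:Z + 0%:Z) = t%:Z - b%:Z by lia.
rewrite !E.
by move: h; rewrite -lez_nat !PoszD !PoszM; lia.
Qed.

Lemma bsign_mixed_neq0 i j a1 a2 : double i j a1 a2 ->
  (0 < tdim M i)%N -> tdim M j = 0%N -> bsign i j (M, P) <> 0.
Proof.
move=> dbl Mi Mj; have [fM Pi] := coherent_pos (retract_refl M) Mi.
rewrite /bsign /= (free_bdim fM) Mj Pi.
have [Pj|Pj] := posnP (tdim P j); last first.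
  have := bdim_double dbl (coherent_vdim (retract_refl M) Pj); lia.
have ext := kron_ext0 (B := B) dbl Mrig (retract_refl M) (retract_refl M).
have := krigid_neq ext; rewrite /knz kron_dimV kron_dimW -/(bdim _ _).
by rewrite ltn_addr // => /(_ isT)/eqP; lia.
Qed.

End Pair.

Lemma bsign_mul_ge0 i j p1 p2 q1 q2 M P X Y PX PY :
  double i j p1 p2 -> double j i q1 q2 ->
  tau_rigid M -> projective P -> hom_zero P M ->
  retract X M -> retract Y M -> retract PX P -> retract PY P ->
  0 <= bsign i j (X, PX) * bsign i j (Y, PY).
Proof.
move=> dij dji Mrig Pproj PM0 XM YM PXP PYP.
have [Mi|Mi] := posnP (tdim M i); have [Mj|Mj] := posnP (tdim M j).
- apply: mulr_le0; rewrite /bsign /=.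
    by rewrite (retract_tdim0 XM Mi) (retract_tdim0 XM Mj); lia.
  by rewrite (retract_tdim0 YM Mi) (retract_tdim0 YM Mj); lia.
- rewrite -(bsignC i j (X, PX)) -(bsignC i j (Y, PY)).
  exact: (bsign_mixed_mul Mrig Pproj PM0 dji Mj Mi XM YM PXP PYP).
- exact: (bsign_mixed_mul Mrig Pproj PM0 dij Mi Mj XM YM PXP PYP).
have pos Z PZ : retract Z M -> retract PZ P -> 0 <= bsign i j (Z, PZ).
  move=> ZM PZP; rewrite /bsign /=.
  have [fi Pi] := coherent_pos Mrig Pproj PM0 ZM Mi.
  have [fj Pj] := coherent_pos Mrig Pproj PM0 ZM Mj.
  rewrite (free_bdim fi) (free_bdim fj) (retract_tdim0 PZP Pi) (retract_tdim0 PZP Pj).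
  lia.
by apply: mulr_ge0; apply: pos.
Qed.

Lemma bsign_eq0 i j p1 p2 q1 q2 M P :
  double i j p1 p2 -> double j i q1 q2 ->
  tau_rigid M -> projective P -> hom_zero P M -> bsign i j (M, P) = 0 ->
  forall l, l = i \/ l = j -> [/\ tdim M l = 0%N, bdim M l = 0%N & tdim P l = 0%N].
Proof.
move=> dij dji Mrig Pproj PM0 s0.
have [Mi|Mi] := posnP (tdim M i); have [Mj|Mj] := posnP (tdim M j).
- by move: s0; rewrite /bsign /= Mi Mj => s0 l [->|->]; split; lia.
- by case: (bsign_mixed_neq0 Mrig Pproj PM0 dji Mj Mi); rewrite bsignC.
- by case: (bsign_mixed_neq0 Mrig Pproj PM0 dij Mi Mj).
have [fi Pi] := coherent_pos Mrig Pproj PM0 (retract_refl M) Mi.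
have [fj Pj] := coherent_pos Mrig Pproj PM0 (retract_refl M) Mj.
move: s0; rewrite /bsign /= (free_bdim fi) (free_bdim fj) Pi Pj; lia.
Qed.

(** ** The number of summands on a block *)

Section Count.
Variables (i j : vert Q) (p1 p2 q1 q2 : arr Q).
Hypotheses (dij : double i j p1 p2) (dji : double j i q1 q2).
Variables (M P : fmod A).
Hypotheses (Mrig : tau_rigid M) (Pproj : projective P) (PM0 : hom_zero P M).
Hypothesis outside : forall l, l != i -> l != j ->
  [/\ tdim M l = 0%N, bdim M l = 0%N & tdim P l = 0%N].

(** By the last hypothesis, a summand is determined by any vertex of its top. *)
Lemma num_ind_le2 N n : num_ind N n -> (forall l, l != i -> l != j -> tdim N l = 0%N) ->
  (forall l X Y, retract X N -> retract Y N -> indecomposable X -> indecomposable Y ->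
     (0 < tdim X l)%N -> (0 < tdim Y l)%N -> iso X Y) ->
  (n <= (0 < tdim N i) + (0 < tdim N j))%N.
Proof.
move=> [s [sP sI _]] No same.
have sN x : retract (s x) N by apply: summand_retract; case: (sP x).
have top x : (0 < tdim (s x) i)%N \/ (0 < tdim (s x) j)%N.
  have [|si] := posnP (tdim (s x) i); [move=> si|by left].
  have [|sj] := posnP (tdim (s x) j); [move=> sj|by right].
  have [[nz _] _] := sP x; case: nz; apply: (tdim_zero (B := B)) => l.
  have [->//|li] := eqVneq l i; have [->//|lj] := eqVneq l j.
  exact: retract_tdim0 (sN x) (No l li lj).
pose c x := (0 < tdim (s x) i)%N.
have cI : injective c.
  move=> x y; rewrite /c => e; apply: sI.
  have [ix _] := sP x; have [iy _] := sP y.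
  have [sx|sx] := top x; first by apply: (same i) => //; rewrite -e.
  have [sy|sy] := top y; first by apply: (same i) => //; rewrite e.
  exact: (same j).
have le l x : (0 < tdim (s x) l)%N -> (0 < tdim N l)%N.
  by move/leq_trans; apply; exact: tdim_retract.
have le1 : (#|codom c| <= (0 < tdim N i) + (0 < tdim N j))%N.
  have cB (e : bool) : e \in codom c -> (if e then 0 < tdim N i else 0 < tdim N j)%N.
    case/codomP => x ->; rewrite /c; case: ifPn => [|si]; first exact: le.
    by have [sx|/le//] := top x; rewrite sx in si.
  have : (#|codom c| <= (true \in codom c) + (false \in codom c))%N.
    rewrite -!sum1_card big_mkcond /= (bigD1 true) //= (bigD1 false) //= big1 ?addn0.
      by do 2!case: (_ \in _).
    by case.
  move/leq_trans; apply; apply: leq_add.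
    by case E: (true \in _) => //; rewrite (cB _ E).
  by case E: (false \in _) => //; rewrite (cB _ E).
by move: le1; rewrite card_codom // card_ord.
Qed.

Lemma num_ind_proj p : num_ind P p -> (p <= (0 < tdim P i) + (0 < tdim P j))%N.
Proof.
move=> Pp; apply: num_ind_le2 Pp _ _ => [l li lj|l X Y XP YP iX iY].
  by have [] := outside li lj.
exact: proj_iso (retract_projective Pproj XP) (retract_projective Pproj YP) iX iY.
Qed.

Lemma num_ind_free m : num_ind M m ->
  (forall l, bdim M l = 0%N \/ vdim M l = 0%N) ->
  (m <= (0 < tdim M i) + (0 < tdim M j))%N.
Proof.
move=> Mm fM; apply: num_ind_le2 Mm _ _ => [l li lj|l X Y XM YM iX iY].
  by have [] := outside li lj.
have r X' Y' : retract X' M -> retract Y' M -> forall l', free_at X' l' \/ vdim Y' l' = 0%N.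
  move=> XM' YM' l'; case: (fM l') => e; [left|right].
    by apply: bdim_free; apply/eqP; rewrite -leqn0 -e; exact: bdim_retract.
  by apply/eqP; rewrite -leqn0 -e; exact: vdim_retract.
by move=> Xl Yl; apply: free_iso iX iY Xl Yl _ _; exact: r.
Qed.

Lemma num_ind_kron m : num_ind M m -> (0 < tdim M i)%N -> tdim M j = 0%N -> (m <= 2)%N.
Proof.
move=> [s [sP sI _]] Mi Mj; rewrite leqNgt; apply/negP => m3.
have sM x : retract (s x) M by apply: summand_retract; case: (sP x).
have solos x : solo B i j (s x).
  split=> l li.
    have [->|lj] := eqVneq l j; first exact: retract_tdim0 (sM x) Mj.
    by have [t0 _ _] := outside li lj; exact: retract_tdim0 (sM x) t0.
  have [->|lj] := eqVneq l i.
    by case: (coherent_pos Mrig Pproj PM0 (sM x) Mi).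
  have [_ b0 _] := outside lj li; apply: bdim_free; apply/eqP.
  by rewrite -leqn0 -b0; exact: bdim_retract.
pose w (x : 'I_3) := widen_ord m3 x.
apply: (no_three_kreps (s := fun x => kron B i j p1 p2 (s (w x)))) => [x y|x|x|x y].
- exact (kron_ext0 (B := B) dij Mrig (sM (w x)) (sM (w y))).
- by apply: (kron_klocal dij) => //; case: (sP (w x)).
- by apply: kron_knz => //; case: (sP (w x)) => -[].
move/(kron_iso dij (solos _) (solos _))/sI/(congr1 val) => /= e.
exact: val_inj.
Qed.

End Count.

(** If P has a top on the block, or M has tops at both vertices, there are no
    relations that matter and the summands are told apart by the vertices of
    their tops. Otherwise M is given by a Kronecker representation and
    [no_three_kreps] applies. *)
Lemma num_ind_block i j p1 p2 q1 q2 M P m p :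
  double i j p1 p2 -> double j i q1 q2 ->
  tau_rigid M -> projective P -> hom_zero P M ->
  (forall l, l != i -> l != j -> [/\ tdim M l = 0%N, bdim M l = 0%N & tdim P l = 0%N]) ->
  num_ind M m -> num_ind P p -> (m + p <= 2)%N.
Proof.
move=> dij dji Mrig Pproj PM0 out Mm Pp.
have out' l : l != j -> l != i -> [/\ tdim M l = 0%N, bdim M l = 0%N & tdim P l = 0%N].
  by move=> lj li; exact: out.
have pos l : (0 < tdim M l)%N -> bdim M l = 0%N.
  by move=> t; case: (coherent_pos Mrig Pproj PM0 (retract_refl M) t) => /free_bdim.
have v0 l : (0 < tdim P l)%N -> vdim M l = 0%N.
  exact: (coherent_vdim Pproj PM0 (retract_refl M)).
have vt l : vdim M l = 0%N -> tdim M l = 0%N.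
  by move=> e; have := tdim_le_vdim B M l; rewrite e; lia.
have z0 : tdim M i = 0%N -> tdim M j = 0%N -> forall l, bdim M l = 0%N.
  move=> ti tj l; have := bdimE B M l; rewrite [RHS]big1; first by lia.
  move=> a _; have [->//|ai] := eqVneq (src a) i; have [->//|aj] := eqVneq (src a) j.
  by case: (out _ ai aj).
have hP := num_ind_proj Pproj out Pp.
have hM := num_ind_free (P := P) out Mm.
have free : (forall l, l = i \/ l = j -> bdim M l = 0%N \/ vdim M l = 0%N) ->
    (m <= (0 < tdim M i) + (0 < tdim M j))%N.
  move=> H; apply: hM => l; have [li|li] := eqVneq l i; first by apply: H; left.
  have [lj|lj] := eqVneq l j; first by apply: H; right.
  by left; case: (out l li lj).
have [Pi|Pi] := posnP (tdim P i); have [Pj|Pj] := posnP (tdim P j).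
- have [Mi|Mi] := posnP (tdim M i); have [Mj|Mj] := posnP (tdim M j).
  + have := free (fun l _ => or_introl (z0 Mi Mj l)); lia.
  + have := num_ind_kron dji Mrig Pproj PM0 out' Mm Mj Mi; lia.
  + have := num_ind_kron dij Mrig Pproj PM0 out Mm Mi Mj; lia.
  have H : (m <= (0 < tdim M i) + (0 < tdim M j) -> m + p <= 2)%N by lia.
  by apply/H/free => l [->|->]; left; exact: pos.
- have vj := v0 j Pj; have tj := vt j vj.
  have [Mi|Mi] := posnP (tdim M i).
    have := free (fun l _ => or_introl (z0 Mi tj l)); lia.
  have H : (m <= (0 < tdim M i) + (0 < tdim M j) -> m + p <= 2)%N by lia.
  by apply/H/free => l [->|->]; [left; exact: pos|right].
- have vi := v0 i Pi; have ti := vt i vi.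
  have [Mj|Mj] := posnP (tdim M j).
    have := free (fun l _ => or_introl (z0 ti Mj l)); lia.
  have H : (m <= (0 < tdim M i) + (0 < tdim M j) -> m + p <= 2)%N by lia.
  by apply/H/free => l [->|->]; [right|left; exact: pos].
have := vt i (v0 i Pi); have := vt j (v0 j Pj) => tj ti.
have := free (fun l _ => or_introl (z0 ti tj l)); rewrite ti tj; lia.
Qed.

End Block.

(** * Modules with a multiplicity-free top *)

Section MultFree.
Variables (k : fieldType) (A : falgType k) (Q : quiver) (B : radsq A Q).
Implicit Types (M N X Y Z P : fmod A) (i j l : vert Q) (a b : arr Q).
Local Notation vop := (vop B).
Local Notation aop := (aop B).
Local Notation rad := (rad B).
Local Notation vdim := (vdim B).
Local Notation rdim := (rdim B).
Local Notation tdim := (tdim B).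

Lemma tdim_neq0 X : ~ is_zero X -> exists l, (0 < tdim X l)%N.
Proof.
move=> nX; have [/existsP//|/existsPn H] := boolP [exists l, (0 < tdim X l)%N]; case: nX.
by apply: (tdim_zero (B := B)) => l; have := H l; rewrite -eqn0Ngt => /eqP.
Qed.

(** The complement of X in N has no top at l, so the functional vanishes on
    it. *)
Lemma top_functional_retract X N l (lN : 'Hom(N, k^o)) (i : 'Hom(X, N)) (p : 'Hom(N, X)) :
  is_hom i -> is_hom p -> cancel i p -> tdim X l = tdim N l ->
  top_functional B l lN -> forall z, lN (i (p z)) = lN z.
Proof.
move=> iA pA iK t [l0 lr lv] z; have iso_N := retract_ker iA pA iK.
set K := submod _ in iso_N; pose c : 'Hom(K, N) := subincl (submodule_lker pA).
have cA : is_hom c by exact: subincl_hom.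
have tK : tdim K l = 0%N.
  by have := tdim_iso B l iso_N; rewrite tdim_dsum t; lia.
have lc0 : (lN \o c)%VF = 0.
  apply/eqP/negPn/negP => lc; suff : (0 < tdim K l)%N by rewrite tK.
  apply: (top_functional_gt0 (l := (lN \o c)%VF)); split=> // [x xr|j x].
    by rewrite comp_lfunE lr // hom_rad.
  by have := lv j (c x); rewrite -(hom_vop B cA) !comp_lfunE.
have zk : z - i (p z) \in lker p by rewrite memv_ker linearB /= iK subrr.
apply/eqP; rewrite eq_sym -subr_eq0 -linearB /=; apply/eqP.
have -> : z - i (p z) = c (vsproj (lker p) (z - i (p z))).
  by rewrite /c subinclE vsproj_id.
have /lfunP/(_ (vsproj (lker p) (z - i (p z)))) := lc0.
by rewrite comp_lfunE zero_lfunE.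
Qed.

Lemma retract_same_top X Y N l : retract X N -> retract Y N ->
  indecomposable X -> indecomposable Y -> (0 < tdim N l)%N ->
  tdim X l = tdim N l -> tdim Y l = tdim N l -> iso X Y.
Proof.
move=> [i [p [iA pA iK]]] [j [q [jA qA jK]]] iX iY N0 tX tY.
have [lN [x [lNt _ _]]] := exists_top_functional N0.
have lNX := top_functional_retract iA pA iK tX lNt.
have lNY := top_functional_retract jA qA jK tY lNt.
have nz Z (h : 'Hom(Z, N)) (r : 'Hom(N, Z)) : (forall z, lN (h (r z)) = lN z) ->
    (lN \o h)%VF != 0.
  move=> lhr; case: lNt => l0 _ _; apply: contra l0 => /eqP/lfunP lh0.
  by apply/eqP/lfunP => z; rewrite -lhr -comp_lfunE lh0 !zero_lfunE.
apply: (indec_iso_functional iX iY (lX := (lN \o i)%VF) (lY := (lN \o j)%VF)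
         (f := (q \o i)%VF) (g := (p \o j)%VF)); try exact: hom_comp.
- exact: nz lNX.
- exact: nz lNY.
- by move=> z; rewrite !comp_lfunE lNY.
- by move=> z; rewrite !comp_lfunE lNX.
Qed.

Lemma basic_mult_free N : (forall l, tdim N l <= 1)%N -> basic N.
Proof.
move=> N1 X Y Z [nX _] _ NXYZ XY; have [l Xl] := tdim_neq0 nX.
have := N1 l; rewrite (tdim_iso B l NXYZ) !tdim_dsum -(tdim_iso B l XY); lia.
Qed.

(** By [retract_same_top], an indecomposable summand with a top at i is
    isomorphic to L i. *)
Lemma num_ind_mult_free N (S : {set vert Q}) (L : vert Q -> fmod A) :
  (forall l, tdim N l = (l \in S)) ->
  (forall i, i \in S -> retract (L i) N) ->
  (forall i l, i \in S -> tdim (L i) l = (l == i)) ->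
  num_ind N #|S|.
Proof.
move=> NS LN Lt.
have Lindec i : i \in S -> indecomposable (L i).
  move=> iS; split=> [/is_zeroP L0|X Y LXY].
    have : (0 < tdim (L i) i)%N by rewrite Lt // eqxx.
    by case/tdim_gt0P => y; rewrite (L0 (vop _ _ _)) mem0v.
  have t l : (tdim X l + tdim Y l = (l == i))%N.
    by rewrite -tdim_dsum -(tdim_iso B l LXY) Lt.
  have [Xi|Xi] := posnP (tdim X i); [left|right]; apply: (tdim_zero (B := B)) => l;
    have := t l; have := t i; rewrite eqxx; have [->|li] := eqVneq l i; lia.
have LS : forall x : 'I_#|S|, enum_val x \in S by move=> x; exact: enum_valP.
exists (fun x => L (enum_val x)); split=> [x|x y e|X iX /summand_retract XN].
- by split; [exact: Lindec|exact: retract_summand (LN _ (LS x))].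
- apply: enum_val_inj; apply/eqP; rewrite eq_sym.
  have := tdim_iso B (enum_val y) e; rewrite !Lt // eqxx.
  by case: eqP.
have [nX _] := iX; have [l Xl] := tdim_neq0 nX.
have := tdim_retract B l XN; rewrite NS; case lS : (l \in S); last by lia.
move=> X1; exists (enum_rank_in lS l); rewrite enum_rankK_in //.
apply: (retract_same_top XN (LN l lS) iX (Lindec l lS) (l := l)); rewrite ?NS ?lS //.
  by move: Xl X1; case: (tdim X l) => [|[]].
by rewrite Lt // eqxx.
Qed.

End MultFree.

(** * Path modules *)

Section PathModules.
Variables (k : fieldType) (A : falgType k) (Q : quiver) (B : radsq A Q).
Implicit Types (M N X Y Z P : fmod A) (i j l : vert Q) (a b : arr Q).
Local Notation vop := (vop B).
Local Notation aop := (aop B).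
Local Notation rad := (rad B).
Local Notation vdim := (vdim B).
Local Notation rdim := (rdim B).
Local Notation tdim := (tdim B).

Section OnePath.
Variables (S0 : pred (vert Q)) (S1 : pred (arr Q)).

Definition pidx : finType := ({i | S0 i} + {a | S1 a && S0 (src a)})%type.
Definition pvec : vectType k := {ffun pidx -> k^o}.

Definition ptgt (t : pidx) : vert Q :=
  match t with inl x => val x | inr a => tgt (val a) end.

Definition pev i : 'End(pvec) :=
  linfun (fun u : pvec => [ffun t => if i == ptgt t then u t else 0] : pvec).

Lemma pevE i u : pev i u = [ffun t => if i == ptgt t then u t else 0].
Proof.
rewrite /pev linfunE // => c v w; apply/ffunP => t; rewrite !ffunE.
by case: ifP => // _; rewrite scaler0 addr0.
Qed.

Definition pgen i : pvec :=
  [ffun t => if t is inl x then ((val x == i)%:R : k^o) else 0].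
Definition parr a : pvec :=
  [ffun t => if t is inr b then ((val b == a)%:R : k^o) else 0].

Definition pcf i (u : pvec) : k^o :=
  if insub i : {? i | S0 i} is Some x then u (inl x) else 0.

Lemma pcf_linear i : linear (pcf i).
Proof.
move=> c u v; rewrite /pcf; case: insub => [x|]; first by rewrite !ffunE.
by rewrite scaler0 addr0.
Qed.

Definition pea a : 'End(pvec) := linfun (fun u : pvec => (pcf (src a) u : k) *: parr a).

Lemma peaE a u : pea a u = (pcf (src a) u : k) *: parr a.
Proof.
rewrite /pea linfunE // => c v w.
by rewrite pcf_linear scalerDl scalerA.
Qed.

Lemma pcf_pev i j u : pcf i (pev j u) = if j == i then pcf i u else 0.
Proof.
rewrite /pcf pevE; case: insubP => [x _ xi|_]; last by rewrite if_same.
by rewrite ffunE /= xi.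
Qed.

Lemma pcf_parr i a : pcf i (parr a) = 0.
Proof. by rewrite /pcf; case: insub => [x|] //; rewrite ffunE. Qed.

Lemma pev_parr i a : pev i (parr a) = if i == tgt a then parr a else 0.
Proof.
rewrite pevE; apply/ffunP => -[x|b]; rewrite [LHS]ffunE /=.
  by rewrite !ffunE if_same; case: ifP => _; rewrite ffunE.
rewrite ffunE; have [ba|ba] := eqVneq (val b) a.
  by rewrite ba; case: ifP => _; rewrite ffunE ?ba ?eqxx.
by rewrite if_same; case: ifP => _; rewrite ffunE ?(negbTE ba).
Qed.

Lemma pevv i j u : pev i (pev j u) = if i == j then pev i u else 0.
Proof.
rewrite !pevE; apply/ffunP => t; rewrite !ffunE.
have [->|ij] := eqVneq i j; rewrite !ffunE /=; first by case: (j == ptgt t).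
by have [<-|_] := eqVneq j (ptgt t); rewrite ?(negbTE ij) ?if_same.
Qed.

Lemma pev1 u : \sum_i pev i u = u.
Proof.
apply/ffunP => t; rewrite sum_ffunE (bigD1 (ptgt t)) //= big1 ?addr0 => [|i it].
  by rewrite pevE ffunE eqxx.
by rewrite pevE ffunE (negbTE it).
Qed.

Lemma peva i a u : pev i (pea a u) = if i == tgt a then pea a u else 0.
Proof. by rewrite peaE linearZ /= pev_parr; case: ifP => // _; rewrite scaler0. Qed.

Lemma peav a i u : pea a (pev i u) = if i == src a then pea a u else 0.
Proof. by rewrite !peaE pcf_pev; case: ifP => // _; rewrite scale0r. Qed.

Lemma peaa a b u : pea a (pea b u) = 0.
Proof.
rewrite !peaE; pose f := linfun (pcf (src a)) : 'Hom(pvec, k^o).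
have -> : pcf (src a) (pcf (src b) u *: parr b) = f ((pcf (src b) u : k) *: parr b).
  by rewrite /f linfunE //; exact: pcf_linear.
by rewrite linearZ /= /f linfunE ?pcf_parr ?scaler0 ?scale0r //; exact: pcf_linear.
Qed.

(** The module with one generator for each vertex in S0, on which an arrow
    starting in S0 acts freely if it lies in S1 and by zero otherwise. With
    all arrows in S1 it is projective; with S0 the complement of E, and S1 the
    arrows that avoid E, it is A / A e A for e the sum of the vertices in E. *)
Definition pmod : fmod A := rep_mod B pevv pev1 peva peav peaa.

Lemma vop_pmod i (u : pmod) : vop pmod i u = [ffun t => if i == ptgt t then u t else 0] :> pvec.
Proof. by rewrite vop_rep pevE. Qed.
Lemma aop_pmod a (u : pmod) : aop pmod a u = (pcf (src a) u : k) *: parr a :> pvec.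
Proof. by rewrite aop_rep peaE. Qed.

Lemma vop_parr i a :
  vop pmod i (parr a : pvec) = (if i == tgt a then parr a else 0) :> pvec.
Proof. by rewrite vop_rep pev_parr. Qed.

Lemma pcf_pgen i : pcf i (pgen i) = (S0 i)%:R.
Proof.
rewrite /pcf; case: insubP => [x Si xi|/negbTE->//]; by rewrite ffunE xi eqxx Si.
Qed.

Lemma parr0 a : ~~ (S1 a && S0 (src a)) -> parr a = 0.
Proof.
move=> na; apply/ffunP => -[x|b]; rewrite !ffunE //; case: eqP => // e.
by case/negP: na; rewrite -e (valP b).
Qed.

Lemma aop_pgen a : aop pmod a (pgen (src a) : pvec) = parr a :> pvec.
Proof.
rewrite aop_pmod pcf_pgen; case: (boolP (S0 (src a))) => [_|ns]; first by rewrite scale1r.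
by rewrite scale0r parr0 // negb_and ns orbT.
Qed.

Lemma vop_pgen i j : vop pmod i (pgen j : pvec) = (if i == j then pgen j else 0) :> pvec.
Proof.
rewrite vop_pmod; case: eqP => [->|/eqP ij]; apply/ffunP => -[x|b]; rewrite !ffunE ?if_same //=.
  by case: eqP => // /eqP jx; rewrite eq_sym (negbTE jx).
by case: eqP => // <-; rewrite (negbTE ij).
Qed.

Lemma pgen0 i : ~~ S0 i -> pgen i = 0.
Proof.
move=> ni; apply/ffunP => -[x|b]; rewrite !ffunE //; case: eqP => // e.
by case/negP: ni; rewrite -e (valP x).
Qed.

Lemma pvecE (u : pvec) : u = \sum_(x : {i | S0 i}) (u (inl x) : k) *: pgen (val x)
  + \sum_(b : {a | S1 a && S0 (src a)}) (u (inr b) : k) *: parr (val b).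
Proof.
apply/ffunP => -[x|b]; rewrite ffunE !sum_ffunE.
  rewrite [X in _ + X]big1 ?addr0 => [|b _]; last by rewrite !ffunE scaler0.
  rewrite (bigD1 x) //= big1 ?addr0 => [|y yx].
    by rewrite !ffunE eqxx /GRing.scale /= mulr1.
  by rewrite !ffunE (inj_eq val_inj) eq_sym (negbTE yx) scaler0.
rewrite [X in X + _]big1 ?add0r => [|x _]; last by rewrite !ffunE scaler0.
rewrite (bigD1 b) //= big1 ?addr0 => [|y yb].
  by rewrite !ffunE eqxx /GRing.scale /= mulr1.
by rewrite !ffunE (inj_eq val_inj) eq_sym (negbTE yb) scaler0.
Qed.

Lemma pmod_hom_eq M (f g : 'Hom(pmod, M)) : is_hom f -> is_hom g ->
  (forall i, S0 i -> f (pgen i : pvec) = g (pgen i : pvec)) -> f = g.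
Proof.
move=> fA gA fg; apply/lfunP => u.
have fg' i : f (pgen i : pvec) = g (pgen i : pvec).
  by have [/fg//|/pgen0->] := boolP (S0 i); rewrite !linear0.
have fa a : f (parr a : pvec) = g (parr a : pvec).
  by rewrite -aop_pgen (hom_aop B fA) (hom_aop B gA) fg'.
rewrite (pvecE u) !linearD !linear_sum; congr (_ + _);
  by apply: eq_bigr => x _; rewrite !linearZ /= ?fg' ?fa.
Qed.

(** The relations of the path module are that the arrows outside S1 act by
    zero on its generators. *)
Lemma pmod_hom M (m : vert Q -> M) :
  (forall i, S0 i -> vop M i (m i) = m i) ->
  (forall a, S0 (src a) -> ~~ S1 a -> aop M a (m (src a)) = 0) ->
  exists2 h : 'Hom(pmod, M), is_hom h & forall i, S0 i -> h (pgen i : pvec) = m i.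
Proof.
move=> mv ma.
pose h : 'Hom(pmod, M) := linfun (fun u : pvec =>
  \sum_(x : {i | S0 i}) (u (inl x) : k) *: m (val x)
  + \sum_(b : {a | S1 a && S0 (src a)}) (u (inr b) : k) *: aop M (val b) (m (src (val b)))).
have hE (u : pvec) : h u = \sum_(x : {i | S0 i}) (u (inl x) : k) *: m (val x)
  + \sum_(b : {a | S1 a && S0 (src a)}) (u (inr b) : k) *: aop M (val b) (m (src (val b))).
  rewrite /h linfunE // => c v w; rewrite scalerDr !scaler_sumr addrACA -!big_split /=.
  by congr (_ + _); apply: eq_bigr => x _; rewrite !ffunE scalerDl scalerA.
have hg i : S0 i -> h (pgen i : pvec) = m i.
  move=> Si; rewrite hE [X in _ + X]big1 ?addr0 => [|b _]; last by rewrite ffunE scale0r.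
  rewrite (bigD1 (exist S0 i Si)) //= big1 ?addr0 => [|y yx]; rewrite !ffunE /=.
    by rewrite eqxx scale1r.
  by rewrite -(inj_eq val_inj) /= in yx; rewrite (negbTE yx) scale0r.
have ha a : h (parr a : pvec) = if S0 (src a) then aop M a (m (src a)) else 0.
  have [Sa|nS] := boolP (S1 a && S0 (src a)); last first.
    rewrite parr0 // linear0; case: ifP => // s0; rewrite ma //.
    by rewrite s0 andbT in nS.
  rewrite hE [X in X + _]big1 ?add0r => [|b _]; last by rewrite ffunE scale0r.
  have s0 : S0 (src a) by case/andP: Sa.
  pose sa : {a | S1 a && S0 (src a)} := exist (fun a => S1 a && S0 (src a)) a Sa.
  rewrite (bigD1 sa) //= big1 ?addr0 => [|y yx]; rewrite !ffunE /=.
    by rewrite eqxx scale1r s0.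
  by rewrite -(inj_eq val_inj) /= in yx; rewrite (negbTE yx) scale0r.
exists h => //; apply: (hom_of_ops (B := B)) => [i u|a u].
  rewrite (pvecE u) !linearD !linear_sum; congr (_ + _); apply: eq_bigr => -[x Sx] _.
    rewrite !linearZ /= vop_pgen hg // -(mv x Sx) vop_vop.
    by case: ifP => [/eqP->|_]; rewrite ?hg ?mv ?linear0.
  rewrite !linearZ /= vop_parr ha; have /andP[_ s0] := Sx; rewrite s0 vop_aop.
  by case: ifP => _; rewrite ?ha ?s0 ?linear0.
rewrite aop_pmod linearZ /= ha.
rewrite [u in RHS](pvecE u) !linearD !linear_sum /= [X in _ = _ + X]big1 ?addr0 => [|b _]; last first.
  rewrite !linearZ /= ha; case: ifP => _; rewrite ?aop_aop ?linear0 ?scaler0 //.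
have term (x : {i | S0 i}) : aop M a (h ((u (inl x) : k) *: (pgen (val x) : pvec))) =
    if src a == val x then (u (inl x) : k) *: aop M a (m (val x)) else 0.
  rewrite !linearZ /= hg ?(valP x) // -{1}(mv _ (valP x)) aop_vop eq_sym.
  by case: eqP => // _; rewrite scaler0.
rewrite (eq_bigr _ (fun x _ => term x)) /pcf.
case: insubP => [x Sx xs|nS]; last first.
  rewrite scale0r big1 // => x _; case: eqP => // e.
  by case/negP: nS; rewrite e (valP x).
rewrite (bigD1 x) //= big1 ?addr0 => [|y yx]; first by rewrite xs eqxx Sx.
by rewrite -xs (inj_eq val_inj) eq_sym (negbTE yx).
Qed.

End OnePath.

End PathModules.

Section PathModules2.
Variables (k : fieldType) (A : falgType k) (Q : quiver) (B : radsq A Q).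
Implicit Types (M N X Y Z P : fmod A) (i j l : vert Q) (a b : arr Q).
Local Notation vop := (vop B).
Local Notation aop := (aop B).
Local Notation rad := (rad B).
Local Notation vdim := (vdim B).
Local Notation rdim := (rdim B).
Local Notation tdim := (tdim B).
Local Notation bdim := (bdim B).
Local Notation pmod := (pmod B).
Local Notation pgen := (@pgen k Q _ _).
Local Notation parr := (@parr k Q _ _).
Local Notation pvec := (@pvec k Q).

Section Dimensions.
Variables (S0 : pred (vert Q)) (S1 : pred (arr Q)).
Local Notation C := (pmod S0 S1).

Lemma dim_scalar_if (c : bool) :
  \dim (limg (if c then \1%VF else 0 : 'End(k^o))) = c.
Proof. by case: c; rewrite ?lim1g ?dimvf // lim0g dimv0. Qed.

Lemma sum_sig (I : finType) (S : pred I) (F : I -> nat) :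
  (\sum_(x : {i | S i}) F (val x) = \sum_(i | S i) F i)%N.
Proof.
rewrite (reindex_omap (val : {i | S i} -> I) insub) => [|i Si]; last by rewrite insubT.
by apply: eq_bigl => x; rewrite (valP x) valK eqxx.
Qed.

Lemma vdim_pmod i : vdim C i =
  (S0 i + \sum_(a | S1 a && S0 (src a)) (tgt a == i))%N.
Proof.
rewrite vdimE.
rewrite (dim_diag (g := fun t : pidx S0 S1 => if i == ptgt t then \1%VF else 0 : 'End(k^o))); last first.
  move=> u; rewrite vop_pmod; apply/ffunP => t; rewrite !ffunE.
  by case: ifP; rewrite ?id_lfunE ?zero_lfunE.
rewrite big_sumType /=; congr (_ + _)%N.
  rewrite (eq_bigr (fun x => (i == val x) : nat)) => [|x _]; last exact: dim_scalar_if.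
  rewrite (sum_sig S0 (fun x => (i == x) : nat)).
  have [Si|Si] := boolP (S0 i).
    rewrite (bigD1 i) //= eqxx big1 // => j /andP[_ ji].
    by rewrite eq_sym (negbTE ji).
  by rewrite big1 // => j Sj; case: eqP => // e; rewrite e Sj in Si.
rewrite (eq_bigr (fun x => (tgt (val x) == i) : nat)) => [|x _].
  by rewrite (sum_sig (fun a => S1 a && S0 (src a)) (fun a => (tgt a == i) : nat)).
by rewrite [tgt _ == _]eq_sym; exact: dim_scalar_if.
Qed.

Lemma rad_pmod_inl (u : C) (x : {i | S0 i}) : u \in rad C -> (u : pvec S0 S1) (inl x) = 0.
Proof.
case/radP => v ->.
have H (s : seq (arr Q)) : (\sum_(a <- s) aop C a (v a) : pvec S0 S1) (inl x) = 0.
  elim: s => [|a s IHs]; first by rewrite big_nil ffunE.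
  rewrite big_cons ffunE IHs addr0 aop_pmod !ffunE; exact: scaler0.
exact: H.
Qed.

Lemma parr_rad a : (parr a : pvec S0 S1) \in rad C.
Proof. by have := aop_rad B (M := C) a (pgen (src a) : pvec S0 S1); rewrite aop_pgen. Qed.

Lemma rdim_pmod i : rdim C i = (\sum_(a | S1 a && S0 (src a)) (tgt a == i))%N.
Proof.
pose g (t : pidx S0 S1) : 'End(k^o) :=
  if (if t is inr b then i == tgt (val b) else false) then \1%VF else 0.
pose D : 'End(pvec S0 S1) :=
  linfun (fun u : pvec S0 S1 => [ffun t => g t (u t)] : pvec S0 S1).
have DE u : D u = [ffun t => g t (u t)].
  rewrite /D linfunE // => c v w; apply/ffunP => t; rewrite !ffunE.
  by rewrite linearP.
have -> : rdim C i = \dim (limg D).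
  congr (\dim _); apply/vspaceP => u; apply/memv_imgP/limgP => [[v vr ->]|[v ->]].
    exists v; rewrite vop_pmod DE; apply/ffunP => -[x|b]; rewrite !ffunE /g /=.
      by rewrite (rad_pmod_inl x vr) zero_lfunE if_same.
    by case: ifP; rewrite ?id_lfunE ?zero_lfunE.
  exists (\sum_(b : {a | S1 a && S0 (src a)}) (v (inr b) : k) *: (parr (val b) : pvec S0 S1)).
    by apply: memv_suml => b _; rewrite memvZ // parr_rad.
  rewrite vop_pmod DE; apply/ffunP => -[x|b]; rewrite !ffunE /g /=.
    by rewrite sum_ffunE big1 ?if_same ?zero_lfunE // => b _; rewrite !ffunE scaler0.
  rewrite sum_ffunE (bigD1 b) //= big1 ?addr0 => [|y yb].
    rewrite !ffunE eqxx /GRing.scale /= mulr1.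
    by case: ifP; rewrite ?id_lfunE ?zero_lfunE.
  by rewrite !ffunE (inj_eq val_inj) eq_sym (negbTE yb) scaler0.
rewrite (dim_diag DE) big_sumType /= big1 ?add0n => [|x _]; last exact: (dim_scalar_if false).
rewrite (eq_bigr (fun x => (tgt (val x) == i) : nat)) => [|x _].
  by rewrite (sum_sig (fun a => S1 a && S0 (src a)) (fun a => (tgt a == i) : nat)).
by rewrite [tgt _ == _]eq_sym /g; exact: dim_scalar_if.
Qed.

Lemma tdim_pmod i : tdim C i = S0 i.
Proof. by apply/eqP; rewrite -(eqn_add2r (rdim C i)) tdimE vdim_pmod rdim_pmod. Qed.

Lemma bdim_pmod j : (bdim C j + \sum_(a | S1 a && S0 (src a)) (tgt a == j) =
  \sum_(a | tgt a == j) S0 (src a))%N.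
Proof.
have := bdimE B C j; rewrite rdim_pmod => ->.
by apply: eq_bigr => a _; rewrite tdim_pmod.
Qed.

Lemma pgen_vop i : vop C i (pgen i : pvec S0 S1) = (pgen i : pvec S0 S1).
Proof. by rewrite vop_pgen eqxx. Qed.

Lemma pmod_projective : (forall a, S0 (src a) -> S1 a) -> projective C.
Proof.
move=> S01 M N g f [gA g1] fA.
have H i : exists m, g m = f (pgen i : pvec S0 S1) by exact: (limg_fullP _).2.
have [m mP] := fin_all_exists H.
have [h hA hE] : exists2 h : 'Hom(C, M), is_hom h &
    forall i, S0 i -> h (pgen i : pvec S0 S1) = vop M i (m i).
  apply: pmod_hom => [i _|a Sa]; first by rewrite vop_id.
  by rewrite S01.
exists h => //; apply: (pmod_hom_eq (B := B)) => //; first exact: hom_comp.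
move=> i Si; rewrite comp_lfunE hE // (hom_vop B gA) mP -(hom_vop B fA).
by rewrite pgen_vop.
Qed.

End Dimensions.

Lemma pmod_retract (S0 : pred (vert Q)) S1 i : S0 i ->
  retract (pmod (pred1 i) S1) (pmod S0 S1).
Proof.
move=> Si.
have [f fA fE] : exists2 f : 'Hom(pmod (pred1 i) S1, pmod S0 S1), is_hom f &
    forall l, pred1 i l -> f (pgen l : pvec (pred1 i) S1) = (pgen l : pvec S0 S1).
  apply: pmod_hom => [l _|a /eqP sa na]; first exact: pgen_vop.
  by rewrite [LHS](aop_pgen B) parr0 // negb_and na.
have [g gA gE] : exists2 g : 'Hom(pmod S0 S1, pmod (pred1 i) S1), is_hom g &
    forall l, S0 l -> g (pgen l : pvec S0 S1) = (pgen l : pvec (pred1 i) S1).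
  apply: pmod_hom => [l _|a sa na]; first exact: pgen_vop.
  by rewrite [LHS](aop_pgen B) parr0 // negb_and na.
exists f, g; split=> // x.
have e : (g \o f)%VF = \1%VF.
  apply: (pmod_hom_eq (B := B)); [exact: hom_comp|exact: hom_id|].
  by move=> l /[dup] /eqP-> li; rewrite comp_lfunE id_lfunE fE ?gE //=.
by rewrite -comp_lfunE e id_lfunE.
Qed.

Lemma num_ind_pmod (S0 : {set vert Q}) S1 : num_ind (pmod (mem S0) S1) #|S0|.
Proof.
apply: (num_ind_mult_free (B := B) (L := fun i => pmod (pred1 i) S1)) => [l|i iS|i l iS].
- by rewrite tdim_pmod.
- exact: pmod_retract.
- by rewrite tdim_pmod.
Qed.

Lemma basic_pmod (S0 : pred (vert Q)) S1 : basic (pmod S0 S1).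
Proof. by apply: (basic_mult_free (B := B)) => l; rewrite tdim_pmod leq_b1. Qed.

Lemma pmod_hom_zero (S0 : pred (vert Q)) S1 M : (forall i, S0 i -> vdim M i = 0%N) -> hom_zero (pmod S0 S1) M.
Proof.
move=> v0 f fA; apply: (pmod_hom_eq (B := B)) => // [|i Si]; first exact: hom_zero_is_hom.
by rewrite zero_lfunE -pgen_vop (hom_vop B fA) vdim_eq0 ?v0.
Qed.

(** ** Rigidity of path modules *)

(** Every xi from P to A is the sum of the h t followed by right
    multiplication by a t, where h t is the coordinate at the generator t and
    a t lies in e_t A. Then u m xi is the sum of the u (a t m) (h t), and a t
    m = 0 because M vanishes at t. *)
Lemma hom_nakayama_zero (R : pred (vert Q)) M :
  (forall t, R t -> vdim M t = 0%N) -> hom_zero M (nakayama (pmod R predT)).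
Proof.
set P := pmod R predT => v0 u uA; apply/lfunP => m; rewrite zero_lfunE.
apply/lfunP => xi; rewrite zero_lfunE.
have xiA : is_hom (vsval xi) := elimT (hom_spaceP _) (subvsP xi).
have vE i (a : A) : vop (regmod A) i a = vx B i * a by exact: lfunE.
have ex t : exists h : hom_reg P, forall l, R l ->
    vsval h (pgen l : pvec R predT) = (if l == t then vx B t else 0) :> A.
  have [h hA hE] : exists2 h : 'Hom(P, regmod A), is_hom h &
      forall l, R l -> h (pgen l : pvec R predT) = (if l == t then vx B t else 0) :> A.
    apply: pmod_hom => // l _; rewrite vE; case: eqP => [->|_]; last exact: mulr0.
    by rewrite vx_mul eqxx.
  exists (vsproj _ h) => l Rl; rewrite vsproj_id; first exact: hE.
  exact/hom_spaceP.
have [h hE] := fin_all_exists ex.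
pose a t : A := if R t then vsval xi (pgen t : pvec R predT) else 0.
have xiE : xi = \sum_t rmul P (a t) (h t).
  apply: val_inj; apply: (pmod_hom_eq (B := B)) => // [|l Rl].
    exact: elimT (hom_spaceP _) (subvsP _).
  transitivity ((\sum_t vsval (rmul P (a t) (h t)))%R (pgen l : pvec R predT)); last first.
    by rewrite -linear_sum.
  rewrite sum_lfunE (bigD1 l) //= big1 => [|t tl].
    rewrite addr0.
    transitivity ((vsval (h l) (pgen l : pvec R predT) : A) * a l); last first.
      exact (esym (rmulE (M := P) (a l) (h l) (pgen l : pvec R predT))).
    rewrite hE // eqxx /a Rl -vE -(hom_vop B xiA).
    by congr (vsval xi _); symmetry; exact: pgen_vop.
  transitivity ((vsval (h t) (pgen l : pvec R predT) : A) * a t).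
    exact (rmulE (M := P) (a t) (h t) (pgen l : pvec R predT)).
  by rewrite hE // eq_sym (negbTE tl) mul0r.
rewrite xiE linear_sum big1 // => t _ /=.
have -> : u m (rmul P (a t) (h t)) = act (nakayama P) (a t) (u m) (h t).
  by rewrite [act (nakayama P) _ _](lfunE (nak_fun (M := P) (a t))) /= /nak_fun comp_lfunE.
rewrite -(homE uA).
have -> : a t = vx B t * a t.
  rewrite /a; case: ifP => [Rt|]; last by rewrite mulr0.
  by rewrite -vE -(hom_vop B xiA) pgen_vop.
rewrite actME /a; case: ifP => [Rt|_].
  by rewrite [act M (vx B t) _](vdim_eq0 (v0 t Rt)) linear0 zero_lfunE.
by rewrite linear0 !zero_lfunE linear0 linear0 zero_lfunE.
Qed.

Lemma nakayama_map_hom M N (p : 'Hom(M, N)) : is_hom p -> is_hom (nakayama_map p).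
Proof.
move=> pA; apply/is_homP => a phi.
rewrite [act (nakayama M) _ _](lfunE (nak_fun (M := M) a)) /= /nak_fun.
rewrite [act (nakayama N) _ _](lfunE (nak_fun (M := N) a)) /= /nak_fun.
rewrite !(lfunE (nak_map_fun p)) /= /nak_map_fun -!comp_lfunA; congr comp_lfun.
apply/lfunP => h; apply: val_inj; apply/lfunP => x.
by rewrite !comp_lfunE /= rmulE !precompE // !comp_lfunE rmulE.
Qed.

Section Rigid.
Variables (S0 : pred (vert Q)) (S1 : pred (arr Q)).
Local Notation C := (pmod S0 S1).
Local Notation F := (pmod S0 predT).

(** The arrows that give the relations of the path module. *)
Definition killed a := S0 (src a) && ~~ S1 a.
(** The tops of the projective that covers these relations. *)
Definition ktops t := [exists a, killed a && (tgt a == t)].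
Local Notation F1 := (pmod ktops predT).

Hypothesis tgt_inj : forall a b, killed a -> killed b -> tgt a = tgt b -> a = b.
Hypothesis killed_vdim : forall a, killed a -> vdim C (tgt a) = 0%N.

Lemma pvec_coord (T0 : pred (vert Q)) (T1 : pred (arr Q)) I (r : seq I) (c : I -> k)
    (f : I -> pvec T0 T1) t :
  (\sum_(x <- r) c x *: f x) t = \sum_(x <- r) c x * (f x t : k).
Proof. by rewrite sum_ffunE; apply: eq_bigr => x _; rewrite ffunE. Qed.

(** In the minimal presentation P1 -> P0 -> C, the tops of P1 lie at vertices
    where C vanishes. So Hom(C, nu P1) = 0, and tau C is a submodule of nu P1. *)
Lemma pmod_tau_rigid : tau_rigid C.
Proof.
pose m t : F := if [pick a | killed a && (tgt a == t)] is Some a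
                then (parr a : pvec S0 predT) else (0 : pvec S0 predT).
have mE b : killed b -> m (tgt b) = (parr b : pvec S0 predT).
  move=> kb; rewrite /m; case: pickP => [a /andP[ka /eqP e]|/(_ b)].
    by rewrite (tgt_inj ka kb e).
  by rewrite kb eqxx.
have ktopsE t : ktops t -> exists2 a, killed a & tgt a = t.
  by case/existsP => a /andP[ka /eqP e]; exists a.
have [p1 p1A p1E] : exists2 p1 : 'Hom(F1, F), is_hom p1 &
    forall t, ktops t -> p1 (pgen t : pvec ktops predT) = m t.
  apply: pmod_hom => // t /ktopsE[a ka <-].
  by rewrite mE // vop_parr eqxx.
have [p0 p0A p0E] : exists2 p0 : 'Hom(F, C), is_hom p0 &
    forall i, S0 i -> p0 (pgen i : pvec S0 predT) = (pgen i : pvec S0 S1).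
  by apply: pmod_hom => // i _; exact: pgen_vop.
have p0a a : p0 (parr a : pvec S0 predT) = (parr a : pvec S0 S1).
  have [sa|ns] := boolP (S0 (src a)); last first.
    by rewrite !parr0 ?negb_and ?ns ?orbT // linear0.
  rewrite -(aop_pgen B) (hom_aop B p0A) p0E //.
  exact: (aop_pgen B).
have p1a b : p1 (parr b : pvec ktops predT) = 0.
  have [sb|ns] := boolP (ktops (src b)); last first.
    by rewrite parr0 ?negb_and ?ns ?orbT // linear0.
  rewrite -(aop_pgen B) (hom_aop B p1A) p1E //.
  have [a ka <-] := ktopsE _ sb; rewrite mE // aop_of_rad //.
  exact: parr_rad.
have p1l t : ktops t -> p0 (m t) = 0.
  move=> /ktopsE[a ka <-]; rewrite mE // p0a parr0 //.
  by rewrite negb_and; case/andP: ka => _ ->.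
have p01 x : p0 (p1 x) = 0.
  have e : (p0 \o p1)%VF = 0.
    apply: (pmod_hom_eq (B := B)); [exact: hom_comp|exact: hom_zero_is_hom|].
    by move=> t kt; rewrite comp_lfunE p1E // p1l // zero_lfunE.
  by rewrite -comp_lfunE e zero_lfunE.
have p0u (u : pvec S0 predT) : p0 u = (\sum_(x : {i | S0 i}) (u (inl x) : k) *: (pgen (val x) : pvec S0 S1)
    + \sum_(b : {a | predT a && S0 (src a)}) (u (inr b) : k) *: (parr (val b) : pvec S0 S1)) :> pvec S0 S1.
  rewrite {1}(pvecE u) linearD !linear_sum; congr (_ + _); apply: eq_bigr => x _.
    by rewrite linearZ /= p0E // (valP x).
  by rewrite linearZ /= p0a.
have ker_inl (u : pvec S0 predT) x : p0 u = 0 -> u (inl x) = 0.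
  move=> pu; have := p0u u; rewrite pu => /esym/ffunP/(_ (inl x)).
  rewrite !ffunE !pvec_coord [X in _ + X]big1 ?addr0 => [|b _]; last by rewrite ffunE mulr0.
  rewrite (bigD1 x) //= big1 ?addr0 => [|y yx]; first by rewrite ffunE eqxx mulr1.
  by rewrite ffunE (inj_eq val_inj) eq_sym (negbTE yx) mulr0.
have ker_inr (u : pvec S0 predT) (c : {a | predT a && S0 (src a)}) : p0 u = 0 -> ~~ killed (val c) -> u (inr c) = 0.
  move=> pu nk; have [_ sb] := andP (valP c).
  have Sb : S1 (val c) && S0 (src (val c)).
    by move: nk; rewrite /killed sb /= negbK => ->.
  have := p0u u; rewrite pu => /esym/ffunP/(_ (inr (exist _ (val c) Sb))).
  rewrite !ffunE !pvec_coord [X in X + _]big1 ?add0r => [|y _]; last by rewrite ffunE mulr0.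
  rewrite (bigD1 c) //= big1 ?addr0 => [|y yb]; first by rewrite ffunE /= eqxx mulr1.
  by rewrite ffunE /= (inj_eq val_inj) eq_sym (negbTE yb) mulr0.
have kerE (u : pvec S0 predT) : p0 u = 0 ->
    u = \sum_(b : {a | predT a && S0 (src a)}) (u (inr b) : k) *: (parr (val b) : pvec S0 predT).
  move=> pu; rewrite {1}(pvecE u) big1 ?add0r // => x _.
  by rewrite ker_inl // scale0r.
have p0s : surjective_hom p0.
  split=> //; apply: (surj_of_top (B := B)) => // u.
  exists (\sum_(x : {i | S0 i}) ((u : pvec S0 S1) (inl x) : k) *: (pgen (val x) : pvec S0 predT)).
  rewrite linear_sum {1}(pvecE (u : pvec S0 S1)).
  rewrite [X in _ - X](eq_bigr (fun x : {i | S0 i} =>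
    ((u : pvec S0 S1) (inl x) : k) *: (pgen (val x) : pvec S0 S1))) => [|x _]; last first.
    by rewrite linearZ /= p0E // (valP x).
  rewrite addrAC subrr add0r memv_suml // => b _; rewrite memvZ //.
  exact: parr_rad.
have p10 : limg p1 = lker p0.
  apply/vspaceP => u; rewrite memv_ker; apply/limgP/eqP => [[x ->]|pu]; first exact: p01.
  have : u \in limg p1.
    rewrite (kerE u pu); apply: memv_suml => b _.
    have [kb|nk] := boolP (killed (val b)); last by rewrite ker_inr // scale0r mem0v.
    rewrite memvZ //; apply/limgP; exists (pgen (tgt (val b)) : pvec ktops predT).
    by rewrite p1E ?mE //; apply/existsP; exists (val b); rewrite kb eqxx.
  by move/limgP.
have k0 : (lker p0 <= rad F)%VS.
  apply/subvP => u; rewrite memv_ker => /eqP/kerE->; apply: memv_suml => b _.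
  by rewrite memvZ // parr_rad.
have k1 : (lker p1 <= rad F1)%VS.
  apply/subvP => u; rewrite memv_ker => /eqP pu.
  have e : p1 u = (\sum_(x : {i | ktops i}) ((u : pvec ktops predT) (inl x) : k) *: (m (val x) : pvec S0 predT)) :> pvec S0 predT.
    rewrite {1}(pvecE (u : pvec ktops predT)) linearD !linear_sum /= [X in _ + X]big1 ?addr0 => [|b _].
      by apply: eq_bigr => x _; rewrite linearZ /= p1E // (valP x).
    by rewrite linearZ /= p1a scaler0.
  rewrite (pvecE (u : pvec ktops predT)) big1 ?add0r => [|x _].
    by apply: memv_suml => b _; rewrite memvZ // parr_rad.
  suff -> : (u : pvec ktops predT) (inl x) = 0 by rewrite scale0r.
  have [a ka ta] := ktopsE _ (valP x).
  have Sa : predT a && S0 (src a) by case/andP: (ka) => ->.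
  move: e; rewrite pu => /esym/ffunP/(_ (inr (exist _ a Sa))).
  rewrite pvec_coord ffunE (bigD1 x) //= big1 ?addr0 => [|y yx].
    by rewrite -ta mE // ffunE eqxx mulr1.
  have [b kb tb] := ktopsE _ (valP y); rewrite -tb mE // ffunE /=.
  case: eqP => [ab|_]; last by rewrite mulr0.
  by case/eqP: yx; apply: val_inj; rewrite -tb -ta ab.
have nA := nakayama_map_hom p1A.
exists (submod (submodule_lker nA)).
  exists F1, F, p1, p0; split.
    split=> //; first by split; apply: pmod_projective.
    by split; [exact: superfluous_rad k0|exact: superfluous_rad k1].
  exists (subincl (submodule_lker nA)); last exact: limg_subincl.
  by split; [exact: subincl_hom|apply/lker_eq0P => x; exact: subincl_inj].
move=> f fA; have z : hom_zero C (nakayama F1).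
  by apply: hom_nakayama_zero => t /ktopsE[a ka <-]; exact: killed_vdim.
have := z _ (hom_comp (subincl_hom (submodule_lker nA)) fA) => /lfunP e.
apply/lfunP => x; rewrite zero_lfunE; apply: (subincl_inj (stU := submodule_lker nA)).
by have := e x; rewrite comp_lfunE zero_lfunE.
Qed.

End Rigid.

End PathModules2.

(** * The quotient of a path algebra by the square of the arrow ideal *)

Section Presentation.
Variables (k : fieldType) (Q : quiver) (A : falgType k).
Variable pi : {rmorphism path_alg k Q -> A}.
Hypothesis pi_scalable : scalable pi.
Hypothesis pi_surj : forall a : A, exists x, pi x = a.
Hypothesis pi_ker : forall x, pi x = 0 <-> arrow_ideal_sq x.

Local Notation path_alg := (path_alg k Q).

Local Transparent of_path.

Lemma coeff_of_path (p q : qpath Q) : (of_path p : path_alg)@_q = (p == q)%:R.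
Proof. by rewrite /of_path mcoeffU. Qed.

Definition deg_ge n (x : path_alg) := forall p, (size (parrows p) < n)%N -> x@_p = 0.

Lemma deg_ge0 n : deg_ge n 0.
Proof. by move=> p _; exact: mcoeff0. Qed.

Lemma deg_geD n x y : deg_ge n x -> deg_ge n y -> deg_ge n (x + y).
Proof. by move=> hx hy p sp; rewrite mcoeffD hx ?hy ?addr0. Qed.

Lemma deg_geZ n c x : deg_ge n x -> deg_ge n (c *: x).
Proof. by move=> hx p sp; rewrite mcoeffZ hx ?mulr0. Qed.

Lemma deg_ge_path n p : (n <= size (parrows p))%N -> deg_ge n (of_path p).
Proof.
move=> np q qn; rewrite coeff_of_path; case: eqP => // e.
by move: qn; rewrite -e ltnNge np.
Qed.

Lemma deg_ge_sum n (I : Type) (r : seq I) (F : I -> path_alg) :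
  (forall i, deg_ge n (F i)) -> deg_ge n (\sum_(i <- r) F i).
Proof.
move=> hF; elim: r => [|i r IHr]; first by rewrite big_nil; exact: deg_ge0.
by rewrite big_cons; exact: deg_geD.
Qed.

Lemma deg_geM m n x y : deg_ge m x -> deg_ge n y -> deg_ge (m + n) (x * y).
Proof.
move=> hx hy; rewrite -[x * y]/(path_mulr y x) {1}(path_algE x) linear_sum.
apply: deg_ge_sum => p; rewrite linearZ /=.
have [lp|lp] := ltnP (size (parrows p)) m.
  by rewrite hx // scale0r; exact: deg_ge0.
apply: deg_geZ; rewrite /path_mulr {1}(path_algE y) linear_sum.
apply: deg_ge_sum => q; rewrite linearZ /=.
have [lq|lq] := ltnP (size (parrows q)) n.
  by rewrite hy // scale0r; exact: deg_ge0.
apply: deg_geZ; rewrite path_mulUU.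
have [e|ne] := eqVneq (pstart p) (pend q); last by rewrite pcompN //; exact: deg_ge0.
have [r -> rE] := pcompP e; apply: deg_ge_path.
by rewrite /parrows rE /= size_cat addnC leq_add.
Qed.

Lemma arrow_ideal_deg (x : path_alg) : arrow_ideal x -> deg_ge 1 x.
Proof.
elim=> [|x' y _ hx _ hy|a x' b [c ->]]; [exact: deg_ge0|exact: deg_geD|].
have h : deg_ge (0 + 1 + 0) (a * of_path (arr_path c) * b).
  by apply: deg_geM => //; apply: deg_geM => //; exact: deg_ge_path.
by move: h; rewrite addn0 add0n.
Qed.

Lemma arrow_ideal_sq_deg (x : path_alg) : arrow_ideal_sq x -> deg_ge 2 x.
Proof.
elim=> [|x' y _ hx _ hy|a x' b [u [v [hu hv ->]]]]; [exact: deg_ge0|exact: deg_geD|].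
have h : deg_ge (0 + (1 + 1) + 0) (a * (u * v) * b).
  apply: deg_geM => //; apply: deg_geM => //.
  by apply: deg_geM; exact: arrow_ideal_deg.
by move: h; rewrite addn0 add0n.
Qed.

Definition pvx i : A := pi (of_path (triv_path i)).
Definition pax a : A := pi (of_path (arr_path a)).

Lemma pax_mul a b : pax a * pax b = 0.
Proof.
have gen c : arrow_ideal (of_path (arr_path c) : path_alg).
  by rewrite -[of_path _]mulr1 -[of_path _]mul1r; apply: ideal_genM; exists c.
rewrite /pax -rmorphM; apply/pi_ker.
rewrite -[X in arrow_ideal_sq X]mulr1 -[X in arrow_ideal_sq (X * _)]mul1r.
by apply: ideal_genM; exists (of_path (arr_path a)), (of_path (arr_path b)).
Qed.

Lemma pi_long (p : qpath Q) : (1 < size (parrows p))%N -> pi (of_path p) = 0.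
Proof.
case: p => -[i [|a [|b s]]] //= w _; set p := QPath _.
have /and3P[/eqP sa /eqP sb ws] := w.
pose r : qpath Q := @QPath Q (tgt b, s) ws.
have [|ba baE baV] := @pcompP Q (arr_path b) (arr_path a); first by [].
have [|t tE tV] := @pcompP Q r ba.
  by rewrite /pend /pstart /parrows baV.
have -> : p = t.
  by apply: val_inj; rewrite tV /= /pstart /parrows baV /= -sa.
have := of_pathM k r ba; rewrite tE /= => <-.
have := of_pathM k (arr_path b) (arr_path a); rewrite baE /= => <-.
have ba0 : pi (of_path (arr_path b) * of_path (arr_path a)) = 0.
  exact: etrans (rmorphM pi _ _) (pax_mul b a).
by apply: etrans (rmorphM pi _ _) _; rewrite ba0 mulr0.
Qed.

Lemma pi_lift_ex a : exists x : path_alg, pi x == a.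
Proof. by have [x <-] := pi_surj a; exists x. Qed.

Definition pi_lift a : path_alg := xchoose (pi_lift_ex a).

Lemma pi_liftK a : pi (pi_lift a) = a.
Proof. exact/eqP/(xchooseP (pi_lift_ex a)). Qed.

(** The square of the arrow ideal only involves paths of length at least 2. *)
Lemma coeff_pi (p : qpath Q) x y : (size (parrows p) <= 1)%N -> pi x = pi y -> x@_p = y@_p.
Proof.
move=> sp e; have : arrow_ideal_sq (x - y) by apply/pi_ker; rewrite rmorphB e subrr.
move/arrow_ideal_sq_deg/(_ p sp) => /eqP.
by rewrite mcoeffB subr_eq0 => /eqP.
Qed.

Definition pcoord (p : qpath Q) (a : A) : k^o := (pi_lift a)@_p.

Lemma pcoord_pi p x : (size (parrows p) <= 1)%N -> pcoord p (pi x) = x@_p.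
Proof. by move=> sp; apply: coeff_pi => //; rewrite pi_liftK. Qed.

Lemma pcoord_linear p : (size (parrows p) <= 1)%N -> linear (pcoord p).
Proof.
move=> sp c a b.
have e : pi (c *: pi_lift a + pi_lift b) = c *: a + b.
  by rewrite rmorphD pi_scalable !pi_liftK.
by rewrite -{1}e pcoord_pi // mcoeffD mcoeffZ.
Qed.

Definition pcoord_lin p (sp : (size (parrows p) <= 1)%N) : {linear A -> k^o} :=
  HB.pack (pcoord p) (GRing.isLinear.Build k A k^o _ (pcoord p) (pcoord_linear sp)).

Definition pvc i := @pcoord_lin (triv_path i) isT.
Definition pac a := @pcoord_lin (arr_path a) isT.

Lemma pvcE i x : pvc i (pi x) = x@_(triv_path i).
Proof. exact: pcoord_pi. Qed.
Lemma pacE a x : pac a (pi x) = x@_(arr_path a).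
Proof. exact: pcoord_pi. Qed.

Lemma triv_path_inj i j : (triv_path i == triv_path j :> qpath Q) = (i == j).
Proof. by rewrite -val_eqE /= xpair_eqE eqxx andbT. Qed.
Lemma arr_path_inj a b : (arr_path a == arr_path b :> qpath Q) = (a == b).
Proof.
rewrite -val_eqE /= xpair_eqE eqseq_cons andbT.
by have [->|_] := eqVneq a b; rewrite ?eqxx ?andbF.
Qed.
Lemma triv_arr_path i a : (triv_path i == arr_path a :> qpath Q) = false.
Proof. by rewrite -val_eqE /= xpair_eqE andbF. Qed.

Lemma pcoordE x : x = \sum_i (pvc i x : k) *: pvx i + \sum_a (pac a x : k) *: pax a.
Proof.
have [y <-] := pi_surj x.
under eq_bigr => i _ do rewrite pvcE.
under [X in _ + X]eq_bigr => a _ do rewrite pacE.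
pose z : path_alg := \sum_i y@_(triv_path i) *: of_path (triv_path i)
                   + \sum_a y@_(arr_path a) *: of_path (arr_path a).
have zE : pi z = \sum_i y@_(triv_path i) *: pvx i + \sum_a y@_(arr_path a) *: pax a.
  by rewrite rmorphD !rmorph_sum; congr (_ + _); apply: eq_bigr => t _; rewrite pi_scalable.
rewrite -zE; apply/eqP; rewrite -subr_eq0 -rmorphB; apply/eqP.
rewrite (path_algE (y - z)) rmorph_sum big1_seq // => p _.
rewrite pi_scalable; have [lp|lp] := ltnP 1 (size (parrows p)).
  by rewrite pi_long // scaler0.
suff -> : (y - z)@_p = 0 by rewrite scale0r.
apply/eqP; rewrite mcoeffB subr_eq0 /z mcoeffD.
rewrite (raddf_sum (mcoeff p)) (raddf_sum (mcoeff p)) /=.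
under eq_bigr => i _ do rewrite mcoeffZ coeff_of_path.
under [X in _ + X]eq_bigr => a _ do rewrite mcoeffZ coeff_of_path.
case: p lp => -[i [|a [|b s]]] //= w _.
  have -> : @QPath Q (i, [::]) w = triv_path i by exact: val_inj.
  rewrite [X in _ + X]big1 ?addr0 => [|a _]; last first.
    by rewrite eq_sym triv_arr_path mulr0.
  rewrite (bigD1 i) //= eqxx mulr1 big1 ?addr0 // => j ji.
  by rewrite triv_path_inj (negbTE ji) mulr0.
have -> : @QPath Q (i, [:: a]) w = arr_path a.
  by apply: val_inj; rewrite /=; move: w => /=; rewrite andbT => /eqP ->.
rewrite [X in X + _]big1 ?add0r => [|j _]; last by rewrite triv_arr_path mulr0.
rewrite (bigD1 a) //= eqxx mulr1 big1 ?addr0 // => b ba.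
by rewrite arr_path_inj (negbTE ba) mulr0.
Qed.

Lemma pi_comp (p q r : qpath Q) : pstart p = pend q ->
  val r = (pstart q, parrows q ++ parrows p) -> pi (of_path p) * pi (of_path q) = pi (of_path r).
Proof.
move=> e rE; have [t tE tV] := pcompP e.
by rewrite -rmorphM of_pathM tE /=; congr (pi (of_path _)); apply: val_inj; rewrite tV rE.
Qed.

Lemma pi_ncomp (p q : qpath Q) : pstart p != pend q -> pi (of_path p) * pi (of_path q) = 0.
Proof. by move=> ne; rewrite -rmorphM of_pathM pcompN //= rmorph0. Qed.

Definition presentation : radsq A Q.
Proof.
apply: (@RadSq k A Q pvx pax _ _ _ _ pax_mul pvc pac pcoordE).
- move=> i j; case: eqP => [->|/eqP ne]; last by rewrite /pvx pi_ncomp.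
  exact: pi_comp.
- by rewrite -rmorph_sum -[RHS](rmorph1 pi).
- move=> i a; case: eqP => [->|/eqP ne]; last by rewrite /pvx /pax pi_ncomp.
  exact: pi_comp.
- move=> a i; rewrite eq_sym; case: eqP => [e|/eqP ne]; last by rewrite /pvx /pax pi_ncomp.
  by apply: pi_comp; rewrite // -e.
- by move=> i j; rewrite pvcE coeff_of_path triv_path_inj eq_sym.
- by move=> i a; rewrite pvcE coeff_of_path eq_sym triv_arr_path.
- by move=> a i; rewrite pacE coeff_of_path triv_arr_path.
- by move=> a b; rewrite pacE coeff_of_path arr_path_inj eq_sym.
Defined.

End Presentation.

(** * Signs and connected components *)

Section Examples.
Variables (k : fieldType) (A : falgType k) (Q : quiver) (B : radsq A Q).
Implicit Types (M N X Y Z P : fmod A) (i j l : vert Q) (a b : arr Q).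
Local Notation vdim := (vdim B).
Local Notation tdim := (tdim B).
Local Notation bdim := (bdim B).
Local Notation pmod := (pmod B).

Local Notation pgen := (@pgen k Q _ _).

Lemma regmod_pmod : iso (regmod A) (pmod (mem [set: vert Q]) predT).
Proof.
set T := mem _; set C := pmod T predT.
have TT i : T i by exact: in_setT.
pose g1 : C := \sum_i (pgen i : pvec k T predT).
have [f fA fE] : exists2 f : 'Hom(C, regmod A), is_hom f &
    forall i, T i -> f (pgen i : pvec k T predT) = vx B i :> A.
  by apply: pmod_hom => // i _; rewrite [LHS]lfunE /= vx_mul eqxx.
pose g : 'Hom(regmod A, C) := linfun (fun a : A => act C a g1).
have gE (a : A) : g a = act C a g1.
  by rewrite /g linfunE // => c u v; rewrite linearP add_lfunE scale_lfunE.
have gA : is_hom g.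
  apply/is_homP => a b; rewrite (gE b) -actME -(gE (a * b)).
  by congr (g _); exact: lfunE.
apply: (@iso_of_inv _ _ _ _ g f) => // [a|u].
  rewrite gE (homE fA) linear_sum.
  rewrite (eq_bigr (vx B)) => [|i _]; last exact: fE.
  by rewrite vx_sum [LHS]lfunE /= mulr1.
have e : (g \o f)%VF = \1%VF.
  apply: (pmod_hom_eq (B := B)); [exact: hom_comp|exact: hom_id|move=> i _].
  rewrite comp_lfunE id_lfunE fE // gE linear_sum (bigD1 i) //= big1 ?addr0 => [|j ji].
    exact: (pgen_vop B).
  by have := vop_pgen B T predT i j; rewrite eq_sym (negbTE ji).
by rewrite -comp_lfunE e id_lfunE.
Qed.

Lemma num_ind_regmod : num_ind (regmod A) #|vert Q|.
Proof.
by rewrite -cardsT; apply: num_ind_iso (iso_sym regmod_pmod) _; exact: num_ind_pmod.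
Qed.

(** ** Examples of support tau-tilting pairs *)

Section VertexSet.
Variable E : {set vert Q}.

Definition inside a := (src a \notin E) && (tgt a \notin E).
Definition outer : pred (vert Q) := mem (~: E).
(** The pair (A / A e A, A e), where e is the sum of the vertices in E. *)
Definition vpair : mod_pair A := (pmod outer inside, pmod (mem E) predT).

Lemma outerE i : outer i = (i \notin E).
Proof. exact: in_setC. Qed.

Lemma vdim_vpair i : i \in E -> vdim vpair.1 i = 0%N.
Proof.
move=> iE; rewrite vdim_pmod outerE iE /= big1 // => a /andP[/andP[_ ta] _].
by case: eqP => // e; rewrite e iE in ta.
Qed.

Lemma bdim_vpair j : j \notin E -> bdim vpair.1 j = 0%N.
Proof.
move=> jE; have := bdim_pmod B outer inside j.
have -> : (\sum_(a | inside a && outer (src a)) (tgt a == j) =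
          \sum_(a | tgt a == j) outer (src a))%N.
  rewrite big_mkcond [RHS]big_mkcond; apply: eq_bigr => a _ /=.
  rewrite /inside !outerE; case: eqP => [->|_]; last by case: ifP.
  by rewrite jE andbT andbb; case: ifP.
by move/eqP; rewrite -[X in _ == X]add0n eqn_add2r => /eqP.
Qed.

Hypothesis one_arrow : forall a b, src a \notin E -> tgt a \in E ->
  src b \notin E -> tgt b \in E -> tgt a = tgt b -> a = b.

Lemma vpair_support_tau_tilting : support_tau_tilting vpair.
Proof.
split; last first.
  exists #|~: E|, #|E|, #|vert Q|; split; [exact: num_ind_pmod..|exact: num_ind_regmod|].
  by rewrite addnC cardsC.
have kE a : killed outer inside a -> src a \notin E /\ tgt a \in E.
  by rewrite /killed /inside !outerE; case: (src a \in E) => //=; rewrite negbK.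
split; first exact: basic_pmod.
- exact: basic_pmod.
- apply: pmod_tau_rigid => [a b /kE[sa ta] /kE[sb tb]|a /kE[sa ta]].
    exact: one_arrow.
  exact: vdim_vpair.
- exact: pmod_projective.
- by apply: (pmod_hom_zero (B := B)) => i iE; exact: vdim_vpair.
Qed.

Lemma bsign_vpair_pos i j : i \notin E -> j \notin E -> 0 < bsign B i j vpair.
Proof.
move=> iE jE; rewrite /bsign !bdim_vpair // !tdim_pmod !outerE iE jE.
by rewrite /= (negbTE iE) (negbTE jE).
Qed.

Lemma bsign_vpair_neg i j : i \in E -> j \in E -> bsign B i j vpair < 0.
Proof.
move=> iE jE; rewrite /bsign !tdim_pmod !outerE iE jE /= iE jE; lia.
Qed.

End VertexSet.

(** ** Mutation preserves signs *)

Section Mutation.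
Variables (i j i' j' : vert Q) (p1 p2 q1 q2 p1' p2' q1' q2' : arr Q).
Hypotheses (dij : double i j p1 p2) (dji : double j i q1 q2).
Hypotheses (dij' : double i' j' p1' p2') (dji' : double j' i' q1' q2').
Hypothesis cover : forall l, l != i' -> l != j' -> l = i \/ l = j.
Hypothesis card4 : #|vert Q| = 4%N.

(** Otherwise U vanishes on the block {i, j}, and it has at most two
    indecomposable summands instead of three. *)
Lemma almost_bsign_neq0 (U : mod_pair A) : almost_support_tau_tilting U -> bsign B i j U <> 0.
Proof.
case: U => M P [[_ _ Mrig Pproj PM0] [m [p [n [Mm Pp An mpn]]]]] s0.
have n4 := num_ind_uniq An num_ind_regmod; rewrite card4 in n4.
have out l : l != i' -> l != j' -> [/\ tdim M l = 0%N, bdim M l = 0%N & tdim P l = 0%N].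
  by move=> li lj; apply: (bsign_eq0 dij dji Mrig Pproj PM0 s0); exact: cover.
have := num_ind_block dij' dji' Mrig Pproj PM0 out Mm Pp; lia.
Qed.

(** The signs of U and T do not vanish, and they are not opposite. *)
Lemma summand_bsign (U T : mod_pair A) : almost_support_tau_tilting U ->
  support_tau_tilting T -> pair_summand U T ->
  (0 < bsign B i j U) = (0 < bsign B i j T).
Proof.
case: U T => [X PX] [M P] Ualm [[_ _ Mrig Pproj PM0] _].
move=> [/summand_retract UM /summand_retract UP].
have sU := almost_bsign_neq0 Ualm.
rewrite /= in Mrig Pproj PM0 UM UP.
have ge0 := bsign_mul_ge0 B dij dji Mrig Pproj PM0 UM (retract_refl M) UP (retract_refl P).
have sT : bsign B i j (M, P) <> 0.
  move=> sT; have z := bsign_eq0 dij dji Mrig Pproj PM0 sT.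
  apply: sU; have [ti bi ri] := z i (or_introl erefl); have [tj bj rj] := z j (or_intror erefl).
  have le0 (a b : nat) : (a <= b)%N -> b = 0%N -> a = 0%N by lia.
  rewrite /bsign /= (le0 _ _ (tdim_retract B i UM)) // (le0 _ _ (tdim_retract B j UM)) //.
  rewrite (le0 _ _ (bdim_retract B i UM)) // (le0 _ _ (bdim_retract B j UM)) //.
  by rewrite (le0 _ _ (tdim_retract B i UP)) // (le0 _ _ (tdim_retract B j UP)).
move: ge0 sU sT; set x := bsign _ _ _ _; set y := bsign _ _ _ _ => ge0 /eqP x0 /eqP y0.
have [xp|xn|xe] := ltrgtP 0 x; last by rewrite -xe eqxx in x0.
  by move: ge0; rewrite pmulr_rge0 // le_eqVlt eq_sym (negbTE y0) /= => ->.
by move: ge0; rewrite nmulr_rge0 // => yn; apply/esym/negbTE; rewrite -leNgt.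
Qed.

Lemma component_bsign (X Y : stau_tilt A) : same_component X Y ->
  (0 < bsign B i j (sval X)) = (0 < bsign B i j (sval Y)).
Proof.
elim=> {X Y} [X Y [XY|[[XT YT _ [U [Ualm UX UY]]] _]]|X|X Y _ ->|X Y Z _ -> _ ->] //.
  by rewrite (bsign_iso B i j XY).
by rewrite -(summand_bsign Ualm XT UX) (summand_bsign Ualm YT UY).
Qed.

End Mutation.

End Examples.

(** * The quiver with nine arrows *)

Definition arrow9 n (lt : (n < 9)%N) : arr quiver9 := Ordinal lt.

Lemma arrow9_cases (P : arr quiver9 -> Prop) :
  P (@arrow9 0 isT) -> P (@arrow9 1 isT) -> P (@arrow9 2 isT) -> P (@arrow9 3 isT) ->
  P (@arrow9 4 isT) -> P (@arrow9 5 isT) -> P (@arrow9 6 isT) -> P (@arrow9 7 isT) ->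
  P (@arrow9 8 isT) -> forall a, P a.
Proof.
move=> h0 h1 h2 h3 h4 h5 h6 h7 h8 [n lt].
have E m (ltm : (m < 9)%N) : m = n -> P (arrow9 ltm) -> P (Ordinal lt).
  move=> e; rewrite /arrow9; have -> // : Ordinal ltm = Ordinal lt by exact: val_inj.
case: n lt E => [|[|[|[|[|[|[|[|[|n]]]]]]]]] // lt E;
  [exact: E h0|exact: E h1|exact: E h2|exact: E h3|exact: E h4|exact: E h5
  |exact: E h6|exact: E h7|exact: E h8].
Qed.

Lemma double12 : @double quiver9 v1 v2 (@arrow9 0 isT) (@arrow9 1 isT).
Proof.
by split=> //; elim/arrow9_cases => // _ _; [left|right].
Qed.

Lemma double21 : @double quiver9 v2 v1 (@arrow9 2 isT) (@arrow9 3 isT).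
Proof. by split=> //; elim/arrow9_cases => // _ _; [left|right]. Qed.

Lemma double34 : @double quiver9 v3 v4 (@arrow9 5 isT) (@arrow9 6 isT).
Proof. by split=> //; elim/arrow9_cases => // _ _; [left|right]. Qed.

Lemma double43 : @double quiver9 v4 v3 (@arrow9 7 isT) (@arrow9 8 isT).
Proof. by split=> //; elim/arrow9_cases => // _ _; [left|right]. Qed.

Lemma vertex9_cases (l : vert quiver9) : [\/ l = v1, l = v2, l = v3 | l = v4].
Proof.
case: l => -[|[|[|[|n]]]] lt //; [apply: Or41|apply: Or42|apply: Or43|apply: Or44];
  exact: val_inj.
Qed.

(** The union of the block {1, 2}, if b holds, and the block {3, 4}, if c
    holds. *)
Definition blocks (b c : bool) : {set vert quiver9} :=
  [set l : 'I_4 | if (l < 2)%N then b else c].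

(** The only arrow between the two blocks is 2 -> 3. *)
Lemma blocks_one_arrow b c (a a' : arr quiver9) :
  src a \notin blocks b c -> tgt a \in blocks b c ->
  src a' \notin blocks b c -> tgt a' \in blocks b c -> tgt a = tgt a' -> a = a'.
Proof.
have H (x : arr quiver9) : src x \notin blocks b c -> tgt x \in blocks b c ->
    x = @arrow9 4 isT.
  by elim/arrow9_cases: x; rewrite !inE /=; case: b; case: c.
by move=> h1 h2 h3 h4 _; rewrite (H _ h1 h2) (H _ h3 h4).
Qed.

Theorem theorem3p10 (k : fieldType) (A : falgType k)
    (pi : {rmorphism path_alg k quiver9 -> A})
    (pi_scalable : scalable pi)
    (pi_surj : forall a : A, exists x, pi x = a)
    (pi_ker : forall x, pi x = 0 <-> arrow_ideal_sq x) :
  at_least_components A 4.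
Proof.
pose B := presentation pi_scalable pi_surj pi_ker.
have card4 : #|vert quiver9| = 4%N by exact: card_ord.
pose X b c : stau_tilt A := exist _ (vpair B (blocks b c))
  (vpair_support_tau_tilting B (@blocks_one_arrow b c)).
exists (fun n : 'I_4 => X (odd n) (1 < n)%N) => n n' XX.
have pos12 b c : (0 < bsign B v1 v2 (sval (X b c))) = ~~ b.
  case: b; last by rewrite bsign_vpair_pos ?inE.
  by apply/negbTE; rewrite -leNgt ltW // bsign_vpair_neg ?inE.
have pos34 b c : (0 < bsign B v3 v4 (sval (X b c))) = ~~ c.
  case: c; last by rewrite bsign_vpair_pos ?inE.
  by apply/negbTE; rewrite -leNgt ltW // bsign_vpair_neg ?inE.
have e12 : odd n = odd n'.
  apply/negb_inj; rewrite -(pos12 _ (1 < n)%N) -(pos12 _ (1 < n')%N).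
  have cov (l : vert quiver9) : l != v3 -> l != v4 -> l = v1 \/ l = v2.
    by case: (vertex9_cases l) => ->; [left|right|..].
  exact (component_bsign B double12 double21 double34 double43 cov card4 XX).
have e34 : (1 < n)%N = (1 < n')%N.
  apply/negb_inj; rewrite -(pos34 (odd n)) -(pos34 (odd n')).
  have cov (l : vert quiver9) : l != v1 -> l != v2 -> l = v3 \/ l = v4.
    by case: (vertex9_cases l) => ->; [..|left|right].
  exact (component_bsign B double34 double43 double12 double21 cov card4 XX).
apply: val_inj; case: n n' e12 e34 {XX} => -[|[|[|[|n]]]] lt [[|[|[|[|n']]]] lt'] //.
Qed.
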